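(* There exist $\mu>0$ and $n_0\in\mathbb{N}$ such that for every $n\ge n_0$, every Dirac graph $G$ on $n$ vertices and every $\mu n$-bounded colouring of $E(G)$, the graph $G$ contains a rainbow Hamilton cycle.
   Context: A Dirac graph is a graph $G$ on $n$ vertices with minimum degree $\delta(G)\ge n/2$. An edge-colouring of a graph is $k$-bounded if no colour appears on more than $k$ edges. A subgraph is rainbow if no two of its edges have the same colour. *)

(* Defs.v *)
From mathcomp Require Import all_boot all_order all_algebra.
Set Implicit Arguments. Unset Strict Implicit. Unset Printing Implicit Defensive.

Definition simple_graph (n : nat) (G : rel 'I_n) : Prop :=
  symmetric G /\ irreflexive G.

Definition deg (n : nat) (G : rel 'I_n) (v : 'I_n) : nat := #|[set u | G v u]|.

Definition dirac (n : nat) (G : rel 'I_n) : Prop :=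
  forall v : 'I_n, n <= 2 * deg G v.

Definition edges (n : nat) (G : rel 'I_n) : {set {set 'I_n}} :=
  [set e : {set 'I_n} | [exists x, exists y, G x y && (e == [set x; y])]].

(* An edge-colouring col : E(G) -> C (values outside E(G) irrelevant) is
   k-bounded if no colour appears on more than k edges; k = mu * n real. *)
Definition bounded_colouring (n : nat) (G : rel 'I_n) (C : eqType)
    (col : {set 'I_n} -> C) (k : rat) : Prop :=
  forall c : C, (#|[set e in edges G | col e == c]|%:R <= k)%R.

Definition hamilton_cycle (n : nat) (G : rel 'I_n) (s : seq 'I_n) : Prop :=
  [/\ 3 <= n, uniq s, size s = n & cycle G s].

Definition cycle_edges (n : nat) (s : seq 'I_n) : seq {set 'I_n} :=
  [seq [set p.1; p.2] | p <- zip s (rot 1 s)].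

Definition rainbow_hamilton_cycle (n : nat) (G : rel 'I_n) (C : eqType)
    (col : {set 'I_n} -> C) (s : seq 'I_n) : Prop :=
  hamilton_cycle G s /\ uniq [seq col e | e <- cycle_edges s].

(* Main.v *)
(* Uniform measure on Hamilton cycles. Deleting an edge uv of a Hamilton cycle
   leaves a Hamilton path from u to v; closing it again by a 2-opt or a 3-opt
   move adds one new edge at u, one at v and at most one further edge. If every
   edge of every cycle admits of order n two-edge moves or of order n^2
   three-edge moves, then a given edge lies on a random cycle with probability
   O(1/n), even conditionally on avoiding equally coloured pairs away from uv,
   because the third new edge can be chosen so as not to conflict with the
   cycle. The lopsided local lemma, with two pairs adjacent when they share a
   vertex, then gives a rainbow cycle.

   If some edge has few moves, reading the neighbourhoods of u and v along the
   path yields two sets of about n/2 vertices with few edges between them, so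
   after moving few vertices G is close to two cliques or to a balanced complete
   bipartite graph. There a small rainbow set F of exceptional edges is fixed
   (two disjoint cross edges, respectively a matching inside the larger side
   that corrects the imbalance), the colours of F are discarded, and 3-opt moves
   avoiding F are again abundant. The matching must not use up the colours at
   any vertex; it is obtained by Beck-Fiala rounding of a constant fractional
   weighting of the edges inside the larger side. *)
Require Import Defs.
From mathcomp Require Import all_boot all_order all_algebra.
From mathcomp Require Import zify lra.

Set Implicit Arguments. Unset Strict Implicit. Unset Printing Implicit Defensive.

(** * Hamilton cycles as edge sets and their 2-opt and 3-opt moves *)

(** The cycles that are counted need not lie in G: they are all Hamilton cycles of the complete
    graph on V, or those that contain F and otherwise respect the two sides. Such cycles can be
    written down explicitly, and switching disallowed edges away leads into G, so a Hamilton cycle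
    of G is a by-product and not an ingredient. Conditional probabilities appear as ratios of
    cardinalities, bounded by counting moves in both directions.

    With of order g two-edge or g n three-edge moves at each edge, the local lemma needs g^2 to
    exceed a multiple of m n; hence g is linear in n and m a small fraction of n. If there are fewer
    moves, the errors pass through two square roots, h of order sqrt (g n) and r of order sqrt (h
    n), before they measure the distance to an extremal graph.

    For two cliques F has two edges, and discarding their colours costs a vertex at most 2 m edges.
    In the bipartite case F may have of order r edges, and the trivial bound m |F| exceeds n; this
    is why the rounding has to control a load at each vertex. *)

Section Cycles.
Variable V : finType.
Implicit Types (s t : seq V) (x y u v : V) (E H : {set {set V}}).

Fixpoint pedges s : seq {set V} :=
  if s is x :: t then if t is y :: _ then [set x; y] :: pedges t else [::]
  else [::].

Definition cedges s : seq {set V} :=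
  if s is x :: t then [set last x t; x] :: pedges s else [::].

(** As a set of edges a cycle no longer depends on the starting vertex or the direction, and a move
    becomes an exchange of edges. *)
Definition cyc s : {set {set V}} := [set:: cedges s].

Lemma in_cyc e s : (e \in cyc s) = (e \in cedges s).
Proof. exact: in_set. Qed.

Lemma pedges_cat x0 s t : s != [::] -> t != [::] ->
  pedges (s ++ t) = pedges s ++ [set last x0 s; head x0 t] :: pedges t.
Proof.
case: t => // y t; elim: s => // x [|x' s] IH _ _ //=.
by have /= -> := IH isT isT.
Qed.

Lemma last_rev x s : last x (rev s) = head x s.
Proof. by case: s => // y s; rewrite rev_cons last_rcons. Qed.

Lemma pedges_rev s : pedges (rev s) = rev (pedges s).
Proof.
elim: s => // x [|y s] IH //.
rewrite rev_cons -cats1 (pedges_cat x) //; last by rewrite -size_eq0 size_rev.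
by rewrite IH last_rev /= rev_cons -cats1 setUC.
Qed.

Lemma head_rev x s : head x (rev s) = last x s.
Proof. by elim/last_ind: s => // s y _; rewrite rev_rcons last_rcons. Qed.

Lemma cedgesE x0 s : s != [::] ->
  cedges s = [set last x0 s; head x0 s] :: pedges s.
Proof. by case: s. Qed.

Lemma cyc_cat s t : cyc (s ++ t) = cyc (t ++ s).
Proof.
case: s t => [|x s] [|y t]; rewrite ?cats0 //.
apply/setP=> e; rewrite !in_cyc !(cedgesE x) //.
rewrite !(pedges_cat x) // !(inE, mem_cat) /= !last_cat /=.
by do !case: (_ == _); do !case: (_ \in _).
Qed.

Lemma cyc_rev s : cyc (rev s) = cyc s.
Proof.
case: s => // x s; apply/setP=> e.
have nz : rev (x :: s) != [::] by rewrite -size_eq0 size_rev.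
rewrite !in_cyc !(cedgesE x) // pedges_rev !inE mem_rev head_rev.
by rewrite last_rev [X in [set X; _]]/= [in RHS]setUC.
Qed.

(** Permuting or reversing the segments keeps their inner edges, only the three joints change; the
    3-opt moves are read off from this. *)
Lemma cyc3 x0 s1 s2 s3 : s1 != [::] -> s2 != [::] -> s3 != [::] ->
  cyc (s1 ++ s2 ++ s3) =
    [set:: pedges s1 ++ pedges s2 ++ pedges s3] :|:
    [set [set last x0 s3; head x0 s1]; [set last x0 s2; head x0 s3];
         [set last x0 s1; head x0 s2]].
Proof.
move=> h1 h2 h3; apply/setP=> e.
have h23 : s2 ++ s3 != [::] by case: (s2) h2.
have h123 : s1 ++ s2 ++ s3 != [::] by case: (s1) h1.
rewrite in_cyc (cedgesE x0) // (pedges_cat x0) // (pedges_cat x0) //.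
have -> : last x0 (s1 ++ s2 ++ s3) = last x0 s3.
  by rewrite !last_cat; case: (s3) h3.
have -> : head x0 (s1 ++ s2 ++ s3) = head x0 s1 by case: (s1) h1.
have -> : head x0 (s2 ++ s3) = head x0 s2 by case: (s2) h2.
rewrite !(inE, mem_cat).
by do !case: (_ == _); do !case: (_ \in _).
Qed.

Lemma cyc2 x0 s1 s2 : s1 != [::] -> s2 != [::] ->
  cyc (s1 ++ s2) =
    [set:: pedges s1 ++ pedges s2] :|:
    [set [set last x0 s2; head x0 s1]; [set last x0 s1; head x0 s2]].
Proof.
move=> h1 h2; apply/setP=> e.
have h12 : s1 ++ s2 != [::] by case: (s1) h1.
rewrite in_cyc (cedgesE x0) // (pedges_cat x0) //.
have -> : last x0 (s1 ++ s2) = last x0 s2.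
  by rewrite !last_cat; case: (s2) h2.
have -> : head x0 (s1 ++ s2) = head x0 s1 by case: (s1) h1.
rewrite !(inE, mem_cat).
by do !case: (_ == _); do !case: (_ \in _).
Qed.

Lemma pedges_mem s e : e \in pedges s -> {subset e <= s}.
Proof.
elim: s => // x [|y s] IH //=; rewrite inE => /orP[/eqP->|/IH h] z.
  by rewrite !inE => /orP[]->; rewrite ?orbT.
by move/h; rewrite !inE => ->; rewrite orbT.
Qed.

Lemma set2_inj u v x y : [set u; v] = [set x; y] ->
  (u = x /\ v = y) \/ (u = y /\ v = x).
Proof.
move=> /setP h; move: (h u) (h v) (h x) (h y); rewrite !inE !eqxx !orbT.
move=> /esym/orP[]/eqP-> /esym/orP[]/eqP->; auto.
  by move=> _ /orP[]/eqP->; left.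
by move=> /orP[]/eqP-> _; left.
Qed.

Lemma pedges_head x y s z : uniq (x :: y :: s) ->
  [set x; z] \in pedges (x :: y :: s) -> z = y.
Proof.
rewrite [uniq _]/= => /andP[xn _]; rewrite [pedges _]/= inE => /orP[/eqP/set2_inj[[]|[]]//|].
  by move=> -> ->.
by move/(@pedges_mem (y :: s))/(_ x); rewrite !inE eqxx => /(_ isT) h; rewrite !inE h in xn.
Qed.

Lemma pedges_uniq s : uniq s -> uniq (pedges s).
Proof.
elim: s => // x [|y s] IH //= /andP[xn un]; rewrite IH // andbT.
apply/negP=> /(@pedges_mem (y :: s))/(_ x); rewrite !inE eqxx => /(_ isT) h.
by rewrite !inE h in xn.
Qed.

Lemma closing_notin x s : uniq (x :: s) -> 1 < size s ->
  [set x; last x s] \notin pedges (x :: s).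
Proof.
case: s => [|y [|z s]] // un _; apply/negP=> /(pedges_head un) /= h.
by case/and3P: un => _ + _; rewrite -h mem_last.
Qed.

Lemma cedges_uniq s : uniq s -> 2 < size s -> uniq (cedges s).
Proof.
case: s => // x s un sz; rewrite /= (setUC [set last x s]).
by rewrite closing_notin //=; have /= -> := pedges_uniq un.
Qed.

Lemma cyc_card_le s : #|cyc s| <= size s.
Proof.
have -> : #|cyc s| = #|cedges s| by apply: eq_card => e; rewrite inE.
apply: leq_trans (card_size _) _; case: s => //= x s; rewrite ltnS.
by elim: s x => // y s IH x; rewrite ltnS; apply: IH.
Qed.

Lemma pedges_split s e : e \in pedges s ->
  exists s1 s2 x y, s = rcons s1 x ++ y :: s2 /\ e = [set x; y].
Proof.
elim: s => // x [|y s] IH //=; rewrite inE => /orP[/eqP->|/IH].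
  by exists [::], s, x, y.
move=> [s1 [s2 [x' [y' [-> ->]]]]].
by exists (x :: s1), s2, x', y'.
Qed.

Lemma cyc_from_edge s u v : uniq s -> [set u; v] \in cyc s ->
  exists t, [/\ perm_eq s (u :: t), cyc (u :: t) = cyc s & last u t = v].
Proof.
move=> un /= uvs.
have [t [x [y [p1 p2 p3 p4 p5]]]] : exists t x y, [/\ perm_eq s (y :: t),
   cyc (y :: t) = cyc s, last y t = x, [set u; v] = [set x; y] & true].
  case: s {un} uvs => [|z s]; rewrite in_cyc ?inE // => /orP[/eqP->|].
    by exists s, (last z s), z.
  move=> /pedges_split [s1 [s2 [x [y [-> ->]]]]].
  exists (s2 ++ rcons s1 x), x, y; split => //.
  - by rewrite perm_catC.
  - by rewrite cyc_cat.
  - by rewrite last_cat last_rcons.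
(* In the first case the sequence runs from v to u and is reversed. *)
case/set2_inj: p4 => -[uE vE].
  exists (behead (rev (y :: t))).
  have ez : u :: behead (rev (y :: t)) = rev (y :: t).
    have : head u (rev (y :: t)) = u by rewrite head_rev /= p3 uE.
    have : size (rev (y :: t)) = (size t).+1 by rewrite size_rev.
    by case: (rev _) => //= a b _ ->.
  rewrite ez cyc_rev perm_sym; split=> //.
    by rewrite perm_rev perm_sym.
  have -> : last u (behead (rev (y :: t))) = last u (u :: behead (rev (y :: t))) by [].
  by rewrite ez last_rev.
by exists t; rewrite uE vE.
Qed.

(** The Hamilton cycles of the complete graph on [V]; a graph enters later, as a restriction on the
    edges. *)
Definition hamc H : bool :=
  [exists t : #|V|.-tuple V, uniq t && (H == cyc t)].

Lemma hamcP H : reflect (exists s, [/\ uniq s, size s = #|V| & H = cyc s]) (hamc H).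
Proof.
apply: (iffP existsP) => [[t /andP[ut /eqP->]]|[s [us ss ->]]].
  by exists t; rewrite size_tuple.
by move/eqP: ss => ss; exists (Tuple ss); rewrite us eqxx.
Qed.

Lemma hamc_edge H u v : hamc H -> [set u; v] \in H ->
  exists t, [/\ uniq (u :: t), size (u :: t) = #|V|, H = cyc (u :: t) & last u t = v].
Proof.
move=> /hamcP[s [us ss ->]] /(cyc_from_edge us)[t [p c l]].
by exists t; rewrite c -(perm_uniq p) -(perm_size p).
Qed.

Lemma hamc_perm s t : uniq s -> size s = #|V| -> perm_eq t s -> hamc (cyc t).
Proof.
by move=> us ss p; apply/hamcP; exists t; rewrite (perm_uniq p) (perm_size p).
Qed.

Lemma hamc_edge2 H e : hamc H -> 1 < #|V| -> e \in H -> exists u v, u != v /\ e = [set u; v].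
Proof.
move=> /hamcP[[|x s] [us ss ->]]; first by rewrite -ss.
rewrite -ss in_cyc => h; rewrite (cedgesE x) // inE => /orP[/eqP->|].
  exists (last x s), x; split=> //; apply/eqP=> h1; move: us; rewrite /=.
  by case: s {ss} h h1 => // y s _ /= <-; rewrite mem_last.
move=> /pedges_split[s1 [s2 [a [b [sE ->]]]]]; exists a, b; split=> //.
move: us; rewrite sE cat_uniq => /and3P[_ /hasPn/(_ b)]; rewrite inE eqxx => /(_ isT).
by rewrite /= mem_rcons inE negb_or eq_sym => /andP[].
Qed.

Lemma hamc_deg H u : hamc H -> #|[set a | [set u; a] \in H]| <= 2.
Proof.
move=> hH; have [a0 a0H|no] := pickP [pred a | [set u; a] \in H]; last first.
  by rewrite eq_card0 // => a; rewrite inE; have /= -> := no a.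
have [t [ut _ HE lt]] := hamc_edge hH a0H.
apply: leq_trans (_ : #|[set a0; head u t]| <= 2); last first.
  by rewrite cards2; case: (_ != _).
apply/subset_leq_card/subsetP=> a; rewrite inE HE in_cyc (cedgesE u) // inE => /orP[/eqP/set2_inj|].
  by rewrite /= lt !inE => -[[-> ->]|[_ ->]]; rewrite eqxx.
case: t ut {HE lt} => // y t ut /(pedges_head ut) ->.
by rewrite !inE eqxx orbT.
Qed.

Lemma hamc_card H : hamc H -> #|H| <= #|V|.
Proof. by move=> /hamcP[s [_ <- ->]]; apply: cyc_card_le. Qed.

Section Moves.
Variables (u v : V) (t : seq V).
Let s := u :: t.
Hypotheses (us : uniq s) (ss : size s = #|V|) (lt : last u t = v).
Let p i := nth u s i.

Lemma last_take_nth i : i < size s -> last u (take i.+1 s) = p i.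
Proof.
move=> h; rewrite -nth_last size_takel // nth_take //.
Qed.

Lemma head_drop_nth i : head u (drop i s) = p i.
Proof. by rewrite -nth0 nth_drop addn0. Qed.

Lemma last_drop i : i < size s -> last u (drop i s) = v.
Proof.
move=> h; rewrite -lt -[last u t]/(last u s) -{2}(cat_take_drop i s) last_cat.
case E: (drop i s) => //; move/eqP: E.
by rewrite -size_eq0 size_drop subn_eq0 leqNgt h.
Qed.

(** The segment [0, a] of the path is followed by the reverse of ]a, n[. That uv is outside [E]
    makes a move remove a bad edge in [allowed_nonempty]. *)
Lemma two_opt a : 2 < size s -> a.+1 < size s -> exists E,
  [/\ [set u; v] \notin E,
      cyc s = E :|: [set [set u; v]; [set p a.+1; p a]] &
      hamc (E :|: [set [set u; p a.+1]; [set v; p a]])].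
Proof.
move=> s2 a1; pose s1 := take a.+1 s; pose s3 := drop a.+1 s.
have sE : s = s1 ++ s3 by rewrite cat_take_drop.
have n1 : s1 != [::] by [].
have n3 : s3 != [::] by rewrite -size_eq0 size_drop -lt0n subn_gt0.
have n3r : rev s3 != [::] by rewrite -size_eq0 size_rev size_eq0.
have h1 : head u s1 = u by [].
have l1 : last u s1 = p a by apply: last_take_nth; lia.
have h3 : head u s3 = p a.+1 by apply: head_drop_nth.
have l3 : last u s3 = v by apply: last_drop.
exists [set:: pedges s1 ++ pedges s3]; split.
- have := closing_notin us s2; rewrite lt -/s; apply: contra.
  rewrite in_set sE (pedges_cat u) // !mem_cat inE.
  by case/orP=> ->; rewrite ?orbT.
- by rewrite sE (cyc2 u) // h1 l1 h3 l3 setUC [RHS]setUC (setUC [set v]) (setUC [set p a]).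
have -> : [set:: pedges s1 ++ pedges s3] :|: [set [set u; p a.+1]; [set v; p a]]
   = cyc (s1 ++ rev s3).
  rewrite (cyc2 u) // last_rev head_rev h1 l1 h3 l3.
  rewrite (setUC [set u]) (setUC [set v]) pedges_rev; congr (_ :|: _).
  by apply/setP=> e; rewrite !in_set !mem_cat mem_rev.
apply: (hamc_perm us ss); rewrite sE perm_cat2l perm_rev //.
Qed.

(* The segments s1 = [0, a], s2 = ]a, b], s3 = ]b, n[ of the path are rejoined as
   s1, rev s2, rev s3. *)
Lemma three_opt1 a b : a < b -> b.+1 < size s -> exists E,
  [/\ [set u; v] \notin E,
      cyc s = E :|: [set [set u; v]; [set p b.+1; p b]; [set p a.+1; p a]] &
      hamc (E :|: [set [set u; p b.+1]; [set v; p a.+1]; [set p b; p a]])].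
Proof.
move=> ab bs; pose s1 := take a.+1 s; pose s2 := drop a.+1 (take b.+1 s).
pose s3 := drop b.+1 s.
have s2E : s1 ++ s2 = take b.+1 s.
  by rewrite -[RHS](cat_take_drop a.+1) take_takel // ltnW.
have sE : s = s1 ++ s2 ++ s3 by rewrite catA s2E cat_take_drop.
have n1 : s1 != [::] by [].
have n2 : s2 != [::] by rewrite -size_eq0 size_drop (size_takel (ltnW bs)) -lt0n subn_gt0.
have n3 : s3 != [::] by rewrite -size_eq0 size_drop -lt0n subn_gt0.
have n3r : rev s3 != [::] by rewrite -size_eq0 size_rev size_eq0.
have n2r : rev s2 != [::] by rewrite -size_eq0 size_rev size_eq0.
have h1 : head u s1 = u by [].
have l1 : last u s1 = p a by apply: last_take_nth; lia.
have h2 : head u s2 = p a.+1.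
  by rewrite -nth0 nth_drop addn0 nth_take.
have l2 : last u s2 = p b.
  rewrite -(@last_take_nth b) -?s2E ?last_cat; last by lia.
  by case: (s2) n2.
have h3 : head u s3 = p b.+1 by apply: head_drop_nth.
have l3 : last u s3 = v by apply: last_drop.
have n23 : s2 ++ s3 != [::] by case: (s2) n2.
exists [set:: pedges s1 ++ pedges s2 ++ pedges s3]; split.
- have sz : 1 < size t by move: bs; rewrite /s /=; lia.
  have := closing_notin us sz; rewrite lt -/s; apply: contra.
  rewrite in_set sE (pedges_cat u) // (pedges_cat u n2) // !(inE, mem_cat).
  by case/or3P=> ->; rewrite ?orbT.
- rewrite sE (cyc3 u) // h1 l1 h2 l2 h3 l3.
  by rewrite (setUC [set v]) (setUC [set p a]) (setUC [set p b]).
have -> : [set:: pedges s1 ++ pedges s2 ++ pedges s3] :|: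
    [set [set u; p b.+1]; [set v; p a.+1]; [set p b; p a]]
   = cyc (s1 ++ rev s2 ++ rev s3).
  rewrite (cyc3 u) // !last_rev !head_rev h1 l1 h2 l2 h3 l3.
  rewrite (setUC [set u]) (setUC [set v]) (setUC [set p b]) !pedges_rev; congr (_ :|: _).
  by apply/setP=> e; rewrite !in_set !mem_cat !mem_rev.
apply: (hamc_perm us ss); rewrite sE perm_cat2l.
by apply: perm_cat; rewrite perm_rev.
Qed.

(* Here they are rejoined as s1, s3, rev s2. *)
Lemma three_opt2 a b : a < b -> b.+1 < size s -> exists E,
  [/\ [set u; v] \notin E,
      cyc s = E :|: [set [set u; v]; [set p a.+1; p a]; [set p b; p b.+1]] &
      hamc (E :|: [set [set u; p a.+1]; [set v; p b]; [set p a; p b.+1]])].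
Proof.
move=> ab bs; pose s1 := take a.+1 s; pose s2 := drop a.+1 (take b.+1 s).
pose s3 := drop b.+1 s.
have s2E : s1 ++ s2 = take b.+1 s.
  by rewrite -[RHS](cat_take_drop a.+1) take_takel // ltnW.
have sE : s = s1 ++ s2 ++ s3 by rewrite catA s2E cat_take_drop.
have n1 : s1 != [::] by [].
have n2 : s2 != [::] by rewrite -size_eq0 size_drop (size_takel (ltnW bs)) -lt0n subn_gt0.
have n3 : s3 != [::] by rewrite -size_eq0 size_drop -lt0n subn_gt0.
have n2r : rev s2 != [::] by rewrite -size_eq0 size_rev size_eq0.
have h1 : head u s1 = u by [].
have l1 : last u s1 = p a by apply: last_take_nth; lia.
have h2 : head u s2 = p a.+1.
  by rewrite -nth0 nth_drop addn0 nth_take.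
have l2 : last u s2 = p b.
  rewrite -(@last_take_nth b) -?s2E ?last_cat; last by lia.
  by case: (s2) n2.
have h3 : head u s3 = p b.+1 by apply: head_drop_nth.
have l3 : last u s3 = v by apply: last_drop.
have n23 : s2 ++ s3 != [::] by case: (s2) n2.
exists [set:: pedges s1 ++ pedges s2 ++ pedges s3]; split.
- have sz : 1 < size t by move: bs; rewrite /s /=; lia.
  have := closing_notin us sz; rewrite lt -/s; apply: contra.
  rewrite in_set sE (pedges_cat u) // (pedges_cat u n2) // !(inE, mem_cat).
  by case/or3P=> ->; rewrite ?orbT.
- rewrite sE (cyc3 u) // h1 l1 h2 l2 h3 l3.
  rewrite (setUC [set v]) (setUC [set p a]); congr (_ :|: _).
  by apply/setP=> e; rewrite !inE orbAC.
have -> : [set:: pedges s1 ++ pedges s2 ++ pedges s3] :|: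
    [set [set u; p a.+1]; [set v; p b]; [set p a; p b.+1]]
   = cyc (s1 ++ s3 ++ rev s2).
  rewrite (cyc3 u) // !last_rev !head_rev h1 l1 h2 l2 h3 l3.
  rewrite (setUC [set u]) !pedges_rev; congr (_ :|: _).
  by apply/setP=> e; rewrite !in_set !mem_cat !mem_rev; congr (_ || _); apply: orbC.
apply: (hamc_perm us ss); rewrite sE perm_cat2l.
by rewrite perm_catC; apply: perm_cat; rewrite ?perm_rev.
Qed.

End Moves.

End Cycles.

Lemma card_le_fiber (T U : finType) (f : T -> U) (A : {set T}) (B : {set U}) k :
  {in A, forall x, f x \in B} ->
  {in B, forall y, #|[set x in A | f x == y]| <= k} -> #|A| <= k * #|B|.
Proof.
move=> fAB fib; rewrite -sum1_card (partition_big f (mem B)) //= mulnC -sum_nat_const.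
apply: leq_sum => y /fib; rewrite -sum1_card; congr (_ <= _).
by apply: eq_bigl => x; rewrite inE.
Qed.

(** * A lopsided local lemma by switchings *)

Section LocalLemma.
Variables (T : finType) (Om : {set {set T}}) (Cf : {set T * T}) (ES : {set T}).
Variables (touch : rel T) (g c K : nat).

Definition avoids (S : {set T * T}) (H : {set T}) : bool :=
  [forall q in S, ~~ ((q.1 \in H) && (q.2 \in H))].

Definition avoiding (S : {set T * T}) (P : {set T}) : {set {set T}} :=
  [set H in Om | avoids S H && (P \subset H)].

Hypothesis CfP : forall q, q \in Cf -> [/\ q.1 \in ES, q.2 \in ES & q.1 != q.2].
(* Lopsidedness: switching e away costs a factor c / g, whatever the pairs far
   from e that have to be avoided and the one edge that has to be kept. *)
Hypothesis switch : forall (S : {set T * T}) (P : {set T}) e,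
  S \subset Cf -> #|P| <= 1 -> e \in ES -> e \notin P ->
  (forall q, q \in S -> ~~ touch e q.1 && ~~ touch e q.2) ->
  #|avoiding S (e |: P)| * g <= c * #|avoiding S P|.
Hypothesis sparse : forall e, e \in ES ->
  #|[set q in Cf | touch e q.1 || touch e q.2]| <= K.
Hypothesis cKg : 8 * c ^ 2 * K <= g ^ 2.
Hypothesis cg : 2 * c ^ 2 < g ^ 2.

Lemma avoids_sub (S1 S2 : {set T * T}) H : S1 \subset S2 -> avoids S2 H -> avoids S1 H.
Proof.
move=> /subsetP s12 /forall_inP h; apply/forall_inP=> q /s12; exact: h.
Qed.

(** Union bound over the pairs by which [S] exceeds [S1]. *)
Lemma avoiding_split (S1 S : {set T * T}) : S1 \subset S ->
  #|avoiding S1 set0| <= #|avoiding S set0| +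
     \sum_(q in S :\: S1) #|avoiding S1 [set q.1; q.2]|.
Proof.
move=> s1; apply: leq_trans (_ : #|avoiding S set0| +
    #|\bigcup_(q in S :\: S1) avoiding S1 [set q.1; q.2]| <= _); last first.
  rewrite leq_add2l; elim/big_rec2: _ => [|q a A _ ih]; first by rewrite cards0.
  by apply: leq_trans (leq_card_setU _ _) _; rewrite leq_add2l.
apply: leq_trans (leq_card_setU _ _); apply/subset_leq_card/subsetP => H.
rewrite !inE sub0set andbT => /andP[HO H1]; rewrite HO ?andbT /=.
case: (boolP (avoids S H)) => //= /forall_inPn[q qS]; rewrite negbK => /andP[q1 q2].
apply/bigcupP; exists q; last first.
  by rewrite !inE HO H1 subUset !sub1set q1 q2.
rewrite inE qS andbT; apply/negP=> qS1.
by move/forall_inP: H1 => /(_ _ qS1); rewrite q1 q2.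
Qed.

Definition near (S : {set T * T}) (q : T * T) : {set T * T} :=
  [set q' in S | [|| touch q.1 q'.1, touch q.1 q'.2,
     touch q.2 q'.1 | touch q.2 q'.2]].

(** Once the pairs near [q] are dropped, [switch] applies to both edges of [q]: first [q.1] is
    removed while [q.2] is kept, then [q.2]. This is the use of the one kept edge in [switch]. *)
Lemma avoiding_far (S : {set T * T}) q : S \subset Cf -> q \in Cf ->
  #|avoiding S [set q.1; q.2]| * g ^ 2 <= c ^ 2 * #|avoiding (S :\: near S q) set0|.
Proof.
move=> SC qC; have [q1 q2 q12] := CfP qC; set S1 := S :\: _.
have S1S : S1 \subset S by rewrite subsetDl.
have S1C := subset_trans S1S SC.
have far e : (e == q.1) || (e == q.2) ->
    forall q', q' \in S1 -> ~~ touch e q'.1 && ~~ touch e q'.2.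
  move=> ee q'; rewrite 2!inE negb_and => /andP[h q'S]; move: h; rewrite q'S /=.
  by case/orP: ee => /eqP-> ; rewrite !negb_or => /and4P[? ? ? ?]; apply/andP.
have h1 : #|avoiding S1 [set q.1; q.2]| * g <= c * #|avoiding S1 [set q.2]|.
  by apply: switch; rewrite ?cards1 ?inE //; apply: far; rewrite eqxx.
have h2 : #|avoiding S1 [set q.2]| * g <= c * #|avoiding S1 set0|.
  rewrite -(setU0 [set q.2]); apply: switch; rewrite ?cards0 ?inE //.
  by apply: far; rewrite eqxx orbT.
have h3 : #|avoiding S [set q.1; q.2]| <= #|avoiding S1 [set q.1; q.2]|.
  apply/subset_leq_card/subsetP=> H; rewrite !inE => /and3P[-> h ->].
  by rewrite (avoids_sub S1S h).
rewrite !expnS !expn0 !muln1; nia.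
Qed.

(** At most 2 K pairs are near [q], and by induction each lies on a proportion of at most 2 c^2 /
    g^2 of the cycles avoiding the far pairs; by [cKg] this adds up to at most one half. So
    restoring the near pairs at most doubles the bound of [avoiding_far]. *)
Lemma avoiding_pair k (S : {set T * T}) q : #|S| <= k -> S \subset Cf -> q \in Cf ->
  #|avoiding S [set q.1; q.2]| * g ^ 2 <= 2 * c ^ 2 * #|avoiding S set0|.
Proof.
elim: k S q => [|k IH] S q Sk SC qC; have b1 := avoiding_far SC qC;
  have S1S : S :\: near S q \subset S by [rewrite subsetDl].
  have S1E : S :\: near S q = S.
    by apply/eqP; rewrite eqEcard S1S; move: Sk; rewrite leqn0 => /eqP->.
  by move: b1; rewrite S1E; nia.
have [q1 q2 _] := CfP qC; move: b1 S1S; set S2 := near S q; set S1 := S :\: S2 => b1 S1S.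
have [S20|[q0 q0S2]] := set_0Vmem S2.
  by move: b1; rewrite /S1 S20 setD0; nia.
have S1k : #|S1| <= k.
  rewrite -ltnS; apply: leq_trans Sk; apply: proper_card; rewrite properEneq S1S andbT.
  apply/eqP=> E; by move: (q0S2); rewrite inE -{1}E inE q0S2.
have S1C := subset_trans S1S SC.
have sp := avoiding_split S1S.
have S2E : S :\: S1 = S2.
  apply/setP=> q'; rewrite !in_set.
  by case: (q' \in S) => //=; rewrite ?andbF // !andbT negbK.
rewrite S2E in sp.
have S2K : #|S2| <= 2 * K.
  apply: leq_trans (_ : #|[set q' in Cf | touch q.1 q'.1 || touch q.1 q'.2] :|:
     [set q' in Cf | touch q.2 q'.1 || touch q.2 q'.2]| <= _).
    apply/subset_leq_card/subsetP=> q'; rewrite !inE => /andP[/(subsetP SC) ->].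
    by case/or4P=> ->; rewrite ?orbT.
  apply: leq_trans (leq_card_setU _ _) _; rewrite mul2n -addnn.
  by apply: leq_add; apply: sparse.
have sm : (\sum_(q' in S2) #|avoiding S1 [set q'.1; q'.2]|) * g ^ 2 <=
    #|S2| * (2 * c ^ 2 * #|avoiding S1 set0|).
  rewrite big_distrl /= -sum_nat_const; apply: leq_sum => q' q'S2.
  apply: IH => //; apply: (subsetP SC); by move: q'S2; rewrite inE => /andP[].
have step : #|avoiding S1 set0| * g ^ 2 <= 2 * (#|avoiding S set0| * g ^ 2).
  move: sm sp S2K cKg; set N1 := #|avoiding S1 _|; set N := #|avoiding S set0|.
  set G := g ^ 2; set D := c ^ 2; set X := \sum_(_ in _) _; set s := #|S2|; nia.
have g0 : 0 < g ^ 2 by lia.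
have {}step : #|avoiding S1 set0| <= 2 * #|avoiding S set0|.
  by rewrite -(leq_pmul2r g0) -mulnA.
apply: leq_trans b1 _; move: step; set N1 := #|avoiding S1 _|.
by set N := #|avoiding S set0|; set D := c ^ 2; nia.
Qed.

(** Pairs are added one at a time; by [cg] a new pair never lies on all the cycles that avoid the
    previous ones. *)
Lemma local_lemma : Om != set0 -> exists2 H, H \in Om & avoids Cf H.
Proof.
move=> Om0; suff h (S : {set T * T}) : S \subset Cf -> 0 < #|avoiding S set0|.
  have /card_gt0P[H] := h Cf (subxx _).
  by rewrite inE sub0set andbT => /andP[? ?]; exists H.
elim: {S}_.+1 {-2}S (ltnSn #|S|) => // k IH S Sk SC.
have [->|[q qS]] := set_0Vmem S.
  case/set0Pn: Om0 => H HO; apply/card_gt0P; exists H; rewrite inE HO sub0set andbT.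
  by apply/forall_inP=> q; rewrite inE.
have sub := subsetDl S [set q].
have h := IH (S :\ q) _ (subset_trans sub SC).
have {}h : 0 < #|avoiding (S :\ q) set0|.
  by apply: h; move: Sk; rewrite (cardsD1 q S) qS; lia.
have sp := avoiding_split sub.
have SqE : S :\: (S :\ q) = [set q].
  by apply/setP=> q'; rewrite !inE; case: eqP => [->|_]; rewrite ?qS //= andNb.
rewrite SqE big_set1 in sp.
have := avoiding_pair (leqnn _) (subset_trans sub SC) (subsetP SC _ qS).
move: sp h cg; set a := #|avoiding S set0|; set b := #|avoiding (S :\ q) set0|.
set d := #|avoiding _ [set _; _]|; set G := g ^ 2; set D := c ^ 2.
by case: (posnP a) => // ->; nia.
Qed.

End LocalLemma.

(* Given H' and w, the unchanged part E is H' minus a subset of new w, whence the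
   factor 2 ^ j. *)
Lemma switch_count (T W : finType) (A B : {set {set T}}) (old new : W -> {set T})
    (good : {set T} -> W -> bool) (j kb al : nat) :
  (forall H w, H \in A -> good H w -> exists H' E,
     [/\ H' \in B, H = E :|: old w & H' = E :|: new w]) ->
  (forall w, #|new w| <= j) ->
  (forall H', H' \in B -> #|[set w | new w \subset H']| <= kb) ->
  (forall H, H \in A -> al <= #|[set w | good H w]|) ->
  #|A| * al <= 2 ^ j * (kb * #|B|).
Proof.
move=> reach newj Bkb Aal.
pose TT := [set p : {set T} * W | (p.1 \in A) && good p.1 p.2].
pose BB := [set p : {set T} * W | (p.1 \in B) && (new p.2 \subset p.1)].
have TTc : #|A| * al <= #|TT|.
  rewrite -sum_nat_const -(card_in_imset (f := id)) ?imset_id; last by move=> ??.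
  rewrite -sum1_card (partition_big fst (mem A)) /=; last first.
    by move=> p; rewrite inE => /andP[].
  apply: leq_sum => H HA; apply: leq_trans (Aal H HA) _.
  rewrite sum1dep_card -(card_imset (f := pair H)); last by move=> ?? [].
  apply/subset_leq_card/subsetP=> p /imsetP[w]; rewrite inE => gw ->.
  by rewrite !inE /= HA gw eqxx.
have BBc : #|BB| <= kb * #|B|.
  apply: (@card_le_fiber _ _ fst) => [p|H' H'B]; first by rewrite inE => /andP[].
  apply: leq_trans (Bkb _ H'B).
  rewrite -[X in X <= _](card_in_imset (f := snd)).
    apply/subset_leq_card/subsetP=> w /imsetP[[H w']]; rewrite !inE /=.
    by case/andP=> /andP[_ h] /eqP <- ->.
  by move=> [x1 y1] [x2 y2]; rewrite !inE /= => /andP[_ /eqP->] /andP[_ /eqP->] ->.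
apply: leq_trans TTc _; apply: leq_trans (leq_mul (leqnn _) BBc).
pose f (p : {set T} * W) : {set T} * W :=
  (odflt set0 [pick H' in B | [exists E, (p.1 == E :|: old p.2) &&
                 (H' == E :|: new p.2)]], p.2).
have fP p : p \in TT -> (f p).1 \in B /\
   exists E, p.1 = E :|: old p.2 /\ (f p).1 = E :|: new p.2.
  rewrite inE => /andP[pA pg]; rewrite /f /=; case: pickP => [H' /andP[H'B]|no] /=.
    by move=> /existsP[E /andP[/eqP h1 /eqP h2]]; split=> //; exists E.
  have [H' [E [H'B h1 h2]]] := reach _ _ pA pg.
  by move: (no H'); rewrite /= H'B => /existsP[]; exists E; rewrite {1}h1 h2 !eqxx.
apply: (@card_le_fiber _ _ f) => [p /fP[h [E [_ h2]]]|[H' w] _].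
  by rewrite inE h h2 subsetUr.
apply: leq_trans (_ : #|powerset (new w)| <= _); last first.
  by rewrite card_powerset leq_pexp2l.
apply: leq_trans (leq_imset_card
  (fun X => ((H' :\: new w) :|: X :|: old w, w)) _).
apply/subset_leq_card/subsetP=> p; rewrite inE => /andP[/fP[_ [E [h1 h2]]] /eqP fp].
have wE : p.2 = w by move: fp; rewrite /f => -[].
rewrite fp wE /= in h1 h2.
apply/imsetP; exists (E :&: new w); first by rewrite inE subsetIr.
case: p wE h1 {fp} => p1 p2 /= -> ->; congr (_ , _).
apply/setP=> z; rewrite h2 !inE.
by case: (z \in E); case: (z \in new w); case: (z \in old w).
Qed.

(** * From switchings to a rainbow cycle *)

Section Arcs.
Variable V : finType.
Implicit Types (D : {set {set V}}).

Definition arcs D := [set w : V * V | [set w.1; w.2] \in D].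

Lemma card_arcs D : #|arcs D| <= 2 * #|D|.
Proof.
apply: (@card_le_fiber _ _ (fun w => [set w.1; w.2])) => [w|e eD]; first by rewrite inE.
have [w /= wP|no] := pickP [pred w : V * V | [set w.1; w.2] == e]; last first.
  by rewrite eq_card0 // => w; rewrite inE; have /= -> := no w; rewrite andbF.
apply: leq_trans (_ : #|[set w; (w.2, w.1)]| <= 2); last by rewrite cards2; case: eqP.
apply/subset_leq_card/subsetP=> -[x y]; rewrite !inE /= => /andP[_].
rewrite -(eqP wP) => /eqP/set2_inj[[-> ->]|[-> ->]]; last by rewrite eqxx orbT.
by case: (w) => ? ?; rewrite eqxx.
Qed.

End Arcs.

(** The bookkeeping of [edge_removal]: of at least 2 g n three-edge moves at most 4 n + 4 n + 8 m n
    <= g n are lost. *)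
Lemma filtered_count (n m g a b c d x1 x2 x3 : nat) :
  x1 <= 2 * 1 * (2 * n) -> x2 <= 2 * n * (2 * 1) -> x3 <= 4 * (2 * (m * n)) ->
  8 * (m + 1) <= g -> 2 * (g * n) <= a -> a <= b + d -> d <= x1 + c -> c <= x2 + x3 ->
  g * n <= b.
Proof. by move=> ? ? ? /(leq_mul (leqnn n)) ? ? ? ? ?; nia. Qed.

Section Switching.
Variables (V : finType) (C : eqType) (col : {set V} -> C).
Variables (KK : {set {set {set V}}}) (F ES : {set {set V}}) (g m : nat).
Let n := #|V|.

(* E collects the edges left unchanged. For move3 the entries of w are ((a, b), (x, y)):
   uv, ax, by are replaced by ua, vb, xy. *)
Definition move2 (H : {set {set V}}) (u v : V) (w : V * V) : bool :=
  [exists E : {set {set V}},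
   [&& [set u; v] \notin E, H == E :|: [set [set u; v]; [set w.1; w.2]],
       E :|: [set [set u; w.1]; [set v; w.2]] \in KK,
       [set u; w.1] \in ES & [set v; w.2] \in ES]].

Definition move3 (H : {set {set V}}) (u v : V) (w : (V * V) * (V * V)) : bool :=
  [exists E : {set {set V}},
   [&& [set u; v] \notin E,
       H == E :|: [set [set u; v]; [set w.1.1; w.2.1]; [set w.1.2; w.2.2]],
       E :|: [set [set u; w.1.1]; [set v; w.1.2]; [set w.2.1; w.2.2]] \in KK,
       [set u; w.1.1] \in ES, [set v; w.1.2] \in ES & [set w.2.1; w.2.2] \in ES]].

Hypothesis KKham : forall H, H \in KK -> hamc H.
Hypothesis disjF : forall e, e \in ES -> e \notin F.
Hypothesis ESP : forall e, e \in ES -> exists x y, e = [set x; y].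
Hypothesis colm : forall e, e \in ES -> #|[set f in ES | col f == col e]| <= m.
Hypothesis moves : forall H u v, H \in KK -> [set u; v] \in H -> [set u; v] \notin F ->
  2 * g <= #|[set w | move2 H u v w]| \/ 2 * (g * n) <= #|[set w | move3 H u v w]|.
Hypothesis V3 : 2 < n.
Hypothesis gm : 8 * (m + 1) <= g.
Hypothesis gbig : 2048 * 100 * (n * m) <= g ^ 2.
Hypothesis g120 : 120 <= g.

Let Om := [set H in KK | H \subset ES :|: F].
Let Cf := [set q : {set V} * {set V} |
  [&& q.1 \in ES, q.2 \in ES, q.1 != q.2 & col q.1 == col q.2]].
Let touch (e f : {set V}) := [exists z, (z \in e) && (z \in f)].

(* A cycle of KK with the fewest edges outside ES and F has none, since a move at such
   an edge only introduces edges of ES. *)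
Lemma allowed_nonempty : KK != set0 -> Om != set0.
Proof.
case/set0Pn=> H0 H0K.
pose mu (H : {set {set V}}) := #|H :\: (ES :|: F)|.
have [H HK Hmin] : exists2 H, H \in KK & forall H', H' \in KK -> mu H <= mu H'.
  by case: (arg_minnP (P := [in KK]) mu H0K) => H ? ?; exists H.
apply/set0Pn; exists H; rewrite inE HK /=; apply/subsetP=> e eH; apply: contraT => eN.
have [u [v [uv eE]]] := hamc_edge2 (KKham HK) (ltnW V3) eH.
have eF : [set u; v] \notin F by move: eN; rewrite -eE !inE negb_or => /andP[].
have dec (H' E X : {set {set V}}) : X \subset ES -> e \notin E -> E \subset H -> H' \in KK -> H' = E :|: X -> False.
  move=> XES eE' EH H'K H'E; have := Hmin _ H'K; rewrite leqNgt => /negP; apply.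
  apply: proper_card; apply/properP; split; last first.
    exists e; rewrite ?inE; first by rewrite inE in eN; rewrite eN eH.
    by rewrite H'E negb_and negbK !inE (negPf eE') /= ; case: (boolP (e \in X)) => [/(subsetP XES)->|]; rewrite ?orbT.
  apply/subsetP=> f; rewrite H'E !inE => /andP[h /orP[fE|fX]].
    by rewrite h (subsetP EH).
  by rewrite (subsetP XES _ fX) in h.
have n0 : 0 < g * n by rewrite muln_gt0; apply/andP; split; lia.
have [h|h] := moves HK (eq_ind _ (fun e => e \in H) eH _ eE) eF.
  have /card_gt0P[w] : 0 < #|[set w | move2 H u v w]| by lia.
  rewrite inE => /existsP[E /and5P[h1 /eqP h2 h3 h4 h5]].
  exfalso; apply: (dec _ E [set [set u; w.1]; [set v; w.2]]) h3 _ => //.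
  - by apply/subsetP=> f; rewrite !inE => /orP[]/eqP->.
  - by rewrite eE.
  - by rewrite h2 subsetUl.
have /card_gt0P[w] : 0 < #|[set w | move3 H u v w]| by lia.
rewrite inE => /existsP[E /and5P[h1 /eqP h2 h3 h4 /andP[h5 h6]]].
exfalso; apply: (dec _ E [set [set u; w.1.1]; [set v; w.1.2]; [set w.2.1; w.2.2]]) h3 _ => //.
- by apply/subsetP=> f; rewrite !inE => /orP[/orP[]|]/eqP->.
- by rewrite eE.
- by rewrite h2 subsetUl.
Qed.

Lemma card_nbr_pairs H (x y : V) : hamc H ->
  #|[set w : V * V | ([set x; w.1] \in H) && ([set y; w.2] \in H)]| <= 4.
Proof.
move=> hH; have -> : [set w : V * V | ([set x; w.1] \in H) && ([set y; w.2] \in H)] =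
   setX [set a | [set x; a] \in H] [set b | [set y; b] \in H].
  by apply/setP=> -[a b]; rewrite !inE.
by rewrite cardsX; apply: (@leq_mul _ _ 2 2); apply: hamc_deg.
Qed.

Lemma card_quads (Q1 Q2 : {set V * V}) :
  #|[set w : (V * V) * (V * V) | ((w.1.1, w.2.1) \in Q1) && ((w.1.2, w.2.2) \in Q2)]|
  <= #|Q1| * #|Q2|.
Proof.
pose f (w : (V * V) * (V * V)) := ((w.1.1, w.2.1), (w.1.2, w.2.2)).
rewrite -cardsX -(card_imset (f := f)); last first.
  by move=> [[a b] [x y]] [[a' b'] [x' y']]; rewrite /f /= => -[-> -> -> ->].
apply/subset_leq_card/subsetP=> z /imsetP[w]; rewrite inE => /andP[h1 h2] ->.
by rewrite inE h1.
Qed.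

Let good2 (B : {set {set {set V}}}) u v H (w : V * V) := [exists H' in B, [exists E : {set {set V}},
   (H == E :|: [set [set u; v]; [set w.1; w.2]]) && 
   (H' == E :|: [set [set u; w.1]; [set v; w.2]])]].

Let good3 (B : {set {set {set V}}}) u v H (w : (V * V) * (V * V)) := [exists H' in B, [exists E : {set {set V}},
   (H == E :|: [set [set u; v]; [set w.1.1; w.2.1]; [set w.1.2; w.2.2]]) && 
   (H' == E :|: [set [set u; w.1.1]; [set v; w.1.2]; [set w.2.1; w.2.2]])]].

(** New edges at u or v cannot complete a pair of [S], since no such pair touches e = uv. Hence a
    2-opt move fails only if it deletes the edge of [P], and a 3-opt move also if its third edge
    conflicts with [H]. Backwards, a cycle arises from at most 4 two-edge and 8 n three-edge moves,
    so the constant is 80 = 4 * 4 + 8 * 8, the factors 4 and 8 being the powers of 2 in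
    [switch_count]. *)
Lemma edge_removal (S : {set {set V} * {set V}}) (P : {set {set V}}) e :
  S \subset Cf -> #|P| <= 1 -> e \in ES -> e \notin P ->
  (forall q, q \in S -> ~~ touch e q.1 && ~~ touch e q.2) ->
  #|avoiding Om S (e |: P)| * g <= 80 * #|avoiding Om S P|.
Proof.
move=> SC P1 eES eP Sfar; set A := avoiding _ _ _; set B := avoiding _ _ _.
have [->|[H0 H0A]] := set_0Vmem A; first by rewrite cards0.
have AP H : H \in A -> [/\ H \in KK, H \subset ES :|: F, avoids S H, e \in H & P \subset H].
  by rewrite !inE => /and3P[/andP[-> ->] ->]; rewrite subUset sub1set => /andP[-> ->].
have BP H : H \in KK -> H \subset ES :|: F -> avoids S H -> P \subset H -> H \in B.
  by rewrite !inE => -> -> -> ->.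
have BK H : H \in B -> hamc H by rewrite !inE => /andP[/andP[/KKham]].
have [H0K _ _ eH0 _] := AP _ H0A.
have [u [v [uv eE]]] := hamc_edge2 (KKham H0K) (ltnW V3) eH0.
have eF : [set u; v] \notin F by rewrite -eE disjF.
have farS q a : q \in S -> [/\ [set u; a] != q.1, [set u; a] != q.2,
    [set v; a] != q.1 & [set v; a] != q.2].
  move=> /Sfar /andP[t1 t2]; split; apply/eqP=> E.
  - by case/existsP: t1; exists u; rewrite -E eE !inE eqxx.
  - by case/existsP: t2; exists u; rewrite -E eE !inE eqxx.
  - by case/existsP: t1; exists v; rewrite -E eE !inE eqxx ?orbT.
  - by case/existsP: t2; exists v; rewrite -E eE !inE eqxx ?orbT.
(* Cycles with many usable 2-opt moves; by [moves] the others have many usable 3-opt moves. *)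
pose A2 := [set H in A | g <= #|[set w | good2 B u v H w]|].
pose A3 := A :\: A2.
have c2 : #|A2| * g <= 2 ^ 2 * (4 * #|B|).
  apply: (@switch_count _ _ _ _
    (fun w : V * V => [set [set u; v]; [set w.1; w.2]])
    (fun w => [set [set u; w.1]; [set v; w.2]]) (good2 B u v)).
  - move=> H w _ /existsP[H' /andP[H'B /existsP[E /andP[/eqP h1 /eqP h2]]]].
    by exists H', E.
  - by move=> w; rewrite cards2; case: eqP.
  - move=> H' /BK hH'; apply: leq_trans (card_nbr_pairs u v hH').
    apply/subset_leq_card/subsetP=> w; rewrite !inE => /subsetP h.
    by rewrite !h ?inE ?eqxx ?orbT.
  by move=> H; rewrite inE => /andP[].
have c3 : #|A3| * (g * n) <= 2 ^ 3 * ((4 * (2 * n)) * #|B|).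
  apply: (@switch_count _ _ _ _
    (fun w : (V * V) * (V * V) => [set [set u; v]; [set w.1.1; w.2.1]; [set w.1.2; w.2.2]])
    (fun w => [set [set u; w.1.1]; [set v; w.1.2]; [set w.2.1; w.2.2]]) (good3 B u v)).
  - move=> H w _ /existsP[H' /andP[H'B /existsP[E /andP[/eqP h1 /eqP h2]]]].
    by exists H', E.
  - move=> w; apply: leq_trans (leq_card_setU _ _) _.
    by rewrite cards2 cards1; case: eqP.
  - move=> H' /BK hH'; apply: leq_trans (_ : #|setX [set w : V * V | ([set u; w.1] \in H') && ([set v; w.2] \in H')] (arcs H')| <= _).
      apply/subset_leq_card/subsetP=> w; rewrite !inE => /subsetP h.
      by rewrite !h ?inE ?eqxx ?orbT.
    rewrite cardsX; apply: leq_mul; first exact: card_nbr_pairs.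
    by apply: leq_trans (card_arcs _) _; rewrite leq_mul2l hamc_card.
  move=> H; rewrite in_setD => /andP[HA2 HA].
  have [HK Hsub HS eH HP] := AP _ HA.
  have hH := KKham HK.
  have [m2|m3] := moves HK (eq_ind _ (fun e => e \in H) eH _ eE) eF.
    case/negP: HA2; rewrite inE HA /=.
    have : [set w | move2 H u v w] \subset [set w | good2 B u v H w] :|: arcs P.
      apply/subsetP=> w; rewrite !in_set => /existsP[E /and5P[h1 /eqP h2 h3 h4 h5]].
      case: (boolP (_ \in P)) => wP; rewrite ?orbT // orbF.
      apply/existsP; exists (E :|: [set [set u; w.1]; [set v; w.2]]).
      apply/andP; split; last by apply/existsP; exists E; rewrite {1}h2 !eqxx.
      apply: BP => //.
      + rewrite subUset; apply/andP; split.
          by apply: subset_trans Hsub; rewrite h2 subsetUl.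
        by apply/subsetP=> f; rewrite !inE => /orP[]/eqP->; rewrite ?h4 ?h5.
      + apply/forall_inP=> q qS; have [f1 _ f3 _] := farS _ w.1 qS.
        have [f1' _ f3' _] := farS _ w.2 qS; have [_ f2 _ f4] := farS _ w.1 qS.
        have [_ f2' _ f4'] := farS _ w.2 qS.
        rewrite !inE ![_ == [set _; _]]eq_sym (negPf f1) (negPf f3') (negPf f2) (negPf f4') !orbF.
        apply: contra (forall_inP HS _ qS) => /andP[q1 q2].
        by rewrite h2 !in_setU q1 q2.
      apply/subsetP=> f fP; move: (subsetP HP _ fP); rewrite h2 !in_setU !in_set1.
      case: (f \in E) => //= /orP[/eqP fe|/eqP fe]; move: fP; rewrite fe.
        by rewrite -eE (negPf eP).
      by rewrite (negPf wP).
    move=> /subset_leq_card h; have := leq_trans h (leq_card_setU _ _).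
    have := card_arcs P; move: m2 P1 g120; clear; set a := #|[set w | _]|.
    set b := #|[set w | _]|; lia.
  (* Edges in conflict with some edge of [H]; the third new edge of a move has to avoid them. *)
  pose CH := [set f | [exists h in H, (f, h) \in Cf]].
  have CHm : #|CH| <= m * n.
    apply: leq_trans (_ : m * #|H| <= _); last by rewrite leq_mul2l hamc_card ?orbT.
    pose CP := [set q in Cf | q.2 \in H].
    apply: leq_trans (_ : #|CP| <= _).
      apply: leq_trans (leq_imset_card fst _); apply/subset_leq_card/subsetP=> f.
      rewrite inE => /existsP[h /andP[hH' fh]]; apply/imsetP; exists (f, h) => //.
      by rewrite inE fh.
    apply: (@card_le_fiber _ _ snd) => [q|h hh]; first by rewrite inE => /andP[].
    have [hES|hES] := boolP (h \in ES); last first.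
      rewrite eq_card0 // => q; rewrite !inE.
      by case: (q.2 =P h) => [->|_]; rewrite ?andbF // (negPf hES) !andbF.
    apply: leq_trans (colm hES); rewrite -[X in X <= _](card_in_imset (f := fst)).
      apply/subset_leq_card/subsetP=> f /imsetP[q]; rewrite !inE => /andP[/andP[]].
      by move=> /and4P[h1 h2 h3 h4] h5 /eqP <- ->; rewrite h1.
    by move=> [? ?] [? ?]; rewrite !inE /= => /andP[_ /eqP->] /andP[_ /eqP->] ->.
  (* [X1] and [X2] contain the moves that delete the edge of [P], [X3] those whose new edge xy is in
     [CH]. Given (x, y), the vertices a and b are neighbours of x and y on [H], which leaves four
     choices. *)
  pose X1 := [set w : (V * V) * (V * V) | ((w.1.1, w.2.1) \in arcs P) && ((w.1.2, w.2.2) \in arcs H)].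
  pose X2 := [set w : (V * V) * (V * V) | ((w.1.1, w.2.1) \in arcs H) && ((w.1.2, w.2.2) \in arcs P)].
  pose X3 := [set w : (V * V) * (V * V) | [&& w.2 \in arcs CH, [set w.2.1; w.1.1] \in H & [set w.2.2; w.1.2] \in H]].
  have x1 : #|X1| <= (2 * 1) * (2 * n).
    apply: leq_trans (card_quads _ _) _; apply: leq_mul.
      by apply: leq_trans (card_arcs _) _; rewrite leq_mul2l.
    by apply: leq_trans (card_arcs _) _; rewrite leq_mul2l hamc_card.
  have x2 : #|X2| <= (2 * n) * (2 * 1).
    apply: leq_trans (card_quads _ _) _; apply: leq_mul.
      by apply: leq_trans (card_arcs _) _; rewrite leq_mul2l hamc_card.
    by apply: leq_trans (card_arcs _) _; rewrite leq_mul2l.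
  have x3 : #|X3| <= 4 * (2 * (m * n)).
    apply: leq_trans (_ : 4 * #|arcs CH| <= _); last first.
      by rewrite leq_mul2l /=; apply: leq_trans (card_arcs _) _; rewrite leq_mul2l.
    apply: (@card_le_fiber _ _ snd) => [w|y _]; first by rewrite !inE => /andP[].
    apply: leq_trans (card_nbr_pairs y.1 y.2 hH).
    rewrite -[X in X <= _](card_in_imset (f := fst)).
      apply/subset_leq_card/subsetP=> f /imsetP[w]; rewrite !inE.
      by case/andP=> /and3P[_ h1 h2] /eqP <- ->; rewrite h1.
    by move=> [? ?] [? ?]; rewrite !inE /= => /andP[_ /eqP->] /andP[_ /eqP->] ->.
  have : [set w | move3 H u v w] \subset [set w | good3 B u v H w] :|: (X1 :|: (X2 :|: X3)).
    apply/subsetP=> w; rewrite in_set => /existsP[E /and5P[h1 /eqP h2 h3 h4 /andP[h5 h6]]].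
    have axH : [set w.1.1; w.2.1] \in H by rewrite h2 !inE eqxx ?orbT.
    have byH : [set w.1.2; w.2.2] \in H by rewrite h2 !inE eqxx ?orbT.
    rewrite !in_setU.
    case: (boolP (w \in X1)) => wX1; rewrite ?orbT //.
    case: (boolP (w \in X2)) => wX2; rewrite ?orbT //.
    case: (boolP (w \in X3)) => wX3; rewrite ?orbT //= orbF.
    have wP1 : [set w.1.1; w.2.1] \notin P by move: wX1; rewrite !inE byH andbT.
    have wP2 : [set w.1.2; w.2.2] \notin P by move: wX2; rewrite !inE axH.
    have wC : [set w.2.1; w.2.2] \notin CH.
      by move: wX3; rewrite 2!in_set (setUC [set w.2.1] [set w.1.1]) axH (setUC [set w.2.2] [set w.1.2]) byH !andbT.
    rewrite in_set; apply/existsP.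
    exists (E :|: [set [set u; w.1.1]; [set v; w.1.2]; [set w.2.1; w.2.2]]).
    apply/andP; split; last by apply/existsP; exists E; rewrite {1}h2 !eqxx.
    apply: BP => //.
    + rewrite subUset; apply/andP; split.
        by apply: subset_trans Hsub; rewrite h2 subsetUl.
      by apply/subsetP=> f; rewrite !inE => /orP[/orP[]|]/eqP->; rewrite ?h4 ?h5 ?h6.
    + apply/forall_inP=> q qS; have [f1 f2 _ _] := farS _ w.1.1 qS.
      have [_ _ f3 f4] := farS _ w.1.2 qS.
      rewrite !in_setU !in_set1 ![_ == [set u; _]]eq_sym ![_ == [set v; _]]eq_sym.
      rewrite (negPf f1) (negPf f2) (negPf f3) (negPf f4) /=.
      have := subsetP SC _ qS; rewrite inE => /and4P[q1 q2 q12 qc].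
      apply/negP=> /andP[/orP[q1E|/eqP q1E] /orP[q2E|/eqP q2E]].
      * by case/negP: (forall_inP HS _ qS); rewrite h2 !in_setU q1E q2E.
      * case/negP: wC; rewrite inE; apply/existsP; exists q.1; rewrite h2 in_setU q1E /=.
        by rewrite inE /= -q2E q1 q2 eq_sym q12 eq_sym qc.
      * case/negP: wC; rewrite inE; apply/existsP; exists q.2; rewrite h2 in_setU q2E /=.
        by rewrite inE /= -q1E q1 q2 q12 qc.
      by move: q12; rewrite q1E q2E eqxx.
    apply/subsetP=> f fP; move: (subsetP HP _ fP); rewrite h2 !in_setU !in_set1.
    case: (f \in E) => //= /orP[/orP[]|]/eqP fe; move: fP; rewrite fe.
    + by rewrite -eE (negPf eP).
    + by rewrite (negPf wP1).
    + by rewrite (negPf wP2).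
  move=> /subset_leq_card h; have {}h := leq_trans h (leq_card_setU _ _).
  exact: (filtered_count x1 x2 x3 gm m3 h (leq_card_setU _ _) (leq_card_setU _ _)).
have n0 : 0 < n by lia.
have {}c3 : #|A3| * g <= 64 * #|B|.
  rewrite -(leq_pmul2r n0); move: c3; clear; set a := #|A3|; set b := #|B|.
  by rewrite /expn /=; nia.
have : #|A| = #|A2| + #|A3|.
  rewrite -(cardsID A2 A) (setIidPr _) //.
  by apply/subsetP=> H; rewrite inE => /andP[].
move: c2 c3; clear; rewrite /expn /=; set a := #|A|; set b := #|B|; nia.
Qed.

Lemma touch_sparse e : e \in ES ->
  #|[set q in Cf | touch e q.1 || touch e q.2]| <= 4 * (n * m).
Proof.
move=> eES.
have star z : #|[set f in ES | z \in f]| <= n.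
  rewrite /n -cardsT; apply: leq_trans (leq_imset_card (fun y => [set z; y]) _).
  apply/subset_leq_card/subsetP=> f; rewrite inE => /andP[/ESP[x [y ->]]].
  rewrite !inE => /orP[]/eqP->; apply/imsetP; [by exists y|by exists x; rewrite // setUC].
have tch : #|[set f in ES | touch e f]| <= 2 * n.
  have [x [y eE]] := ESP eES.
  apply: leq_trans (_ : #|[set f in ES | x \in f] :|: [set f in ES | y \in f]| <= _).
    apply/subset_leq_card/subsetP=> f; rewrite !inE => /andP[-> /existsP[z]].
    by rewrite eE !inE => /andP[/orP[]/eqP-> ->]; rewrite ?orbT.
  apply: leq_trans (leq_card_setU _ _) _; rewrite mul2n -addnn.
  by apply: leq_add; apply: star.
have half : #|[set q in Cf | touch e q.1]| <= m * (2 * n).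
  apply: leq_trans (leq_mul (leqnn _) tch).
  apply: (@card_le_fiber _ _ fst) => [q|f].
    by rewrite !inE => /andP[/and4P[-> _ _ _] ->].
  rewrite inE => /andP[fES _]; apply: leq_trans (colm fES).
  rewrite -[X in X <= _](card_in_imset (f := snd)).
    apply/subset_leq_card/subsetP=> h /imsetP[q]; rewrite !inE.
    by case/andP=> /andP[/and4P[q1 q2 q3 q4] _] /eqP <- ->; rewrite q2 eq_sym.
  by move=> [? ?] [? ?]; rewrite !inE /= => /andP[_ /eqP->] /andP[_ /eqP->] ->.
have half2 : #|[set q in Cf | touch e q.2]| <= m * (2 * n).
  apply: leq_trans half; rewrite -(card_imset (f := fun q => (q.2, q.1))); last first.
    by move=> [? ?] [? ?] /= [-> ->].
  apply/subset_leq_card/subsetP=> q /imsetP[p]; rewrite !inE.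
  move=> /andP[/and4P[q1 q2 q3 q4] q5] -> /=.
  by rewrite q1 q2 eq_sym q3 eq_sym q4.
apply: leq_trans (_ : #|[set q in Cf | touch e q.1] :|: [set q in Cf | touch e q.2]| <= _).
  by apply/subset_leq_card/subsetP=> q; rewrite !inE -andb_orr.
apply: leq_trans (leq_card_setU _ _) _; lia.
Qed.

Theorem switching_rainbow : KK != set0 ->
  exists2 H, H \in KK & H \subset ES :|: F /\ {in H :\: F &, injective col}.
Proof.
move=> /allowed_nonempty Om0.
have CfP q : q \in Cf -> [/\ q.1 \in ES, q.2 \in ES & q.1 != q.2].
  by rewrite inE => /and4P[-> -> ->].
(* [gbig] and [g120] are made for c = 80 and K = 4 n m: 8 * 80^2 * 4 = 2048 * 100, and 2 * 80^2 <
   120^2. *)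
have c1 : 8 * 80 ^ 2 * (4 * (n * m)) <= g ^ 2.
  by move: gbig; rewrite /expn /=; lia.
have c2 : 2 * 80 ^ 2 < g ^ 2 by rewrite !expnS !expn0; nia.
have [H] := local_lemma CfP edge_removal touch_sparse c1 c2 Om0.
rewrite inE => /andP[HK Hs] Ha; exists H => //; split=> // e f.
rewrite !inE => /andP[eF eH] /andP[fF fH] ef; apply/eqP; apply: contraT => nef.
have eES : e \in ES by move: (subsetP Hs _ eH); rewrite inE (negPf eF) orbF.
have fES : f \in ES by move: (subsetP Hs _ fH); rewrite inE (negPf fF) orbF.
have /(forall_inP Ha) : (e, f) \in Cf by rewrite inE eES fES nef ef eqxx.
by rewrite /= eH fH.
Qed.

End Switching.

(** * Few moves force a sparse cut *)

Lemma sum_shift (P : nat -> nat) n :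
  \sum_(0 <= i < n) P i.+1 + P 0 = \sum_(0 <= i < n) P i + P n.
Proof. by rewrite addnC -big_nat_recl // big_nat_recr. Qed.

Lemma sum_point n k : \sum_(0 <= i < n) (i == k) = (k < n).
Proof.
elim: n => [|n IH]; first by rewrite big_nil.
by rewrite big_nat_recr //= IH; lia.
Qed.

(** Finds where the last h elements of [P] below n begin; these are the late positions of
    [almost_constant]. *)
Lemma sum_threshold n (P : pred nat) h : h <= \sum_(0 <= i < n) P i ->
  exists m, \sum_(0 <= i < n) (P i && (m <= i)) = h.
Proof.
elim: n h => [|n IH] h; first by rewrite big_nil leqn0 => /eqP->; exists 0; rewrite big_nil.
rewrite big_nat_recr //=; case Pn: (P n) => /= hs; last first.
  have [|m mE] := IH h; first by lia.
  by exists m; rewrite big_nat_recr //= Pn mE addn0.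
case: h hs => [|h] hs.
  by exists n.+1; rewrite big_nat big1 // => i /andP[_ ?]; lia.
have [|m mE] := IH h; first by lia.
have [mn|nm] := leqP m n.
  by exists m; rewrite big_nat_recr //= Pn mE mn addn1.
exists n; rewrite big_nat_recr //= Pn leqnn.
suff : h = 0 by move=> ->; rewrite big_nat big1 // => i /andP[_ ?]; lia.
by rewrite -mE big_nat big1 // => i /andP[_ ?]; lia.
Qed.

Lemma leq_sum_nat n (f g : nat -> nat) : (forall i, i < n -> f i <= g i) ->
  \sum_(0 <= i < n) f i <= \sum_(0 <= i < n) g i.
Proof. by move=> h; rewrite !big_nat; apply: leq_sum => i /andP[_ /h]. Qed.

Lemma sum_const_nat0 n k : \sum_(0 <= i < n) k = n * k.
Proof. by rewrite sum_nat_const_nat subn0. Qed.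

(* Vertices are positions 0, ..., n-1 on a Hamilton path; X and Y are the neighbourhoods
   of its first and last vertex. The sums in c2, c1, c4 count the 2-opt moves and the two
   kinds of 3-opt moves that close the path. *)
Section Positions.
Variables (n q h : nat) (X Y : pred nat) (G : rel nat).
Hypotheses (X0 : X 0 = false) (Xn : forall i, n <= i -> X i = false).
Hypotheses (Gs : symmetric G) (Gi : irreflexive G).
Hypothesis degX : n <= 2 * \sum_(0 <= i < n) X i.
Hypothesis degY : n <= 2 * \sum_(0 <= i < n) Y i.
Hypothesis degG : forall i, i < n -> n <= 2 * \sum_(0 <= j < n) G i j.
Hypothesis c2 : \sum_(0 <= i < n) (Y i && X i.+1) <= q.
Hypothesis c1 : \sum_(0 <= a < n) \sum_(0 <= b < n)
  [&& a < b, X b.+1, Y a.+1 & G a b] <= q * n.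
Hypothesis c4 : \sum_(0 <= a < n) \sum_(0 <= b < n)
  [&& a < b, X a.+1, Y b & G a b.+1] <= q * n.
Hypotheses (qh : q * n <= h * h) (q1 : 0 < q) (qlh : q <= h) (hn : 2 * h <= n).

Let s := \sum_(0 <= i < n) X i.
Let exc i := [&& i < n, ~~ X i.+1 & ~~ Y i].

Lemma shiftX : \sum_(0 <= i < n) X i.+1 = s.
Proof. by have := sum_shift X n; rewrite X0 (Xn (leqnn n)) !addn0. Qed.

(** X - 1 and Y have at least n/2 elements each and meet in at most q positions, so Y is nearly the
    complement of X - 1 and neither is much larger than n/2. *)
Lemma few_exceptions : \sum_(0 <= i < n) exc i <= q /\ 2 * s <= n + 2 * q.
Proof.
have : \sum_(0 <= i < n) exc i + (\sum_(0 <= i < n) X i.+1 + \sum_(0 <= i < n) Y i)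
   = n * 1 + \sum_(0 <= i < n) (Y i && X i.+1).
  rewrite -sum_const_nat0 -!big_split /= !big_nat; apply: eq_bigr => i /andP[_ lti].
  by rewrite /exc lti; case: (X _); case: (Y _).
rewrite shiftX; move: degX degY c2; rewrite -/s.
set e := \sum_(_ <= _ < _) _; set y := \sum_(_ <= _ < _) _; set z := \sum_(_ <= _ < _) _.
lia.
Qed.

(** Edges that ought not to exist: if y is not in X then, exceptions aside, y - 1 is in Y, and xy
    gives a move counted in [c4]. In [below] it is y + 2 that is not in X, so y + 1 is in Y and xy
    gives a move counted in [c1]. *)
Let above x y := [&& x < y, X x.+1, ~~ X y & G x y].
Let below x y := [&& y < x, X x.+1, ~~ X y.+2 & G x y].

Lemma few_above : \sum_(0 <= x < n) \sum_(0 <= y < n) above x y <= 2 * (q * n).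
Proof.
have [ex _] := few_exceptions.
apply: leq_trans (_ : \sum_(0 <= a < n) (\sum_(0 <= b < n)
    [&& a < b, X a.+1, Y b & G a b.+1] + \sum_(0 <= b < n) exc b) <= _); last first.
  by rewrite big_split /= sum_const_nat0 mul2n -addnn leq_add // mulnC leq_mul2r ex orbT.
apply: leq_sum_nat => a an; rewrite -big_split /=.
apply: leq_trans (_ : \sum_(0 <= y < n) above a y.+1 <= _).
  have := sum_shift (above a) n; rewrite {2}/above ltn0 /= addn0 => ->.
  exact: leq_addr.
apply: leq_sum_nat => b bn; rewrite /above /exc bn.
have [ab|ba|->] := ltngtP a b.
- by rewrite ltnS (ltnW ab); case: (X a.+1); case: (X b.+1); case: (Y b); case: (G _ _).
- by rewrite ltnS (leqNgt a b) ba.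
by rewrite ltnS leqnn; case: (X _).
Qed.

Lemma few_below : \sum_(0 <= x < n) \sum_(0 <= y < n) below x y <= 2 * (q * n).
Proof.
have [ex _] := few_exceptions.
rewrite exchange_big_nat /=.
apply: leq_trans (_ : \sum_(0 <= a < n) (\sum_(0 <= b < n)
    [&& a < b, X b.+1, Y a.+1 & G a b] + n * exc a.+1) <= _); last first.
  rewrite big_split /= -big_distrr /=.
  have := sum_shift exc n; rewrite {2 4}/exc ltnn /= addn0 => exE.
  rewrite mul2n -addnn leq_add // mulnC leq_mul2r; apply/orP; right.
  by apply: leq_trans ex; rewrite -exE leq_addr.
apply: leq_sum_nat => a an; rewrite -sum_const_nat0 -big_split /=.
apply: leq_sum_nat => b bn; rewrite /below /exc Gs.
have [ab|//] := ltnP a b; rewrite (leq_ltn_trans ab bn).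
by case: (X b.+1); case: (X a.+2); case: (Y _); case: (G _ _).
Qed.

(* Up to few errors a vertex x with x+1 in X is joined exactly to the y with pred_ x y. *)
Let pred_ x y := if y < x then X y.+2 else (x < y) && X y.
Let mism x y := pred_ x y != G x y.

(** For y < x the tested positions y + 2 reach up to x + 1, for y > x they start at x + 1; only x +
    1 can be counted twice. *)
Lemma pred_sum x : \sum_(0 <= y < n) pred_ x y <= s + 1.
Proof.
pose P y := (y < x.+2) && X y.
have P2 : \sum_(0 <= y < n) P y.+2 <= \sum_(0 <= y < n) P y.
  have := sum_shift (fun y => P y.+1) n; have := sum_shift P n.
  have -> : P n = false by rewrite /P Xn ?andbF.
  have -> : P n.+1 = false by rewrite /P Xn ?andbF // leqnSn.
  by rewrite /=; lia.
apply: leq_trans (_ : \sum_(0 <= y < n) (P y.+2 + ((x < y) && X y)) <= _).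
  apply: leq_sum_nat => y yn; rewrite /pred_ /P !ltnS.
  by case: ltnP => //; case: (X _).
rewrite big_split /=; apply: leq_trans (leq_add P2 (leqnn _)) _.
rewrite -big_split /=.
apply: leq_trans (_ : \sum_(0 <= y < n) (X y + (y == x.+1)) <= _).
  by apply: leq_sum_nat => y _; rewrite /P; case: (X y); rewrite ?andbF ?andbT /=; lia.
by rewrite big_split /= leq_add2l sum_point; case: (_ < _).
Qed.

(** So far only edges outside the prediction are known to be few. As the prediction has hardly more
    than n/2 elements and every degree is at least n/2, the predicted non-edges are few as well. *)
Lemma few_mismatches :
  \sum_(0 <= x < n) (X x.+1 * \sum_(0 <= y < n) mism x y) <= 10 * (q * n).
Proof.
have [_ sE] := few_exceptions.
have row x : x < n -> X x.+1 * \sum_(0 <= y < n) mism x y <=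
   2 * q + 2 * (\sum_(0 <= y < n) above x y + \sum_(0 <= y < n) below x y).
  move=> xn; case Xx: (X x.+1) => //; rewrite mul1n.
  have e1 : \sum_(0 <= y < n) mism x y + \sum_(0 <= y < n) G x y <=
     \sum_(0 <= y < n) pred_ x y + 2 * (\sum_(0 <= y < n) above x y + \sum_(0 <= y < n) below x y).
    rewrite -!big_split /= big_distrr -!big_split /=; apply: leq_sum_nat => y yn.
    rewrite /mism /above /below /pred_ Xx /=.
    case: ltngtP => [lt|lt|->] /=; last by rewrite Gi.
      by case: (X y.+2); case: (G x y).
    by case: (X y); case: (G x y).
  have := pred_sum x; have := degG xn; lia.
apply: leq_trans (leq_sum_nat row) _.
rewrite big_split /= sum_const_nat0 -big_distrr big_split /=.
have := few_above; have := few_below; lia.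
Qed.

Lemma few_inversions :
  \sum_(0 <= x < n) \sum_(0 <= y < n)
     [&& x < y, X x.+1, X y.+1 & X y != X x.+2] <= 20 * (q * n).
Proof.
apply: leq_trans (_ : \sum_(0 <= x < n) \sum_(0 <= y < n) (X x.+1 * mism x y) +
   \sum_(0 <= x < n) \sum_(0 <= y < n) (X y.+1 * mism y x) <= _); last first.
  rewrite [X in _ + X]exchange_big_nat /=.
  have := few_mismatches; under eq_bigr => x _ do rewrite big_distrr /=.
  by lia.
rewrite -big_split /=; apply: leq_sum_nat => x xn; rewrite -big_split /=.
apply: leq_sum_nat => y yn; rewrite /mism /pred_ (Gs y x).
case: ltngtP => //= _.
by case: (X x.+1); case: (X y.+1); case: (X x.+2); case: (X y); case: (G x y).
Qed.

(* For two such vertices x < y, reading the edge xy from x and from y gives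
   X y = X x.+2; comparing all x with one late y makes X x.+2 almost constant. *)
Lemma almost_constant : exists c, \sum_(0 <= x < n) (X x.+1 && (X x.+2 != c)) <= 21 * h.
Proof.
have h0 : 0 < h by apply: leq_trans qlh.
have sX : h <= \sum_(0 <= x < n) X x.+1 by rewrite shiftX; move: degX; rewrite -/s; lia.
have [m mE] := @sum_threshold n (fun x => X x.+1) h sX.
pose bad t := \sum_(0 <= x < n) [&& x < t, X x.+1 & X t != X x.+2].
(* Averaging over the h late positions: if each had more than 20 h bad x, there would be more than
   20 h^2 >= 20 q n inversions. *)
have /hasP[t] : has (fun t => [&& X t.+1, m <= t & bad t <= 20 * h]) (index_iota 0 n).
  apply: contraT => /hasPn no.
  suff : h * (20 * h + 1) <= 20 * (q * n) by nia.
  apply: leq_trans few_inversions; rewrite exchange_big_nat /= -{1}mE big_distrl /=.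
  apply: leq_sum_nat => t tn; have := no t; rewrite mem_index_iota tn => /(_ isT).
  rewrite !negb_and -ltnNge; case Xt: (X t.+1) => //=; case: leqP => //= mt.
  by rewrite mul1n addn1 ltnNge.
rewrite mem_index_iota => /= tn /and3P[Xt mt bt]; exists (X t).
apply: leq_trans (_ : bad t + \sum_(0 <= x < n) (X x.+1 && (m <= x)) <= _); last first.
  by rewrite mE; lia.
rewrite -big_split /=; apply: leq_sum_nat => x xn.
case: (ltnP x t) => xt; first by rewrite eq_sym; case: (X x.+1); case: (_ != _).
by rewrite (leq_trans mt xt) andbT; case: (X _); case: (_ != _).
Qed.

(** If c is true, X is nearly closed under successor, hence consists of few blocks; this leads to
    two cliques. If c is false, X has few consecutive elements, and having density 1/2 it nearly
    alternates; this leads to a bipartite graph. Both kinds of set are nearly invariant under a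
    shift by two. *)
Lemma almost_periodic : \sum_(0 <= y < n) (X y.+2 && ~~ X y) <= 44 * h.
Proof.
have [c cP] := almost_constant.
have [_ sE] := few_exceptions.
have {}cP : \sum_(0 <= x < n) (X x && (X x.+1 != c)) <= 21 * h.
  apply: leq_trans cP; have := sum_shift (fun x => X x && (X x.+1 != c)) n.
  by rewrite X0 (Xn (leqnn n)) /= !addn0 => ->.
have sX := shiftX.
case: c cP => cP.
  pose P x := X x.+1 && ~~ X x.
  have PE : \sum_(0 <= x < n) P x <= 21 * h.
    have : \sum_(0 <= x < n) P x + \sum_(0 <= x < n) X x =
      \sum_(0 <= x < n) X x.+1 + \sum_(0 <= x < n) (X x && (X x.+1 != true)).
      rewrite -!big_split /=; apply: eq_bigr => x _; rewrite /P.
      by case: (X x); case: (X x.+1).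
    by rewrite -/s sX; lia.
  apply: leq_trans (_ : \sum_(0 <= y < n) P y.+1 + \sum_(0 <= y < n) P y <= _).
    rewrite -big_split /=; apply: leq_sum_nat => y yn; rewrite /P.
    by case: (X y); case: (X y.+1); case: (X y.+2).
  have := sum_shift P n; rewrite {4}/P Xn //=; lia.
pose P x := X x && X x.+1.
pose Q x := ~~ X x && ~~ X x.+1.
have PE : \sum_(0 <= x < n) P x <= 21 * h.
  by apply: leq_trans cP; apply: leq_sum_nat => x _; rewrite /P; case: (X x); case: (X _).
have QE : \sum_(0 <= x < n) Q x <= 21 * h.
  have : \sum_(0 <= x < n) Q x + (\sum_(0 <= x < n) X x + \sum_(0 <= x < n) X x.+1) =
      n * 1 + \sum_(0 <= x < n) P x.
    rewrite -sum_const_nat0 -!big_split /=; apply: eq_bigr => x _; rewrite /P /Q.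
    by case: (X x); case: (X x.+1).
  by rewrite sX -/s; move: degX; rewrite -/s; lia.
apply: leq_trans (_ : \sum_(0 <= y < n) P y.+1 + \sum_(0 <= y < n) Q y <= _).
  rewrite -big_split /=; apply: leq_sum_nat => y yn; rewrite /P /Q.
  by case: (X y); case: (X y.+1); case: (X y.+2).
have := sum_shift P n; rewrite {4}/P Xn //=; lia.
Qed.

(** An edge xy with y < x and y outside X is counted by [below] unless y + 2 is in X, which
    [almost_periodic] makes rare. *)
Lemma sparse_cut : 2 * s <= n + 2 * q /\
  \sum_(0 <= x < n) \sum_(0 <= y < n) [&& X x.+1, ~~ X y & G x y] <= 48 * (h * n).
Proof.
have [_ sE] := few_exceptions; split=> //.
apply: leq_trans (_ : \sum_(0 <= x < n) (\sum_(0 <= y < n) above x y +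
   (\sum_(0 <= y < n) below x y + \sum_(0 <= y < n) (X y.+2 && ~~ X y))) <= _); last first.
  rewrite !big_split /= sum_const_nat0.
  have := few_above; have := few_below; have := leq_mul (leqnn n) almost_periodic.
  have := leq_mul qlh (leqnn n); lia.
apply: leq_sum_nat => x xn; rewrite -!big_split /=; apply: leq_sum_nat => y yn.
rewrite /above /below; case: (ltngtP x y) => [_|_|->] /=; last by rewrite Gi !andbF.
  by case: (X x.+1); case: (X y); case: (G x y).
by case: (X x.+1); case: (X y); case: (X y.+2); case: (G x y).
Qed.

End Positions.

(** * From positions on a Hamilton path to vertices of the graph *)

Lemma card_ord_sum n (P : pred nat) :
  \sum_(0 <= i < n) P i = #|[set i : 'I_n | P i]|.
Proof. by rewrite big_mkord -sum1dep_card [RHS]big_mkcond; apply: eq_bigr => i _; case: (P i). Qed.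

Lemma card_ord_sum2 n (P : rel nat) :
  \sum_(0 <= i < n) \sum_(0 <= j < n) P i j = #|[set w : 'I_n * 'I_n | P w.1 w.2]|.
Proof.
rewrite big_mkord -sum1dep_card (eq_bigr (fun i : 'I_n => \sum_(j < n) P i j)).
  rewrite pair_bigA /= [RHS]big_mkcond; apply: eq_bigr => i _.
  by case: (P _ _).
by move=> i _; rewrite big_mkord.
Qed.

Lemma sum_nth_uniq (V : finType) (s : seq V) u (f : V -> nat) :
  uniq s -> size s = #|V| -> \sum_(0 <= i < #|V|) f (nth u s i) = \sum_y f y.
Proof.
move=> us ss; rewrite -ss -(big_nth u xpredT) /=.
have su : perm_eq s (index_enum V).
  apply: uniq_perm => //; first exact: index_enum_uniq.
  have /(uniq_min_size us) [] // : {subset s <= index_enum V}.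
    by move=> y _; rewrite mem_index_enum.
  by rewrite ss cardT enumT.
exact: perm_big.
Qed.

Lemma card_sum (V : finType) (P : pred V) : \sum_y P y = #|[set y | P y]|.
Proof. by rewrite -sum1dep_card [RHS]big_mkcond; apply: eq_bigr => i _; case: (P i). Qed.

Section Graph.
Variables (V : finType) (G : rel V).
Let n := #|V|.
Hypotheses (Gs : symmetric G) (Gi : irreflexive G).

Definition gedges : {set {set V}} :=
  [set e : {set V} | [exists x, exists y, G x y && (e == [set x; y])]].

Lemma gedgesP e : reflect (exists x y, G x y /\ e = [set x; y]) (e \in gedges).
Proof.
rewrite inE; apply: (iffP existsP) => [[x /existsP[y /andP[h /eqP->]]]|[x [y [h ->]]]].
  by exists x, y.
by exists x; apply/existsP; exists y; rewrite h eqxx.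
Qed.

Lemma gedgesE x y : ([set x; y] \in gedges) = G x y.
Proof.
apply/gedgesP/idP => [[a [b [h /set2_inj[[-> ->]|[-> ->]]]]]|h] //; first by rewrite Gs.
by exists x, y.
Qed.

Section AtEdge.
Variables (u v : V) (t : seq V).
Let s := u :: t.
Hypotheses (us : uniq s) (ss : size s = n) (lt : last u t = v).
Let p i := nth u s i.

Lemma nth_pos_inj i j : i < n -> j < n -> p i = p j -> i = j.
Proof. by rewrite -ss => hi hj /eqP; rewrite nth_uniq // => /eqP. Qed.

Lemma nth_pos_last : p n.-1 = v.
Proof. by rewrite /p -ss nth_last. Qed.

Hypothesis n3 : 2 < n.
Let KK : {set {set {set V}}} := [set H | hamc H].

Lemma card_move2 : \sum_(0 <= i < n) ((i < n) && G v (p i) && ((i.+1 < n) && G u (p i.+1)))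
  <= #|[set w | move2 KK gedges (cyc s) u v w]|.
Proof.
rewrite (card_ord_sum n (fun i => (i < n) && G v (p i) && ((i.+1 < n) && G u (p i.+1)))).
rewrite -(card_in_imset (f := fun i : 'I_n => (p i.+1, p i))); last first.
  by move=> i j _ _ [_ /nth_pos_inj h]; apply/val_inj/h.
apply/subset_leq_card/subsetP=> w /imsetP[i]; rewrite inE => /andP[/andP[_ h1] /andP[h2 h3]] ->.
have s3 : 2 < size s by rewrite ss.
have i1 : i.+1 < size s by rewrite ss.
have [E [e1 e2 e3]] := two_opt us ss lt s3 i1.
by rewrite inE; apply/existsP; exists E; rewrite e1 e2 eqxx inE e3 !gedgesE h3 h1.
Qed.

Lemma card_move31 : \sum_(0 <= a < n) \sum_(0 <= b < n)
   [&& a < b, (b.+1 < n) && G u (p b.+1), (a.+1 < n) && G v (p a.+1) & G (p a) (p b)]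
  <= #|[set w | move3 KK gedges (cyc s) u v w]|.
Proof.
rewrite (card_ord_sum2 n (fun a b => [&& a < b, (b.+1 < n) && G u (p b.+1), (a.+1 < n) && G v (p a.+1) & G (p a) (p b)])).
rewrite -(card_in_imset (f := fun w : 'I_n * 'I_n => ((p w.2.+1, p w.1.+1), (p w.2, p w.1)))); last first.
  by move=> [a b] [a' b'] _ _ /= [_ _ /nth_pos_inj hb /nth_pos_inj ha]; congr pair; apply/val_inj; [apply: ha|apply: hb].
apply/subset_leq_card/subsetP=> w /imsetP[[a b]]; rewrite inE /= => /and4P[ab /andP[bn h1] /andP[an h2] h3] ->.
have b1 : b.+1 < size s by rewrite ss.
have [E [e1 e2 e3]] := three_opt1 us ss lt ab b1.
by rewrite inE; apply/existsP; exists E; rewrite e1 e2 eqxx inE e3 !gedgesE h1 h2 Gs h3.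
Qed.

Lemma card_move32 : \sum_(0 <= a < n) \sum_(0 <= b < n)
   [&& a < b, (a.+1 < n) && G u (p a.+1), (b < n) && G v (p b) & G (p a) (p b.+1)]
  <= #|[set w | move3 KK gedges (cyc s) u v w]|.
Proof.
rewrite (card_ord_sum2 n (fun a b => [&& a < b, (a.+1 < n) && G u (p a.+1), (b < n) && G v (p b) & G (p a) (p b.+1)])).
rewrite -(card_in_imset (f := fun w : 'I_n * 'I_n => ((p w.1.+1, p w.2), (p w.1, p w.2.+1)))); last first.
  by move=> [a b] [a' b'] _ _ /= [_ /nth_pos_inj hb /nth_pos_inj ha _]; congr pair; apply/val_inj; [apply: ha|apply: hb].
apply/subset_leq_card/subsetP=> w /imsetP[[a b]]; rewrite inE /= => /and4P[ab /andP[an h1] /andP[bn h2] h3] ->.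
(* The move needs a position after b: the last position holds v, which is not its own neighbour. *)
have b1 : b.+1 < size s.
  rewrite ss; have := ltn_ord b; rewrite leq_eqVlt => /orP[/eqP bE|//].
  have bl : b = n.-1 :> nat by lia.
  by move: h2; rewrite bl nth_pos_last Gi.
have [E [e1 e2 e3]] := three_opt2 us ss lt ab b1.
by rewrite inE; apply/existsP; exists E; rewrite e1 e2 eqxx inE e3 !gedgesE h1 h2 h3.
Qed.

Lemma dichotomy_at (q h : nat) :
  (forall x, n <= 2 * #|[set y | G x y]|) ->
  q * n <= h * h -> 0 < q -> q <= h -> 2 * h <= n ->
  [\/ q <= #|[set w | move2 KK gedges (cyc s) u v w]|,
      q * n <= #|[set w | move3 KK gedges (cyc s) u v w]| |
      exists S0 S1 : {set V}, [/\ n <= 2 * #|S0| <= n + 2 * q,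
         n - 2 * q <= 2 * #|S1| <= n &
         \sum_(x in S0) \sum_(y in S1) G x y <= 48 * (h * n)]].
Proof.
move=> dG qh q0 qlh hn.
case: (leqP q #|[set w | move2 _ _ _ _ _ w]|) => [|m2]; first by constructor 1.
case: (leqP (q * n) #|[set w | move3 _ _ _ _ _ w]|) => [|m3]; first by constructor 2.
constructor 3.
pose X i := (i < n) && G u (p i); pose Y i := (i < n) && G v (p i).
pose G' i j := G (p i) (p j).
have degE (P : pred V) : \sum_(0 <= i < n) ((i < n) && P (p i)) = #|[set y | P y]|.
  rewrite -card_sum -(sum_nth_uniq u (fun y => nat_of_bool (P y)) us ss) !big_nat.
  by apply: eq_bigr => i /andP[_ ->].
have X0 : X 0 = false by rewrite /X /p /= Gi andbF.
have Xn i : n <= i -> X i = false by rewrite /X leqNgt => /negPf ->.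
have G's : symmetric G' by move=> i j; apply: Gs.
have G'i : irreflexive G' by move=> i; apply: Gi.
have dX : n <= 2 * \sum_(0 <= i < n) X i by rewrite (degE (G u)).
have dY : n <= 2 * \sum_(0 <= i < n) Y i by rewrite (degE (G v)).
have dG' i : i < n -> n <= 2 * \sum_(0 <= j < n) G' i j.
  move=> ilt; apply: leq_trans (dG (p i)) _; rewrite -(degE (G (p i))).
  by rewrite leq_mul2l /=; apply: leq_sum_nat => j ->.
have c2 : \sum_(0 <= i < n) (Y i && X i.+1) <= q.
  by apply: leq_trans (ltnW m2); apply: card_move2.
have c1 : \sum_(0 <= a < n) \sum_(0 <= b < n) [&& a < b, X b.+1, Y a.+1 & G' a b] <= q * n.
  by apply: leq_trans (ltnW m3); apply: card_move31.
have c4 : \sum_(0 <= a < n) \sum_(0 <= b < n) [&& a < b, X a.+1, Y b & G' a b.+1] <= q * n.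
  by apply: leq_trans (ltnW m3); apply: card_move32.
have [sX cut] := sparse_cut X0 Xn G's G'i dX dY dG' c2 c1 c4 qh q0 qlh hn.
have sXE : \sum_(0 <= i < n) X i = #|[set y | G u y]| by apply: (degE (G u)).
pose N := [set y | G u y].
(* The path predecessors of the neighbours of u; they are paired with the non-neighbours of u. *)
pose S0 := [set p i | i : 'I_n & X i.+1].
exists S0, (~: N).
have cS0 : #|S0| = \sum_(0 <= i < n) X i.
  rewrite card_in_imset; last first.
    by move=> i j _ _ /nth_pos_inj h1; apply/val_inj/h1.
  rewrite -(card_ord_sum n (fun i => X i.+1)); exact: (shiftX X0 Xn).
have cN := cardsC N; rewrite -/N in sXE.
split; first by rewrite cS0; apply/andP; split.
  by move: sX dX; rewrite sXE; move: cN; rewrite -/n; lia.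
apply: leq_trans cut; rewrite big_imset /=; last first.
  by move=> i j _ _ /nth_pos_inj h1; apply/val_inj/h1.
rewrite big_mkcond /= big_mkord; apply: leq_sum => i _.
rewrite inE; case Xi: (X i.+1) => //.
rewrite (big_mkcond (fun y => y \in ~: N)) /=.
rewrite -(sum_nth_uniq u _ us ss); apply: leq_sum_nat => j jn.
by rewrite !inE /X jn /=; case: (G u _).
Qed.

End AtEdge.
End Graph.

(** * The two extremal structures *)

(* k = false: both ends on the same side; k = true: ends on opposite sides. *)
Definition sideR (V : finType) (A : {set V}) (k : bool) : rel V :=
  fun x y => ((x \in A) (+) (y \in A)) == k.

Lemma sideR_sym (V : finType) (A : {set V}) k : symmetric (sideR A k).
Proof. by move=> x y; rewrite /sideR addbC. Qed.

Lemma sum_card_in (V : finType) (A : {set V}) : \sum_x (x \in A) = #|A|.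
Proof. by rewrite card_sum; apply: eq_card => x; rewrite inE. Qed.

Lemma sum_const_fin (V : finType) k : \sum_(x : V) k = #|V| * k.
Proof. exact: sum_nat_const. Qed.

Section Structure.
Variables (V : finType) (G : rel V) (q h r : nat).
Let n := #|V|.
Hypotheses (Gs : symmetric G).
Hypothesis dG : forall x, n <= 2 * \sum_y G x y.
Hypotheses (qlh : q <= h) (hr : h <= r) (hnr : 96 * (h * n) <= r * r) (rn : 8 * r <= n) (n0 : 0 < n) (r0 : 0 < r).

(** If [S0] and [S1] share fewer than r vertices, they are almost complementary and [S0] is nearly
    separated. Otherwise some common vertex has at most r neighbours in the union, since else r (r +
    1) <= 96 h n; its degree then bounds the union by n/2 + r, so [S0] and [S1] almost coincide and
    [S0] is nearly independent. *)
Lemma sparse_side (S0 S1 : {set V}) :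
  n <= 2 * #|S0| <= n + 2 * q -> n - 2 * q <= 2 * #|S1| <= n ->
  \sum_(x in S0) \sum_(y in S1) G x y <= 48 * (h * n) ->
  exists k, \sum_x \sum_y [&& x \in S0, ~~ sideR S0 k x y & G x y] <= 3 * (r * n).
Proof.
move=> /andP[s0 s0'] /andP[s1 s1'] cut.
have {}cut : \sum_x \sum_y [&& x \in S0, y \in S1 & G x y] <= 48 * (h * n).
  apply: leq_trans cut; rewrite [leqRHS]big_mkcond; apply: leq_sum => x _.
  case: (x \in S0); last by rewrite big1.
  by rewrite [leqRHS]big_mkcond; apply: leq_sum => y _; case: (y \in S1).
have cut' : \sum_x \sum_y [&& x \in S1, y \in S0 & G x y] <= 48 * (h * n).
  apply: leq_trans cut; rewrite exchange_big; apply: leq_sum => x _; apply: leq_sum => y _.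
  by rewrite Gs; case: (_ \in _); case: (_ \in _).
have hrn : 48 * (h * n) <= r * n by nia.
have cUI := cardsUI S0 S1.
have key (X : {set V}) k : #|X| <= q + r ->
    (forall x y, x \in S0 -> ~~ sideR S0 k x y -> y \in S1 \/ y \in X) ->
    \sum_x \sum_y [&& x \in S0, ~~ sideR S0 k x y & G x y] <= 3 * (r * n).
  move=> cX sub; apply: leq_trans (_ : \sum_x (\sum_y [&& x \in S0, y \in S1 & G x y] +
     \sum_y (y \in X)) <= _).
    apply: leq_sum => x _; rewrite -big_split /=; apply: leq_sum => y _.
    have := sub x y; case: (x \in S0) => //= /(_ isT); case: sideR => //= /(_ isT).
    by case=> ->; case: (G x y); rewrite ?addn1 ?leq_addr.
  rewrite big_split /= sum_card_in sum_const_fin -/n.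
  have : n * #|X| <= n * (2 * r) by rewrite leq_mul2l; apply/orP; right; lia.
  by move: cut hrn; clear; nia.
have [rI|Ir] := leqP r #|S0 :&: S1|; last first.
  exists false; apply: (key (~: (S0 :|: S1))).
    by have := cardsC (S0 :|: S1); rewrite -/n; lia.
  by move=> x y xS; rewrite /sideR xS eqbF_neg negbK !inE /= => /negPf ->; case: (y \in S1); auto.
exists true.
have [x xU xd] : exists2 x, x \in S0 :&: S1 & \sum_y (G x y && (y \in S0 :|: S1)) <= r.
  apply/exists_inP; apply: contraT; rewrite negb_exists_in => /forall_inP no.
  have : \sum_(x in S0 :&: S1) r.+1 <= \sum_(x in S0 :&: S1) \sum_y (G x y && (y \in S0 :|: S1)).
    by apply: leq_sum => x /no; rewrite -ltnNge.
  rewrite sum_nat_const.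
  have : \sum_(x in S0 :&: S1) \sum_y (G x y && (y \in S0 :|: S1)) <=
     \sum_x \sum_y [&& x \in S0, y \in S1 & G x y] + \sum_x \sum_y [&& x \in S1, y \in S0 & G x y].
    rewrite big_mkcond -big_split /=; apply: leq_sum => x _.
    rewrite inE; case: (x \in S0); case: (x \in S1) => //=.
    rewrite -big_split /=; apply: leq_sum => y _; rewrite inE.
    by case: (y \in S0); case: (y \in S1); case: (G x y).
  by move: cut cut' rI hnr r0; clear; nia.
have cU : 2 * #|S0 :|: S1| <= n + 2 * r.
  have := dG x; have : \sum_y G x y <= \sum_y (G x y && (y \in S0 :|: S1)) + \sum_y (y \in ~: (S0 :|: S1)).
    rewrite -big_split /=; apply: leq_sum => y _; rewrite in_setC.
    by case: (_ \in _); case: (G x y).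
  rewrite sum_card_in; have := cardsC (S0 :|: S1); rewrite -/n; lia.
apply: (key (S0 :\: S1)).
  by have := cardsUI S1 (S0 :\: S1); have := cardsID S1 S0; lia.
move=> a b aS; rewrite /sideR aS addTb eqb_id negbK inE => ->.
by case: (b \in S1); auto.
Qed.

Lemma side_nonedges (S : {set V}) k :
  n <= 2 * #|S| <= n + 2 * q ->
  \sum_x \sum_y [&& x \in S, ~~ sideR S k x y & G x y] <= 3 * (r * n) ->
  \sum_x \sum_y (sideR S k x y && ~~ G x y) <= 8 * (r * n).
Proof.
move=> /andP[s0 s0'] cut.
have cR x : 2 * \sum_y sideR S k x y <= n + 2 * q.
  have cC := cardsC S; rewrite -/n in cC.
  have : \sum_y sideR S k x y <= maxn #|S| #|~: S|.
    rewrite leq_max; case: k {cut}; case: (boolP (x \in S)) => xS; apply/orP; [right|left|left|right];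
    rewrite -sum_card_in; apply: leq_sum => y _; rewrite /sideR ?xS ?(negPf xS) ?inE; by case: (y \in S).
  rewrite /maxn; case: ifP => _; lia.
have row x : \sum_y (sideR S k x y && ~~ G x y) <= q + \sum_y (~~ sideR S k x y && G x y).
  have : \sum_y (sideR S k x y && ~~ G x y) + \sum_y G x y =
     \sum_y sideR S k x y + \sum_y (~~ sideR S k x y && G x y).
    rewrite -!big_split /=; apply: eq_bigr => y _.
    by case: (G x y); case: (sideR S k x y).
  have := cR x; have := dG x; lia.
have qn : n * q <= r * n by rewrite mulnC leq_mul2r (leq_trans qlh hr) orbT.
(* For k = true only edges inside [S] are controlled, but every missing pair has an end in [S]. For
   k = false each crossing edge is charged to its end in [S]. *)
case: k cut cR row => cut cR row.
  apply: leq_trans (_ : \sum_x \sum_y [&& x \in S, sideR S true x y & ~~ G x y] +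
     \sum_x \sum_y [&& y \in S, sideR S true x y & ~~ G x y] <= _).
    rewrite -big_split /=; apply: leq_sum => x _; rewrite -big_split /=; apply: leq_sum => y _.
    by rewrite /sideR; case: (x \in S); case: (y \in S); case: (G x y).
  have -> : \sum_x \sum_y [&& y \in S, sideR S true x y & ~~ G x y] =
      \sum_x \sum_y [&& x \in S, sideR S true x y & ~~ G x y].
    rewrite exchange_big; apply: eq_bigr => x _; apply: eq_bigr => y _.
    by rewrite sideR_sym Gs.
  have : \sum_x \sum_y [&& x \in S, sideR S true x y & ~~ G x y] <=
     \sum_x (q + \sum_y [&& x \in S, ~~ sideR S true x y & G x y]).
    apply: leq_sum => x _; case: (x \in S); last by rewrite big1.
    exact: row.
  rewrite big_split /= sum_const_fin -/n; lia.
apply: leq_trans (_ : \sum_x (q + \sum_y (~~ sideR S false x y && G x y)) <= _).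
  by apply: leq_sum => x _; apply: row.
rewrite big_split /= sum_const_fin -/n.
have : \sum_x \sum_y (~~ sideR S false x y && G x y) <=
  \sum_x \sum_y [&& x \in S, ~~ sideR S false x y & G x y] +
  \sum_x \sum_y [&& y \in S, ~~ sideR S false x y & G x y].
  rewrite -big_split /=; apply: leq_sum => x _; rewrite -big_split /=; apply: leq_sum => y _.
  by rewrite /sideR; case: (x \in S); case: (y \in S); case: (G x y).
have -> : \sum_x \sum_y [&& y \in S, ~~ sideR S false x y & G x y] =
      \sum_x \sum_y [&& x \in S, ~~ sideR S false x y & G x y].
  rewrite exchange_big; apply: eq_bigr => x _; apply: eq_bigr => y _.
  by rewrite sideR_sym Gs.
lia.
Qed.

(** A vertex with fewer than n/4 neighbours of the right type misses at least n/8 pairs, so there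
    are at most 64 r of them; having degree n/2, they get n/4 right neighbours by changing sides.
    The constants are 256 = 4 * 64, 136 = 8 + 2 * 64 and 130 = 2 + 2 * 64. *)
Lemma extremal_structure (S0 S1 : {set V}) :
  n <= 2 * #|S0| <= n + 2 * q -> n - 2 * q <= 2 * #|S1| <= n ->
  \sum_(x in S0) \sum_(y in S1) G x y <= 48 * (h * n) ->
  exists (A : {set V}) k,
  [/\ forall x, n <= 4 * (\sum_y (sideR A k x y && G x y)) + 256 * r,
      \sum_x \sum_y (sideR A k x y && ~~ G x y) <= 136 * (r * n),
      n <= 2 * #|A| + 130 * r & 2 * #|A| <= n + 130 * r].
Proof.
move=> s0 s1 cut; have [k cutk] := sparse_side s0 s1 cut.
have NS := side_nonedges s0 cutk.
pose Fl := [set v | 4 * (\sum_y (sideR S0 k v y && G v y)) < n].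
have cFl : #|Fl| <= 64 * r.
  have h1 : n * #|Fl| <= 8 * (8 * (r * n)).
    apply: leq_trans (_ : 8 * \sum_x \sum_y (sideR S0 k x y && ~~ G x y) <= _); last by rewrite leq_mul2l NS.
    rewrite mulnC -sum_nat_const big_distrr /= [leqLHS]big_mkcond; apply: leq_sum => x _.
    rewrite inE; case: ifP => // xF.
    have : \sum_y (sideR S0 k x y && ~~ G x y) + \sum_y (sideR S0 k x y && G x y) = \sum_y sideR S0 k x y.
      by rewrite -big_split /=; apply: eq_bigr => y _; case: (G x y); case: sideR.
    have : n - 2 * q <= 2 * \sum_y sideR S0 k x y.
      have cC := cardsC S0; rewrite -/n in cC.
      have : minn #|S0| #|~: S0| <= \sum_y sideR S0 k x y.
        rewrite geq_min; case: (k); case: (boolP (x \in S0)) => xS; apply/orP; [right|left|left|right];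
        rewrite -sum_card_in; apply: leq_sum => y _; rewrite /sideR ?xS ?(negPf xS) ?inE; by case: (y \in S0).
      rewrite /minn; case: ifP => _; lia.
    lia.
  by rewrite -(leq_pmul2l n0); lia.
pose A := [set v | (v \in S0) (+) (v \in Fl)].
have RA x y : sideR A k x y = sideR S0 k x y (+) (x \in Fl) (+) (y \in Fl).
  by rewrite /sideR !in_set -!/Fl; case: (_ < _); case: (_ < _); case: (x \in S0); case: (y \in S0); case: (k).
exists A, k; split.
- move=> x; have h1 : \sum_y ((sideR S0 k x y (+) (x \in Fl)) && G x y) <=
      \sum_y (sideR A k x y && G x y) + #|Fl|.
    rewrite -sum_card_in -big_split /=; apply: leq_sum => y _; rewrite RA.
    by case: (sideR _ _ _ _); case: (x \in Fl); case: (y \in Fl); case: (G x y).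
  have h2 : n <= 4 * \sum_y ((sideR S0 k x y (+) (x \in Fl)) && G x y).
    rewrite inE; case: (ltnP _ n) => xF; last first.
      by apply: leq_trans xF _; rewrite leq_mul2l; apply: leq_sum => y _; rewrite addbF.
    have : \sum_y G x y = \sum_y (sideR S0 k x y && G x y) + \sum_y ((sideR S0 k x y (+) true) && G x y).
      by rewrite -big_split /=; apply: eq_bigr => y _; case: (G x y); case: sideR.
    by have := dG x; lia.
  lia.
- apply: leq_trans (_ : \sum_x (\sum_y (sideR S0 k x y && ~~ G x y) + (n * (x \in Fl) + #|Fl|)) <= _).
    apply: leq_sum => x _; rewrite -sum_card_in -sum_const_fin -!big_split /=.
    apply: leq_sum => y _; rewrite RA.
    by case: (sideR _ _ _ _); case: (x \in Fl); case: (y \in Fl); case: (G x y).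
  rewrite big_split /= big_split /= -big_distrr /= sum_card_in sum_const_fin -/n.
  by have := leq_mul (leqnn n) cFl; lia.
- have : #|S0| <= #|A| + #|Fl|.
    rewrite -!sum_card_in -big_split /=; apply: leq_sum => y _; rewrite (in_set (fun v => _ (+) _)).
    by case: (_ \in _); case: (_ \in Fl).
  by case/andP: s0; lia.
have : #|A| <= #|S0| + #|Fl|.
  rewrite -!sum_card_in -big_split /=; apply: leq_sum => y _; rewrite (in_set (fun v => _ (+) _)).
  by case: (_ \in _); case: (_ \in Fl).
by case/andP: s0; lia.
Qed.

End Structure.

(** * Moves in the extremal structures *)

Lemma set_in_id (T : finType) (B : {set T}) : [set x | x \in B] = B.
Proof. by apply/setP=> x; rewrite inE. Qed.

Lemma card_pairs_fst (n k : nat) (P : pred 'I_n) :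
  #|[set i | P i]| <= k -> #|[set w : 'I_n * 'I_n | P w.1]| <= k * n.
Proof.
move=> h; have -> : [set w : 'I_n * 'I_n | P w.1] = setX [set i | P i] setT.
  by apply/setP=> w; rewrite !inE andbT.
by rewrite cardsX cardsT card_ord leq_mul2r h orbT.
Qed.

Lemma card_pairs_snd (n k : nat) (P : pred 'I_n) :
  #|[set i | P i]| <= k -> #|[set w : 'I_n * 'I_n | P w.2]| <= k * n.
Proof.
move=> h; have -> : [set w : 'I_n * 'I_n | P w.2] = setX setT [set i | P i].
  by apply/setP=> w; rewrite !inE.
by rewrite cardsX cardsT card_ord mulnC leq_mul2r h orbT.
Qed.

Lemma cover_count (a n N D I g u0 u1 u2 u3 u4 u5 b0 b1 b2 b3 b4 b5 b6 f : nat) :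
  2 * a + 2 * n + 6 * (f * n) + 2 * N <= D -> D <= I -> I <= g + u0 -> u0 <= b0 + u1 ->
  u1 <= b1 + u2 -> u2 <= b2 + u3 -> u3 <= b3 + u4 -> u4 <= b4 + u5 -> u5 <= b5 + b6 ->
  b0 <= n -> b1 <= 1 * n -> b2 <= 2 * f * n -> b3 <= 2 * f * n -> b4 <= 2 * f * n ->
  b5 <= N -> b6 <= N -> 2 * a <= g.
Proof. lia. Qed.

(** Outside [F] the edges only have to be of the right type, not in the graph, so that a member can
    be constructed directly. *)
Definition side_cycles (V : finType) (A : {set V}) (k : bool) (F : {set {set V}}) :=
  [set H : {set {set V}} | [&& hamc H, F \subset H & H :\: F \subset gedges (sideR A k)]].

(** x a u v b y is a walk of five pairs of type [k], and an odd number of them has type [k] again.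
    So the third edge of a 3-opt move has the right type automatically. *)
Lemma side_transport (V : finType) (A : {set V}) k u v a b x y :
  sideR A k u v -> sideR A k u a -> sideR A k v b -> sideR A k a x -> sideR A k b y ->
  sideR A k x y.
Proof.
rewrite /sideR; case: (u \in A); case: (v \in A); case: (a \in A); case: (b \in A);
by case: (x \in A); case: (y \in A); case: k.
Qed.

Section SideMoves.
Variables (V : finType) (A : {set V}) (k : bool) (F ES : {set {set V}}) (dl N f g : nat).
Let n := #|V|.
Let R := sideR A k.
Hypothesis ESR : ES \subset gedges R.
Hypothesis ES1 : forall x, [set x; x] \notin ES.
Hypothesis ESdeg : forall v, dl <= #|[set y | [set v; y] \in ES]|.
Hypothesis ESN : \sum_x \sum_y (R x y && ([set x; y] \notin ES)) <= N.
Hypothesis Ff : #|F| <= f.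
Hypothesis dlbig : 2 * (g * n) + 2 * n + 6 * (f * n) + 2 * N <= dl * dl.

Let KK := side_cycles A k F.

Section At.
Variables (u v : V) (t : seq V).
Let s := u :: t.
Hypotheses (us : uniq s) (ss : size s = n) (lt : last u t = v).
Let p i := nth u s i.
Hypotheses (HK : cyc s \in KK) (uvF : [set u; v] \notin F) (uvH : [set u; v] \in cyc s).

Let p_inj i j : i < n -> j < n -> p i = p j -> i = j.
Proof. exact: (nth_pos_inj us ss). Qed.

Lemma in_side x y : [set x; y] \in cyc s -> [set x; y] \notin F -> R x y.
Proof.
move: HK; rewrite inE => /and3P[_ _ /subsetP h] xyH xyF.
have : [set x; y] \in gedges R by apply: h; rewrite inE xyF.
by rewrite gedgesE //; apply: sideR_sym.
Qed.

Lemma ES_side x y : [set x; y] \in ES -> R x y.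
Proof. by move/(subsetP ESR); rewrite gedgesE //; apply: sideR_sym. Qed.

Lemma new_cycle (E old new : {set {set V}}) : cyc s = E :|: old -> [disjoint old & F] ->
  hamc (E :|: new) -> new \subset ES -> E :|: new \in KK.
Proof.
move=> sE oF hE nE; move: HK; rewrite !inE => /and3P[_ FH /subsetP sR]; apply/and3P; split=> //.
  apply/subsetP=> e eF; have := subsetP FH _ eF; rewrite sE !inE.
  by case/orP=> [->//|eo]; move/disjoint_setI0/setP: oF => /(_ e); rewrite !inE eo eF.
apply/subsetP=> e; rewrite !inE => /andP[eF /orP[eE|eN]].
  by have := sR e; rewrite in_setD eF sE in_setU eE inE => /(_ isT).
by have := subsetP ESR _ (subsetP nE _ eN); rewrite !inE.
Qed.

Let I := [set i : 'I_n | [set u; p i] \in ES].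
Let J := [set j : 'I_n | [set v; p j] \in ES].

Lemma card_pos_nbrs x : #|[set i : 'I_n | [set x; p i] \in ES]| = #|[set y | [set x; y] \in ES]|.
Proof.
rewrite -(card_ord_sum n (fun i => [set x; p i] \in ES)) -card_sum.
exact: (sum_nth_uniq u (fun y => nat_of_bool ([set x; y] \in ES)) us ss).
Qed.

(** A neighbour p i of u and a neighbour p j of v determine the move: [three_opt1] with a = j - 1
    and b = i - 1 if j < i, [three_opt2] with a = i - 1 and b = j if i < j. *)
Let phi (w : 'I_n * 'I_n) : (V * V) * (V * V) :=
  ((p w.1, p w.2), (p w.1.-1, if w.2 < w.1 then p w.2.-1 else p w.2.+1)).
Let good (w : 'I_n * 'I_n) := phi w \in [set w | move3 KK ES (cyc s) u v w].

Lemma disjoint3 (a b c : {set V}) : a \notin F -> b \notin F -> c \notin F ->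
  [disjoint [set a; b; c] & F].
Proof.
move=> ha hb hc; rewrite disjoint_subset; apply/subsetP=> e.
by rewrite !inE => /orP[/orP[]|]/eqP->.
Qed.

(** Of the dl^2 choices (i, j) those with i = j ([B0]), with j = 0 ([B1]), with a deleted edge in
    [F] ([B2] to [B4]) or with a third pair of the right type outside [ES] ([B5], [B6]) are given
    up; [dlbig] leaves enough. *)
Lemma card_side_moves : 2 * (g * n) <= #|[set w | move3 KK ES (cyc s) u v w]|.
Proof.
have cI : dl <= #|I| by rewrite card_pos_nbrs.
have cJ : dl <= #|J| by rewrite card_pos_nbrs.
have nE : n = size s by [].
have Iu (i : 'I_n) : i \in I -> 0 < i.
  by rewrite inE; case: (nat_of_ord i) => //; rewrite /p /= (negPf (ES1 u)).
have Jv (j : 'I_n) : j \in J -> j.+1 < n.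
  rewrite inE => h; have := ltn_ord j; rewrite leq_eqVlt => /orP[/eqP jE|//].
  have jl : j = n.-1 :> nat by lia.
  have pl : p n.-1 = v := nth_pos_last ss lt.
  by move: h; rewrite jl pl (negPf (ES1 v)).
pose B0 := [set w : 'I_n * 'I_n | w.1 == w.2].
pose B1 := [set w : 'I_n * 'I_n | nat_of_ord w.2 == 0].
pose C1 := [set i : 'I_n | (0 < i) && ([set p i; p i.-1] \in F)].
pose C2 := [set i : 'I_n | [set p i; p i.+1] \in F].
have cC1 : #|C1| <= 2 * f.
  apply: leq_trans (_ : 2 * #|F| <= _); last by rewrite leq_mul2l Ff orbT.
  apply: leq_trans (card_arcs F).
  rewrite -(card_in_imset (f := fun i : 'I_n => (p i, p i.-1))); last first.
    by move=> i j _ _ [/p_inj h _]; apply/val_inj/h.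
  by apply/subset_leq_card/subsetP=> w /imsetP[i]; rewrite inE => /andP[_ h] ->; rewrite inE.
have cC2 : #|C2| <= 2 * f.
  apply: leq_trans (_ : 2 * #|F| <= _); last by rewrite leq_mul2l Ff orbT.
  apply: leq_trans (card_arcs F).
  rewrite -(card_in_imset (f := fun i : 'I_n => (p i, p i.+1))); last first.
    by move=> i j _ _ [/p_inj h _]; apply/val_inj/h.
  by apply/subset_leq_card/subsetP=> w /imsetP[i]; rewrite inE => h ->; rewrite inE.
pose B2 := [set w : 'I_n * 'I_n | w.1 \in C1].
pose B3 := [set w : 'I_n * 'I_n | w.2 \in C1].
pose B4 := [set w : 'I_n * 'I_n | w.2 \in C2].
pose NE := [set w : V * V | R w.1 w.2 && ([set w.1; w.2] \notin ES)].
have cNE : #|NE| <= N.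
  apply: leq_trans ESN; rewrite pair_bigA /= card_sum; apply: eq_leq.
  by apply: eq_card => w; rewrite !inE.
pose B5 := [set w : 'I_n * 'I_n | [&& 0 < w.1, 0 < w.2 & (p w.1.-1, p w.2.-1) \in NE]].
pose B6 := [set w : 'I_n * 'I_n | [&& 0 < w.1, w.2.+1 < n & (p w.1.-1, p w.2.+1) \in NE]].
have c5 : #|B5| <= N.
  apply: leq_trans cNE.
  rewrite -(card_in_imset (f := fun w : 'I_n * 'I_n => (p w.1.-1, p w.2.-1))).
    by apply/subset_leq_card/subsetP=> w /imsetP[i]; rewrite inE => /and3P[_ _ h] ->.
  move=> [i j] [i' j']; rewrite !in_set /= => /and3P[i0 j0 _] /and3P[i0' j0' _].
  have := ltn_ord i; have := ltn_ord j; have := ltn_ord i'; have := ltn_ord j'.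
  move=> ? ? ? ? [/p_inj h1 /p_inj h2].
  by congr pair; apply/val_inj => /=; lia.
have c6 : #|B6| <= N.
  apply: leq_trans cNE.
  rewrite -(card_in_imset (f := fun w : 'I_n * 'I_n => (p w.1.-1, p w.2.+1))).
    by apply/subset_leq_card/subsetP=> w /imsetP[i]; rewrite inE => /and3P[_ _ h] ->.
  move=> [i j] [i' j']; rewrite !in_set /= => /and3P[i0 j0 _] /and3P[i0' j0' _].
  have := ltn_ord i; have := ltn_ord j; have := ltn_ord i'; have := ltn_ord j'.
  move=> ? ? ? ? [/p_inj h1 /p_inj h2].
  by congr pair; apply/val_inj => /=; lia.
have c0 : #|B0| <= n.
  rewrite -[leqRHS]card_ord -cardsT -(card_in_imset (f := fst) (D := mem B0)); last first.
    by move=> [i j] [i' j']; rewrite !inE /= => /eqP -> /eqP -> ->.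
  by apply/subset_leq_card/subsetP=> i _; rewrite inE.
have c1 : #|B1| <= 1 * n.
  apply: (@card_pairs_snd _ _ (fun j : 'I_n => nat_of_ord j == 0)).
  by rewrite -(card_ord_sum n (fun j => j == 0)) sum_point leq_b1.
have c2 : #|B2| <= 2 * f * n by apply: (@card_pairs_fst _ _ (fun i => i \in C1)); rewrite set_in_id.
have c3 : #|B3| <= 2 * f * n by apply: (@card_pairs_snd _ _ (fun i => i \in C1)); rewrite set_in_id.
have c4 : #|B4| <= 2 * f * n by apply: (@card_pairs_snd _ _ (fun i => i \in C2)); rewrite set_in_id.
have cover : setX I J \subset [set w | good w] :|: (B0 :|: (B1 :|: (B2 :|: (B3 :|: (B4 :|: (B5 :|: B6)))))).
  apply/subsetP=> -[i j]; rewrite in_setX /= => /andP[iI jJ].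
  have i0 := Iu _ iI; have j1 := Jv _ jJ; rewrite !in_setU.
  have iu : [set u; p i] \in ES by rewrite inE in iI.
  have jv : [set v; p j] \in ES by rewrite inE in jJ.
  have Ruv := in_side uvH uvF.
  have [w0|w0] := boolP ((i, j) \in B0); first by rewrite ?orbT.
  have [w1|w1] := boolP ((i, j) \in B1); first by rewrite ?orbT.
  have [w2|w2] := boolP ((i, j) \in B2); first by rewrite ?orbT.
  have [w3|w3] := boolP ((i, j) \in B3); first by rewrite ?orbT.
  have [w4|w4] := boolP ((i, j) \in B4); first by rewrite ?orbT.
  have [w5|w5] := boolP ((i, j) \in B5); first by rewrite ?orbT.
  have [w6|w6] := boolP ((i, j) \in B6); first by rewrite ?orbT.
  rewrite !orbF in_set /good /phi /=.
  have j0 : 0 < j by move: w1; rewrite inE /= lt0n.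
  have iF : [set p i; p i.-1] \notin F by move: w2; rewrite !inE /= i0.
  have jF : [set p j; p j.-1] \notin F by move: w3; rewrite !inE /= j0.
  have jF' : [set p j; p j.+1] \notin F by move: w4; rewrite !inE.
  case: (ltngtP j i) => [ji|ij|/val_inj ij].
  - have ab : j.-1 < i.-1 by rewrite ltn_predRL prednK.
    have b1 : i.-1.+1 < size s by rewrite prednK // ss ltn_ord.
    have [E [a1 a2 a3]] := three_opt1 us ss lt ab b1.
    rewrite !prednK // in a2 a3.
    have Ri : R (p i) (p i.-1) by apply: in_side => //; rewrite a2 !inE eqxx ?orbT.
    have Rj : R (p j) (p j.-1) by apply: in_side => //; rewrite a2 !inE eqxx ?orbT.
    have Rxy : R (p i.-1) (p j.-1) := side_transport Ruv (ES_side iu) (ES_side jv) Ri Rj.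
    have xyE : [set p i.-1; p j.-1] \in ES.
      by move: w5; rewrite !inE /= i0 j0 Rxy /= negbK.
    rewrite inE; apply/existsP; exists E; rewrite a1 a2 eqxx iu jv xyE !andbT /=.
    apply: (new_cycle a2) => //; first exact: disjoint3.
    by apply/subsetP=> e; rewrite !inE => /orP[/orP[]|]/eqP->.
  - have ab : i.-1 < j by rewrite prednK // ltnW.
    have b1 : j.+1 < size s by rewrite ss.
    have [E [a1 a2 a3]] := three_opt2 us ss lt ab b1.
    rewrite !prednK // in a2 a3.
    have Ri : R (p i) (p i.-1) by apply: in_side => //; rewrite a2 !inE eqxx ?orbT.
    have Rj : R (p j) (p j.+1) by apply: in_side => //; rewrite a2 !inE eqxx ?orbT.
    have Rxy : R (p i.-1) (p j.+1) := side_transport Ruv (ES_side iu) (ES_side jv) Ri Rj.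
    have xyE : [set p i.-1; p j.+1] \in ES.
      by move: w6; rewrite !inE /= i0 j1 Rxy /= negbK.
    rewrite inE; apply/existsP; exists E; rewrite a1 a2 eqxx iu jv xyE !andbT /=.
    apply: (new_cycle a2) => //; first exact: disjoint3.
    by apply/subsetP=> e; rewrite !inE => /orP[/orP[]|]/eqP->.
  by move: w0; rewrite inE /= ij eqxx.
have cgood : #|[set w | good w]| <= #|[set w | move3 KK ES (cyc s) u v w]|.
  rewrite -(card_in_imset (f := phi)); last first.
    move=> [i j] [i' j'] _ _ [/p_inj h1 /p_inj h2 _ _].
    by congr pair; apply/val_inj => /=; [apply: h1|apply: h2].
  by apply/subset_leq_card/subsetP=> w /imsetP[x]; rewrite inE => h ->.
apply: leq_trans cgood.
have := subset_leq_card cover; rewrite cardsX.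
move=> /leq_trans/(_ (leq_card_setU _ _)) h.
have h0 := leq_card_setU B0 (B1 :|: (B2 :|: (B3 :|: (B4 :|: (B5 :|: B6))))).
have h1 := leq_card_setU B1 (B2 :|: (B3 :|: (B4 :|: (B5 :|: B6)))).
have h2 := leq_card_setU B2 (B3 :|: (B4 :|: (B5 :|: B6))).
have h3 := leq_card_setU B3 (B4 :|: (B5 :|: B6)).
have h4 := leq_card_setU B4 (B5 :|: B6).
have h5 := leq_card_setU B5 B6.
exact: (cover_count dlbig (leq_mul cI cJ) h h0 h1 h2 h3 h4 h5 c0 c1 c2 c3 c4 c5 c6).
Qed.

End At.
End SideMoves.

(** * Completing a fixed rainbow set [F] to a rainbow Hamilton cycle *)

Section Rainbow.
Variables (V : finType) (G : rel V) (C : eqType) (col : {set V} -> C).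
Let n := #|V|.
Hypotheses (Gs : symmetric G) (Gi : irreflexive G).

Definition has_rainbow_cycle := exists s : seq V,
  [/\ uniq s, size s = n, cycle G s & uniq [seq col [set p.1; p.2] | p <- zip s (rot 1 s)]].

Lemma zip_pedges x y (t : seq V) :
  [seq [set p.1; p.2] | p <- zip (y :: t) (rcons t x)] =
  rcons (pedges (y :: t)) [set last y t; x].
Proof. by elim: t y => [|z t IH] y //=; congr cons; apply: IH. Qed.

Lemma path_edges x (t : seq V) : {subset pedges (x :: t) <= gedges G} -> path G x t.
Proof.
elim: t x => //= y t IH x h; rewrite IH ?andbT.
  by rewrite -gedgesE // h // inE eqxx.
by move=> e eP; apply: h; rewrite inE eP orbT.
Qed.

Lemma rainbow_of_edges H : 2 < n -> hamc H -> H \subset gedges G -> {in H &, injective col} ->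
  has_rainbow_cycle.
Proof.
move=> n3 /hamcP[s [us ss ->]] /subsetP HG cinj.
case: s us ss HG cinj => [|x t] us ss HG cinj; first by move: n3; rewrite /n -ss.
have pE : perm_eq (cedges (x :: t)) [seq [set p.1; p.2] | p <- zip (x :: t) (rot 1 (x :: t))].
  by rewrite rot1_cons zip_pedges perm_sym perm_rcons.
exists (x :: t); split=> //.
  rewrite /= rcons_path path_edges /=; last first.
    by move=> e eP; apply: HG; rewrite in_cyc (cedgesE x) // inE eP orbT.
  rewrite -gedgesE // HG // in_cyc (cedgesE x) // inE eqxx //.
rewrite map_comp -(perm_uniq (perm_map col pE)) map_inj_in_uniq.
  by apply: cedges_uniq; rewrite // ss.
by move=> e f eH fH; apply: cinj; rewrite in_cyc.
Qed.

Variables (A : {set V}) (k : bool) (F : {set {set V}}) (m g f dl L N : nat).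
Let R := sideR A k.
Hypothesis colm : forall c, #|[set e in gedges G | col e == c]| <= m.
Hypothesis FG : F \subset gedges G.
Hypothesis FR : forall e, e \in F -> e \notin gedges R.
Hypothesis Fcol : {in F &, injective col}.
Let hit e := [exists e' in F, col e' == col e].
Hypothesis Fload : forall v, #|[set y | G v y && hit [set v; y]]| <= L.
Hypothesis degR : forall v, dl + L <= \sum_y (R v y && G v y).
Hypothesis nonR : \sum_x \sum_y (R x y && ~~ G x y) <= N.
Hypothesis Ff : #|F| <= f.
Hypothesis KK0 : side_cycles A k F != set0.
Hypothesis n3 : 2 < n.
Hypothesis dlbig : 2 * (g * n) + 2 * n + 6 * (f * n) + 2 * (N + 2 * (m * f)) <= dl * dl.
Hypothesis gm : 8 * (m + 1) <= g.
Hypothesis gbig : 2048 * 100 * (n * m) <= g ^ 2.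
Hypothesis g120 : 120 <= g.

(** The allowed edges avoid the colours of [F]; this costs L in the degrees and at most m f edges,
    that is 2 m f ordered pairs, in total. [F] and the remaining edges are then rainbow with
    disjoint sets of colours. *)
Theorem side_rainbow : has_rainbow_cycle.
Proof.
pose ES := [set e in gedges G | (e \in gedges R) && ~~ hit e].
have Rs : symmetric R by apply: sideR_sym.
have ESE x y : ([set x; y] \in ES) = [&& G x y, R x y & ~~ hit [set x; y]].
  by rewrite in_set !gedgesE.
have ESR : ES \subset gedges R by apply/subsetP=> e; rewrite inE => /and3P[].
have ESF e : e \in ES -> e \notin F.
  by rewrite inE => /and3P[_ eR _]; apply: contraL eR; apply: FR.
have ES1 x : [set x; x] \notin ES by rewrite ESE Gi.
have ESdeg v : dl <= #|[set y | [set v; y] \in ES]|.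
  rewrite -(leq_add2r L); apply: leq_trans (degR v) _.
  apply: leq_trans (_ : #|[set y | [set v; y] \in ES]| + #|[set y | G v y && hit [set v; y]]| <= _);
    last by rewrite leq_add2l.
  rewrite -!card_sum -big_split /=; apply: leq_sum => y _.
  by rewrite ESE; case: (R v y); case: (G v y); case: (hit _).
have ESN : \sum_x \sum_y (R x y && ([set x; y] \notin ES)) <= N + 2 * (m * f).
  pose B := [set e in gedges G | hit e].
  have cB : #|B| <= m * f.
    apply: leq_trans (_ : m * #|F| <= _); last by rewrite leq_mul2l Ff orbT.
    pose pk (e : {set V}) := odflt set0 [pick e' in F | col e' == col e].
    have pkP e : e \in B -> pk e \in F /\ col (pk e) == col e.
      rewrite inE => /andP[_ /exists_inP[e' e'F ce]]; rewrite /pk; case: pickP => [z /andP[]//|no].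
      by move: (no e'); rewrite /= e'F ce.
    apply: (@card_le_fiber _ _ pk) => [e /pkP[]//|e' e'F].
    apply: leq_trans (colm (col e')); apply/subset_leq_card/subsetP=> e.
    rewrite in_set => /andP[eB /eqP pe]; have [_ ce] := pkP _ eB.
    by move: eB; rewrite !inE => /andP[-> _] /=; rewrite -pe eq_sym.
  apply: leq_trans (_ : \sum_x \sum_y ((R x y && ~~ G x y) + ([set x; y] \in B)) <= _).
    apply: leq_sum => x _; apply: leq_sum => y _; rewrite ESE in_set gedgesE //.
    by case: (G x y); case: (R x y); case: (hit _).
  under eq_bigr => x _ do rewrite big_split /=.
  rewrite big_split /=; apply: leq_add => //.
  rewrite pair_bigA /= card_sum; apply: leq_trans (_ : #|arcs B| <= _).
    by apply: eq_leq; apply: eq_card => w; rewrite !inE.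
  by apply: leq_trans (card_arcs _) _; rewrite leq_mul2l cB orbT.
have KKham H : H \in side_cycles A k F -> hamc H by rewrite inE => /and3P[].
have ESP e : e \in ES -> exists x y, e = [set x; y].
  by rewrite inE => /and3P[/gedgesP[x [y [_ ->]]] _ _]; exists x, y.
have EScol e : e \in ES -> #|[set f in ES | col f == col e]| <= m.
  move=> _; apply: leq_trans (colm (col e)); apply/subset_leq_card/subsetP=> e'.
  by rewrite !in_set => /andP[/andP[-> _] ->].
have moves H u v : H \in side_cycles A k F -> [set u; v] \in H -> [set u; v] \notin F ->
  2 * g <= #|[set w | move2 (side_cycles A k F) ES H u v w]| \/
  2 * (g * n) <= #|[set w | move3 (side_cycles A k F) ES H u v w]|.
  move=> HK uvH uvF; right; have [t [us ss HE lt]] := hamc_edge (KKham _ HK) uvH.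
  rewrite HE in HK uvH *.
  exact: (card_side_moves ESR ES1 ESdeg ESN Ff dlbig us ss lt HK uvF uvH).
have [H HK [Hs Hc]] := switching_rainbow KKham ESF ESP EScol moves n3 gm gbig g120 KK0.
apply: (rainbow_of_edges n3 (KKham _ HK)).
  apply: subset_trans Hs _; rewrite subUset FG andbT.
  by apply/subsetP=> e; rewrite inE => /andP[].
have cross e e' : e \in H -> e \notin F -> e' \in F -> col e = col e' -> False.
  move=> eH eF e'F ce; have := subsetP Hs _ eH; rewrite in_setU (negPf eF) orbF in_set.
  by case/and3P=> _ _ /exists_inP[]; exists e' => //; rewrite ce.
move=> e e' eH e'H ce.
have [eF|eF] := boolP (e \in F); have [e'F|e'F] := boolP (e' \in F).
- exact: Fcol.
- by case: (cross e' e).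
- by case: (cross e e').
by apply: Hc; rewrite // inE ?eF ?e'F.
Qed.

End Rainbow.

(** * Two near-cliques *)

Lemma set2_injr (V : finType) (v x y : V) : [set v; x] = [set v; y] -> x = y.
Proof. by case/set2_inj=> -[] => [_|<-]. Qed.

Section TwoCliques.
Variables (V : finType) (G : rel V) (C : eqType) (col : {set V} -> C) (m : nat).
Let n := #|V|.
Hypotheses (Gs : symmetric G) (Gi : irreflexive G).
Hypothesis colm : forall c, #|[set e in gedges G | col e == c]| <= m.

(** The crude bound on the load, good enough for an [F] of bounded size. *)
Lemma hit_load (F : {set {set V}}) v :
  #|[set y | G v y && [exists e in F, col e == col [set v; y]]]| <= m * #|F|.
Proof.
set Y := [set y | _].
have pkP y : y \in Y -> exists2 e, e \in F & col e == col [set v; y].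
  by rewrite inE => /andP[_ /exists_inP].
pose pk y := odflt set0 [pick e' in F | col e' == col [set v; y]].
have {}pkP y : y \in Y -> pk y \in F /\ col (pk y) == col [set v; y].
  move/pkP=> [e eF ce]; rewrite /pk; case: pickP => [z /andP[]//|no].
  by move: (no e); rewrite /= eF ce.
apply: (@card_le_fiber _ _ pk) => [y /pkP[]//|e eF].
apply: leq_trans (colm (col e)); rewrite -(card_in_imset (f := fun y => [set v; y])).
  apply/subset_leq_card/subsetP=> z /imsetP[y]; rewrite inE => /andP[yY /eqP pe] ->.
  have [_ ce] := pkP _ yY; rewrite in_set -pe eq_sym ce andbT gedgesE //.
  by move: yY; rewrite inE => /andP[].
by move=> x y _ _; apply: set2_injr.
Qed.

Variable A : {set V}.
Hypothesis dG : forall x, n <= 2 * \sum_y G x y.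

Lemma cross_nbrs (B : {set V}) x : x \in B -> n + 2 <= 2 * #|B| + 2 * #|[set y | G x y && (y \notin B)]|.
Proof.
move=> xB; have := dG x; have : \sum_y G x y + 1 <= #|B| + #|[set y | G x y && (y \notin B)]|.
  have <- : \sum_y (y == x) = 1.
    by rewrite card_sum (_ : [set y | _] = [set x]) ?cards1 //; apply/setP=> y; rewrite !inE.
  rewrite -card_sum -sum_card_in.
  rewrite -!big_split /=; apply: leq_sum => y _.
  by case: (y =P x) => [->|_]; rewrite ?Gi ?xB //; case: (G x y); case: (y \in B).
lia.
Qed.

(** Every vertex of the smaller side [A] has a crossing edge. Take crossing edges a0 b0 and ab with
    b0 and b distinct, and a vertex a' of [A] other than a and a0 whose crossing edge has neither of
    their colours; at most 2 m + 2 vertices are excluded. That edge misses b or b0, and is disjoint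
    from ab or from a0 b0 accordingly. *)
Lemma crossing_edges : 2 * #|A| <= n -> 2 * m + 3 <= #|A| ->
  exists a1 b1 a2 b2, [/\ [/\ a1 \in A, a2 \in A, b1 \notin A & b2 \notin A],
    a1 != a2, b1 != b2, G a1 b1 /\ G a2 b2 & col [set a1; b1] != col [set a2; b2]].
Proof.
move=> An mA.
pose gg a := odflt a [pick b | G a b && (b \notin A)].
have ggP a : a \in A -> G a (gg a) /\ gg a \notin A.
  move=> aA; rewrite /gg; case: pickP => [b /andP[]//|no].
  have := cross_nbrs aA; have -> : #|[set y | G a y && (y \notin A)]| = 0; last by lia.
  by apply: eq_card0 => y; rewrite inE no.
have /card_gt0P[a0 a0A] : 0 < #|A| by lia.
have [gab0 b0A] := ggP _ a0A; set b0 := gg a0 in gab0 b0A.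
have [a [b [aA bA gab bb0]]] : exists a b, [/\ a \in A, b \notin A, G a b & b != b0].
  (* If [A] is strictly smaller, a0 itself has two crossing neighbours. If the sides are equal,
     every vertex outside [A] has a crossing edge too. *)
  case: (ltnP (2 * #|A|) n) => An'.
    have : 1 < #|[set y | G a0 y && (y \notin A)]| by have := cross_nbrs a0A; lia.
    rewrite (cardsD1 b0) inE gab0 b0A add1n ltnS => /card_gt0P[b].
    by rewrite !inE => /and3P[bb gb bA]; exists a0, b.
  have cA := cardsC A; rewrite -/n in cA.
  have : 1 < #|~: A| by lia.
  rewrite (cardsD1 b0) inE b0A add1n ltnS => /card_gt0P[b]; rewrite !inE => /andP[bb bA].
  have bB : b \in ~: A by rewrite inE.
  have : 0 < #|[set y | G b y && (y \notin ~: A)]| by have := cross_nbrs bB; lia.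
  move=> /card_gt0P[a]; rewrite !inE negbK => /andP[gba aA].
  by exists a, b; split=> //; rewrite Gs.
have few c : #|[set a' in A | col [set a'; gg a'] == c]| <= m.
  apply: leq_trans (colm c); rewrite -(card_in_imset (f := fun a' => [set a'; gg a'])).
    apply/subset_leq_card/subsetP=> e /imsetP[a']; rewrite inE => /andP[a'A ca] ->.
    by rewrite in_set ca andbT gedgesE // (proj1 (ggP _ a'A)).
  move=> x y; rewrite !in_set => /andP[xA _] /andP[yA _] /set2_inj[[]//|[xy _]].
  by have [_] := ggP _ yA; rewrite -xy xA.
pose bad := [set a' in A | col [set a'; gg a'] == col [set a; b]] :|:
            [set a' in A | col [set a'; gg a'] == col [set a0; b0]] :|: [set a; a0].
have cbad : #|bad| < #|A|.
  have h5 : #|[set a; a0]| <= 2 by rewrite cards2; case: eqP.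
  apply: leq_ltn_trans (leq_card_setU _ _) _.
  apply: leq_ltn_trans (leq_add (leq_trans (leq_card_setU _ _) (leq_add (few _) (few _))) h5) _.
  by lia.
have /subsetPn[a' a'A a'N] : ~~ (A \subset bad).
  by apply/negP=> /subset_leq_card; rewrite leqNgt cbad.
move: a'N; rewrite !inE a'A /= !negb_or => /andP[/andP[c1 c2] /andP[na na0]].
have [ga' ba'] := ggP _ a'A.
have [E|ne] := eqVneq (gg a') b.
  exists a', b, a0, b0; split=> //; rewrite -E //.
by exists a', (gg a'), a, b; split.
Qed.

Lemma pedges_side (s : seq V) k (B : {set V}) e : (forall x y, x \in B -> y \in B -> sideR A k x y) ->
  {subset s <= B} -> e \in pedges s -> e \in gedges (sideR A k).
Proof.
move=> BR sB eP; have [s1 [s2 [x [y [sE eE]]]]] := pedges_split eP.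
rewrite eE gedgesE; last exact: sideR_sym.
apply: BR; apply: sB; rewrite sE mem_cat.
  by rewrite mem_rcons mem_head.
by rewrite mem_head orbT.
Qed.

Lemma hamc_all (s : seq V) : uniq s -> (forall x, x \in s) -> hamc (cyc s).
Proof.
move=> us sV; apply/hamcP; exists s; split=> //.
by rewrite -(card_uniqP us); apply: eq_card => x; rewrite sV.
Qed.

Lemma clique_cycles a1 b1 a2 b2 : a1 \in A -> a2 \in A -> b1 \notin A -> b2 \notin A ->
  a1 != a2 -> b1 != b2 ->
  side_cycles A false [set [set a1; b1]; [set a2; b2]] != set0.
Proof.
move=> a1A a2A b1A b2A a12 b12.
pose s1 := a1 :: rcons (enum (A :\ a1 :\ a2)) a2.
pose s2 := b2 :: rcons (enum (~: A :\ b1 :\ b2)) b1.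
have s1A x : (x \in s1) = (x \in A).
  rewrite !inE mem_rcons inE mem_enum !inE.
  by case: (x =P a1) => [->|_] //=; case: (x =P a2) => [->|_].
have s2A x : (x \in s2) = (x \notin A).
  rewrite !inE mem_rcons inE mem_enum !inE.
  by case: (x =P b2) => [->|_] //=; case: (x =P b1) => [->|_].
have u1 : uniq s1.
  by rewrite /= rcons_uniq mem_rcons inE negb_or a12 !mem_enum !inE !eqxx enum_uniq !andbF.
have u2 : uniq s2.
  by rewrite /= rcons_uniq mem_rcons inE negb_or eq_sym b12 !mem_enum !inE !eqxx enum_uniq !andbF.
apply/set0Pn; exists (cyc (s1 ++ s2)); rewrite inE; apply/and3P; split.
- apply: hamc_all => [|x]; last by rewrite mem_cat s1A s2A orbN.
  rewrite cat_uniq u1 u2 andbT andTb; apply/hasPn => x; rewrite s2A.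
  by apply: contra => xs; rewrite -s1A.
- rewrite (cyc2 a1) // !last_cons !last_rcons /= (setUC [set b1]).
  exact: subsetUr.
rewrite (cyc2 a1) // [head _ s1]/= [head _ s2]/= !last_cons !last_rcons (setUC [set b1]).
apply/subsetP=> e /setDP[/setUP[eP|eF] eN]; last by rewrite eF in eN.
move: eP; rewrite in_set mem_cat; case/orP; first apply: (@pedges_side s1 false A).
- by move=> x y xA yA; rewrite /sideR xA yA.
- by move=> x; rewrite s1A.
apply: (@pedges_side s2 false (~: A)).
- by move=> x y; rewrite !inE /sideR => /negPf-> /negPf->.
by move=> x; rewrite s2A inE.
Qed.

Lemma two_cliques_rainbow (g dl N : nat) :
  2 * #|A| <= n -> 2 * m + 3 <= #|A| -> 
  (forall v, dl + 2 * m <= \sum_y (sideR A false v y && G v y)) ->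
  \sum_x \sum_y (sideR A false x y && ~~ G x y) <= N ->
  2 < n ->
  2 * (g * n) + 2 * n + 6 * (2 * n) + 2 * (N + 2 * (m * 2)) <= dl * dl ->
  8 * (m + 1) <= g -> 2048 * 100 * (n * m) <= g ^ 2 -> 120 <= g ->
  has_rainbow_cycle G col.
Proof.
move=> An mA degR nonR n3 dlbig gm gbig g120.
have [a1 [b1 [a2 [b2 [[a1A a2A b1A b2A] a12 b12 [g1 g2] c12]]]]] := crossing_edges An mA.
have Rs := sideR_sym A false.
have cF : #|[set [set a1; b1]; [set a2; b2]]| <= 2 by rewrite cards2; case: eqP.
apply: (@side_rainbow V G C col Gs Gi A false [set [set a1; b1]; [set a2; b2]] m g 2 dl (2 * m) N) => //.
- by apply/subsetP=> e; rewrite !in_set2 => /orP[]/eqP->; rewrite gedgesE.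
- by move=> e; rewrite in_set2 => /orP[]/eqP->; rewrite gedgesE // /sideR ?a1A ?a2A ?(negPf b1A) ?(negPf b2A).
- move=> e e'; rewrite !in_set2 => /orP[]/eqP-> /orP[]/eqP-> // /eqP; first by rewrite (negPf c12).
  by rewrite eq_sym (negPf c12).
- move=> v; apply: leq_trans (hit_load _ _) _; rewrite mulnC leq_mul2r cF orbT //.
by apply: clique_cycles.
Qed.

End TwoCliques.

(** * Beck-Fiala rounding *)

Section BeckFiala.
Import Order.TTheory GRing.Theory Num.Theory.
Local Open Scope ring_scope.

Lemma kernel_vector (K : fieldType) (I R : finType) (Fl : {set I}) (Ac : {set R}) (c : R -> I -> K) :
  (#|Ac| < #|Fl|)%N -> exists y : I -> K,
  [/\ forall i, i \notin Fl -> y i = 0, exists2 i, i \in Fl & y i != 0 &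
      forall r, r \in Ac -> \sum_i c r i * y i = 0].
Proof.
move=> lt; have /card_gt0P[i0 i0F] : (0 < #|Fl|)%N by apply: leq_trans lt.
pose M : 'M[K]_(#|Fl|, #|Ac|) := \matrix_(i, j) c (enum_val j) (enum_val i).
have [Kx KxM] : exists2 Kx : 'M[K]_#|Fl|, Kx *m M = 0 & Kx != 0.
  exists (kermx M); first exact: mulmx_ker.
  by rewrite kermx_eq0 /row_free neq_ltn (leq_ltn_trans (rank_leq_col M) lt).
move=> /matrix0Pn[a [b kab]].
pose y i := if i \in Fl then Kx a (enum_rank_in i0F i) else 0.
exists y; split.
- by move=> i /negPf iF; rewrite /y iF.
- by exists (enum_val b); rewrite ?enum_valP // /y enum_valP enum_valK_in.
move=> r rA; have := congr1 (fun B : 'M_(_, _) => B a (enum_rank_in rA r)) KxM.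
rewrite !mxE => E; rewrite -[RHS]E (bigID (mem Fl)) /= [X in _ + X]big1 ?addr0; last first.
  by move=> i iF; rewrite /y (negPf iF) mulr0.
rewrite (reindex (enum_val : 'I_#|Fl| -> I)) /=; last first.
  exists (enum_rank_in i0F) => [i _|i iF]; first by rewrite enum_valK_in.
  by rewrite enum_rankK_in.
rewrite (eq_bigl xpredT); last by move=> i; rewrite enum_valP.
by apply: eq_bigr => i _; rewrite mxE enum_rankK_in // /y enum_valP enum_valK_in mulrC.
Qed.

Variables (I R : finType) (c : R -> I -> rat) (t : rat).
Hypothesis c0 : forall r i, 0 <= c r i.
Hypothesis ct : forall i, \sum_r c r i <= t.
Hypothesis t0 : 0 < t.

Let float (z : I -> rat) := [set i | 0 < z i < 1].

Lemma boundary_step (z y : I -> rat) : (forall i, 0 <= z i <= 1) ->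
  (forall i, i \notin float z -> y i = 0) -> (exists2 i, i \in float z & y i != 0) ->
  exists l, [/\ 0 <= l, forall i, 0 <= z i + l * y i <= 1 &
    (#|float (fun i => z i + l * y i)%R| < #|float z|)%N].
Proof.
move=> z01 yF [i0 i0F yi0].
(* The largest multiple of y that keeps coordinate i in [0, 1]; the smallest of these makes one
   coordinate integral. *)
pose b i := if 0 < y i then (1 - z i) / y i else - z i / y i.
have [i1 yi1 bmin] := Order.TotalTheory.arg_minP (P := [pred i | y i != 0]) b yi0.
have F1 i : y i != 0 -> 0 < z i < 1.
  move=> yi; have : i \in float z by apply: contraNT yi => /yF ->.
  by rewrite inE.
have bE i : y i != 0 -> 0 < b i.
  move=> yi; have /andP[z0 z1] := F1 _ yi; rewrite /b; have [yi'|yi'] := ltP 0 (y i).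
    by rewrite divr_gt0 // subr_gt0.
  by rewrite -mulrNN -invrN divr_gt0 // ?opprK // oppr_gt0 lt_neqAle yi.
have key i : 0 <= z i + b i1 * y i <= 1.
  have [->|yi] := eqVneq (y i) 0; first by rewrite mulr0 addr0.
  have /andP[z0 z1] := F1 _ yi; have bi := bmin _ yi; have b1 := bE _ yi1.
  move: bi; rewrite {2}/b; have [yi'|yi'] := ltP 0 (y i) => bi.
    have : b i1 * y i <= 1 - z i by rewrite -ler_pdivlMr.
    have : 0 <= b i1 * y i by rewrite mulr_ge0 // ltW.
    by move=> *; apply/andP; split; lra.
  have yi0' : y i < 0 by rewrite lt_neqAle yi.
  have : - z i <= b i1 * y i by rewrite -ler_ndivlMr.
  have : b i1 * y i <= 0 by rewrite mulr_ge0_le0 // ltW.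
  by move=> *; apply/andP; split; lra.
exists (b i1); split=> //; first exact: ltW (bE _ yi1).
apply: proper_card; apply/properP; split.
  apply/subsetP=> i; rewrite !inE; have [->|yi _] := eqVneq (y i) 0; first by rewrite mulr0 addr0.
  exact: F1.
exists i1; first by rewrite inE F1.
rewrite inE negb_and -!leNgt /b; have [yi'|yi'] := ltP 0 (y i1); rewrite divfK //.
  by apply/orP; right; rewrite addrC subrK.
by apply/orP; left; rewrite subrr.
Qed.

(** Double counting: each active row weighs more than t on the floating columns, each column at most
    t in all. *)
Lemma active_few z : float z != set0 ->
  (#|[set r | (t < \sum_(i in float z) c r i)%R]| < #|float z|)%N.
Proof.
move=> /set0Pn[i0 i0F]; set Ac := [set r | _].
have [->|[r0 r0A]] := set_0Vmem Ac; first by rewrite cards0; apply/card_gt0P; exists i0.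
have h1 : \sum_(r in Ac) t < \sum_(r in Ac) \sum_(i in float z) c r i.
  apply: ltr_sum => [|r]; last by rewrite inE.
  by apply/hasP; exists r0; rewrite ?mem_index_enum.
have h2 : \sum_(r in Ac) \sum_(i in float z) c r i <= \sum_(i in float z) t.
  rewrite exchange_big /=; apply: ler_sum => i _; apply: le_trans (ct i).
  rewrite [leRHS](bigID (mem Ac)) /= lerDl; exact: sumr_ge0.
have := lt_le_trans h1 h2; rewrite !sumr_const -!(mulr_natr t) ltr_pM2l //.
by rewrite ltr_nat.
Qed.

(* Rows whose fractional part weighs at most t can no longer go wrong by more than t; the
   other rows are fewer than the fractional variables, so z can be moved along a vector
   orthogonal to them until one more variable becomes integral. *)
Lemma beck_fiala (z : I -> rat) : (forall i, 0 <= z i <= 1) ->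
  exists S : {set I}, [/\ \sum_i z i <= #|S|%:R,
    forall i, z i = 0 -> i \notin S &
    forall r, \sum_(i in S) c r i <= \sum_i c r i * z i + t].
Proof.
move=> z01.
(* The induction must remember that coordinates already integral are never changed. *)
suff [S [h1 h2 h]] : exists S : {set I}, [/\ \sum_i z i <= #|S|%:R,
    forall r, \sum_(i in S) c r i <= \sum_i c r i * z i + t &
    forall i, i \notin float z -> z i = (i \in S)%:R].
  exists S; split=> // i zi; have := h i; rewrite inE zi ltxx => /(_ isT)/esym/eqP.
  by rewrite pnatr_eq0 eqb0.
have [k] := ubnP #|float z|; elim: k z z01 => // k IH z z01 zk.
have [F0|F0] := eqVneq (float z) set0.
  pose S := [set i | z i == 1].
  have zS i : z i = (i \in S)%:R.
    have : i \notin float z by rewrite F0 inE.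
    rewrite !inE negb_and -!leNgt; have /andP[z0 z1] := z01 i.
    by case: eqP => //= zi /orP[] h; apply/eqP; rewrite eq_le ?h ?z0 //; case: zi; apply/eqP; rewrite eq_le z1.
  exists S; split=> // [|r].
    rewrite -sum1_card natr_sum [leRHS]big_mkcond /=; apply: ler_sum => i _.
    by rewrite {1}zS; case: (i \in S).
  rewrite [leLHS]big_mkcond /= -[leLHS]addr0; apply: lerD (ltW t0).
  by apply: ler_sum => i _; rewrite zS; case: (i \in S); rewrite ?mulr1 ?mulr0.
have [y [yF yn yA]] := kernel_vector c (active_few F0).
(* The sign of y is chosen so that the total weight does not drop; this yields the lower bound on
   the size of [S]. *)
have [{}y [{}yF {}yn {}yA ys]] : exists y : I -> rat,
  [/\ forall i, i \notin float z -> y i = 0, exists2 i, i \in float z & y i != 0,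
   forall r, r \in [set r | t < \sum_(i in float z) c r i] -> \sum_i c r i * y i = 0
   & 0 <= \sum_i y i].
  have [s0|s0] := lerP 0 (\sum_i y i); first by exists y.
  exists (fun i => - y i); split.
  - by move=> i /yF ->; rewrite oppr0.
  - by case: yn => i iF yi; exists i; rewrite ?oppr_eq0.
  - by move=> r /yA h; under eq_bigr => i _ do rewrite mulrN; rewrite sumrN h oppr0.
  by rewrite sumrN oppr_ge0 ltW.
have [l [l0 z1 zl]] := boundary_step z01 yF yn.
have [S [h1 h2 h3]] := IH _ z1 (leq_trans zl zk).
have zS i : i \notin float z -> z i = (i \in S)%:R.
  move=> iF; rewrite -h3; first by rewrite yF // mulr0 addr0.
  by rewrite inE yF // mulr0 addr0; move: iF; rewrite inE.
exists S; split=> //.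
  apply: le_trans h1; rewrite big_split /= lerDl -mulr_sumr; exact: mulr_ge0.
move=> r; have [rA|rA] := boolP (r \in [set r | t < \sum_(i in float z) c r i]).
  apply: le_trans (h2 r) _; rewrite lerD2r.
  under eq_bigr => i _ do rewrite mulrDr mulrCA.
  by rewrite big_split /= -mulr_sumr yA // mulr0 addr0.
move: rA; rewrite inE -leNgt => rA; apply: le_trans (lerD (lexx _) rA).
rewrite [leLHS]big_mkcond [X in _ + X]big_mkcond -big_split /=; apply: ler_sum => i _.
have [iF|iF] := boolP (i \in float z); last first.
  by rewrite zS //; case: (i \in S); rewrite ?mulr1 ?mulr0 addr0.
have cz : 0 <= c r i * z i by rewrite mulr_ge0 //; case/andP: (z01 i).
by case: (i \in S); rewrite ?lerDr // addr_ge0.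
Qed.

End BeckFiala.

Lemma exists_subset_card (T : finType) (M : {set T}) d : d <= #|M| ->
  exists2 M' : {set T}, M' \subset M & #|M'| = d.
Proof.
move=> dM; exists [set x in take d (enum M)].
  by apply/subsetP=> x; rewrite inE => /mem_take; rewrite mem_enum.
rewrite cardsE; have /card_uniqP -> : uniq (take d (enum M)) by rewrite take_uniq ?enum_uniq.
by rewrite size_takel // -cardE.
Qed.

(** A maximal independent set dominates [S], and each of its elements dominates at most k, itself
    included. *)
Lemma independent_subset (T : finType) (e : rel T) (S : {set T}) k :
  symmetric e -> (forall x, x \in S -> #|[set y in S | e x y]| <= k) -> (forall x, e x x) ->
  exists M : {set T}, [/\ M \subset S, #|S| <= k * #|M| &
    forall x y, x \in M -> y \in M -> e x y -> x = y].
Proof.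
move=> es ek er; pose P (M : {set T}) := (M \subset S) &&
  [forall x in M, forall y in M, e x y ==> (x == y)].
have P0 : P set0 by rewrite /P sub0set; apply/forall_inP=> x; rewrite inE.
have [M /maxsetP[/andP[MS /forall_inP Mi] Mmax] _] := maxset_exists P0.
have {}Mi x y : x \in M -> y \in M -> e x y -> x = y.
  by move=> xM yM exy; have /forall_inP/(_ _ yM)/implyP/(_ exy)/eqP := Mi _ xM.
exists M; split=> //.
have near x : x \in S -> exists2 y, y \in M & e y x.
  move=> xS; apply/exists_inP; apply: contraT; rewrite negb_exists_in => /forall_inP no.
  have xM : x \notin M by apply: contraT; rewrite negbK => /no; rewrite er.
  have : P (x |: M).
    rewrite /P subUset sub1set xS MS /=; apply/forall_inP=> a aM; apply/forall_inP=> b bM.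
    apply/implyP=> eab; move: aM bM; rewrite !inE => /orP[/eqP ax|aM] /orP[/eqP bx|bM].
    - by rewrite ax bx.
    - by move: (no _ bM); rewrite es -ax eab.
    - by move: (no _ aM); rewrite -bx eab.
    by rewrite (Mi a b).
  move=> /Mmax/(_ (subsetUr _ _)) E; by rewrite -E setU11 in xM.
pose pk x := odflt x [pick y in M | e y x].
have pkP x : x \in S -> pk x \in M /\ e (pk x) x.
  move=> /near[y yM exy]; rewrite /pk; case: pickP => [z /andP[]//|no].
  by move: (no y); rewrite /= yM exy.
apply: (@card_le_fiber _ _ pk) => [x /pkP[]//|y yM].
apply: leq_trans (ek _ (subsetP MS _ yM)); apply/subset_leq_card/subsetP=> x.
by rewrite !inE => /andP[xS /eqP <-]; have [_ ->] := pkP _ xS; rewrite xS.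
Qed.

(** * A rainbow matching with small load at every vertex *)

Section Matching.
Import Order.TTheory GRing.Theory Num.Theory.
Variables (V C : finType) (G : rel V) (col : {set V} -> C) (m : nat) (A : {set V}) (d b : nat).
Let n := #|V|.
Hypotheses (Gs : symmetric G) (Gi : irreflexive G).
Hypothesis colm : forall c, #|[set e in gedges G | col e == c]| <= m.
Hypothesis degA : forall v, v \in A -> b * #|[set y | G v y && (y \in A)]| <= n.
Let EA := [set e in gedges G | e \subset A].
Hypothesis cEA : d * n <= 8 * #|EA|.
Hypotheses (bE : b = 256) (bn : b <= n) (bm : b * m <= n) (m0 : 0 < m).

Let w v x := #|[set y | G v y && (col [set v; y] == x)]|.

Lemma w_row v : \sum_x w v x <= n.
Proof.
rewrite /w; under eq_bigr => x _ do rewrite -card_sum; rewrite exchange_big /= /n -sum1_card.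
apply: leq_sum => y _; case: (G v y); last by rewrite big1.
rewrite (bigD1 (col [set v; y])) //= eqxx big1 // => x; rewrite eq_sym => /negPf ->.
by [].
Qed.

Lemma w_col x : \sum_v w v x <= 2 * m.
Proof.
apply: leq_trans (_ : 2 * #|[set e in gedges G | col e == x]| <= _); last by rewrite leq_mul2l colm orbT.
apply: leq_trans (card_arcs _).
rewrite /w; under eq_bigr => v _ do rewrite -card_sum.
rewrite pair_bigA /= card_sum; apply: eq_leq; apply: eq_card => p.
by rewrite in_set in_set in_set gedgesE.
Qed.

Lemma EA_deg v : b * #|[set e in EA | v \in e]| <= n.
Proof.
have [vA|vA] := boolP (v \in A); last first.
  rewrite eq_card0 ?muln0 // => e; rewrite !inE -andbA; apply/negP=> /and3P[_ /subsetP eA /eA].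
  by rewrite (negPf vA).
apply: leq_trans (degA vA); rewrite leq_mul2l; apply/orP; right.
apply: leq_trans (leq_imset_card (fun y => [set v; y]) _).
apply/subset_leq_card/subsetP=> e; rewrite in_set in_set => /andP[/andP[/gedgesP[x [y [gxy ->]]]]].
rewrite subUset !sub1set => /andP[xA yA]; rewrite !inE => /orP[]/eqP ->.
  by apply: imset_f; rewrite inE gxy.
by rewrite setUC; apply: imset_f; rewrite inE Gs gxy.
Qed.

Let Row := (V + C + V)%type.
Local Open Scope ring_scope.
(* Rows: degrees, colours, and for each vertex v the number of edges at v (divided by m)
   whose colour is used. *)
Let c (r : Row) (e : {set V}) : rat := match r with
  | inl (inl v) => ((e \in EA) && (v \in e))%:R
  | inl (inr x) => ((e \in EA) && (col e == x))%:R
  | inr v => if e \in EA then (w v (col e))%:R / m%:R else 0 end.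
Let z (e : {set V}) : rat := if e \in EA then b%:R / n%:R else 0.

Let mR : 0 < m%:R :> rat. Proof. by rewrite ltr0n. Qed.
Let nR : 0 < n%:R :> rat. Proof. by rewrite ltr0n; move: bn; rewrite bE; case: (n). Qed.

Lemma c_ge0 r e : 0 <= c r e.
Proof. by case: r => [[v|x]|v] /=; rewrite ?ler0n //; case: ifP => // _; rewrite divr_ge0. Qed.

(** An edge contributes 2 to degree rows, 1 to colour rows, and at most 2 to load rows because a
    colour class has at most m edges. *)
Lemma c_col e : \sum_r c r e <= 5.
Proof.
rewrite !big_sumType /=.
have [eE|eE] := boolP (e \in EA); last first.
  by rewrite !big1 // => i _; rewrite (negPf eE).
rewrite /=.
have h1 : \sum_v (v \in e)%:R <= 2 :> rat.
  rewrite -natr_sum ler_nat sum_card_in; move: eE; rewrite inE => /andP[/gedgesP[x [y [_ ->]]] _].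
  by rewrite cards2; case: eqP.
have h2 : \sum_x (col e == x)%:R <= 1 :> rat.
  rewrite -natr_sum (_ : 1 = 1%:R) // ler_nat (bigD1 (col e)) //= eqxx big1 // => x.
  by rewrite eq_sym => /negPf ->.
have h3 : \sum_v (w v (col e))%:R / m%:R <= 2 :> rat.
  by rewrite -mulr_suml ler_pdivrMr // -natr_sum -natrM ler_nat w_col.
move: h1 h2 h3; set s1 := \sum_v _; set s2 := \sum_x _; set s3 := \sum_v _; lra.
Qed.

Lemma z01 e : 0 <= z e <= 1.
Proof.
rewrite /z; case: ifP => // _; apply/andP; split; first by rewrite divr_ge0.
by rewrite ler_pdivrMr // mul1r ler_nat.
Qed.

Lemma sum_z (a : {set V} -> rat) : \sum_e a e * z e = (\sum_(e in EA) a e) * (b%:R / n%:R).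
Proof.
rewrite mulr_suml [RHS]big_mkcond; apply: eq_bigr => e _.
by rewrite /z; case: ifP; rewrite ?mulr0.
Qed.

Lemma scaled_le (a k : nat) : (b * a <= k * n)%N -> a%:R * (b%:R / n%:R) <= k%:R :> rat.
Proof. by move=> h; rewrite mulrA ler_pdivrMr // -!natrM ler_nat mulnC. Qed.

Lemma row_count (S : {set {set V}}) (P : pred {set V}) : S \subset EA ->
  \sum_(e in S) ((e \in EA) && P e)%:R = #|[set e in S | P e]|%:R :> rat.
Proof.
move=> /subsetP SE; rewrite -natr_sum -card_sum big_mkcond; congr (_%:R).
apply: eq_bigr => e _; have := SE e; case: (e \in S) => // /(_ isT) ->.
by rewrite andTb.
Qed.

Lemma rounded_row (S : {set {set V}}) (P : pred {set V}) : S \subset EA ->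
  \sum_(e in S) ((e \in EA) && P e)%:R <=
     (\sum_(e in EA) ((e \in EA) && P e)%:R) * (b%:R / n%:R) + 5 :> rat ->
  (b * #|[set e in EA | P e]| <= n)%N -> (#|[set e in S | P e]| <= 6)%N.
Proof.
move=> SE; rewrite !row_count // => h1 h2.
have h3 : #|[set e in EA | P e]|%:R * (b%:R / n%:R) <= 1 :> rat.
  by apply: (@scaled_le _ 1); rewrite mul1n.
rewrite -(ler_nat rat); move: h1 h3; set x := (_ * _); lra.
Qed.

(** Under the weight b / n the degrees and colours inside [A] weigh at most 1 and the loads at most
    b; rounding adds 5 to each. The total weight is at least (256 / n) * (d n / 8) = 32 d. *)
Lemma rounded_edges : exists S : {set {set V}}, [/\ S \subset EA, (32 * d <= #|S|)%N,
  forall v, (#|[set e in S | v \in e]| <= 6)%N,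
  forall x, (#|[set e in S | col e == x]| <= 6)%N &
  forall v, (\sum_(e in S) w v (col e) <= (b + 5) * m)%N].
Proof.
have [S [S1 S2 S3]] := beck_fiala c_ge0 c_col (isT : 0 < 5 :> rat) z01.
have SE : S \subset EA.
  apply/subsetP=> e eS; apply: contraT => eE.
  by have := S2 e; rewrite /z (negPf eE) => /(_ erefl); rewrite eS.
exists S; split=> //.
- rewrite -(ler_nat rat); apply: le_trans S1.
  have -> : \sum_e z e = \sum_e 1 * z e by apply: eq_bigr => e _; rewrite mul1r.
  rewrite sum_z sumr_const mulrA ler_pdivlMr // -!natrM ler_nat bE; lia.
- move=> v; have := S3 (inl (inl v)); rewrite sum_z => h.
  by apply: (rounded_row SE h); apply: EA_deg.
- move=> x; have := S3 (inl (inr x)); rewrite sum_z => h.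
  apply: (rounded_row SE h); apply: leq_trans bm; rewrite leq_mul2l; apply/orP; right.
  apply: leq_trans (colm x); apply/subset_leq_card/subsetP=> e.
  by rewrite !in_set => /andP[/andP[-> _] ->].
move=> v; have := S3 (inr v); rewrite sum_z.
have row (B : {set {set V}}) : B \subset EA ->
    \sum_(e in B) c (inr v) e = (\sum_(e in B) w v (col e))%:R / m%:R.
  move=> /subsetP BE; rewrite natr_sum mulr_suml; apply: eq_bigr => e eB.
  by rewrite /= BE.
rewrite !row // => h.
have h1 : (\sum_(e in EA) w v (col e))%:R / m%:R * (b%:R / n%:R) <= b%:R :> rat.
  rewrite mulrA ler_pdivrMr // mulrAC ler_pdivrMr // -!natrM ler_nat.
  (* Grouped by colour: at most m edges of each colour x, each weighing [w v x], and these weights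
     sum to at most n. *)
  have : (\sum_(e in EA) w v (col e) <= m * n)%N.
    rewrite (partition_big col predT) //=.
    apply: leq_trans (_ : (\sum_x m * w v x <= _)%N); last first.
      by rewrite -big_distrr leq_mul2l w_row orbT.
    apply: leq_sum => x _; apply: leq_trans (_ : (\sum_(e in EA | col e == x) w v x <= _)%N).
      by apply: leq_sum => e /andP[_ /eqP->].
    rewrite sum_nat_cond_const leq_mul2r; apply/orP; right.
    apply: leq_trans (colm x); apply/subset_leq_card/subsetP=> e.
    by rewrite !inE => /andP[/andP[-> _] ->].
  by move=> /(leq_mul (leqnn b)); lia.
have h2 : (\sum_(e in S) w v (col e))%:R / m%:R <= b%:R + 5%:R :> rat.
  by apply: le_trans h _; rewrite lerD2r.
by move: h2; rewrite ler_pdivrMr // -natrD -natrM ler_nat.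
Qed.

Local Open Scope nat_scope.

(** Two edges conflict if they meet or share a colour. Each edge conflicts with at most 1 + 6 + 6 +
    6 = 19 edges including itself, and 19 < 32 leaves d independent ones. *)
Lemma rainbow_matching : exists M : {set {set V}}, [/\ M \subset EA, #|M| = d,
  forall e e', e \in M -> e' \in M -> e != e' -> [disjoint e & e'],
  {in M &, injective col} &
  forall v, #|[set y | G v y && [exists e in M, col e == col [set v; y]]]| <= (b + 5) * m].
Proof.
have [S [SE dS Sd Sc Sl]] := rounded_edges.
pose cf (e e' : {set V}) := [|| e == e', [exists v, (v \in e) && (v \in e')] | col e == col e'].
have cfs : symmetric cf.
  move=> e e'; rewrite /cf eq_sym (eq_sym (col e)); congr [|| _, _ | _].
  by apply: eq_existsb => v; rewrite andbC.
have cfr e : cf e e by rewrite /cf eqxx.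
have cfk e : e \in S -> #|[set e' in S | cf e e']| <= 19.
  move=> eS; have : e \in EA by apply: (subsetP SE).
  rewrite inE => /andP[/gedgesP[x [y [_ eE]]] _].
  apply: leq_trans (_ : #|[set e] :|: ([set e' in S | x \in e'] :|: ([set e' in S | y \in e'] :|:
     [set e' in S | col e' == col e]))| <= _).
    apply/subset_leq_card/subsetP=> e'; rewrite !inE => /andP[e'S /or3P[/eqP->|/existsP[v]|/eqP->]].
    - by rewrite eqxx.
    - by rewrite eE !inE => /andP[/orP[]/eqP-> ->]; rewrite e'S ?orbT.
    by rewrite e'S eqxx !orbT.
  apply: leq_trans (leq_card_setU _ _) _; rewrite cards1 -[19]/(1 + (6 + (6 + 6))) leq_add2l.
  apply: leq_trans (leq_card_setU _ _) _; apply: leq_add => //.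
  by apply: leq_trans (leq_card_setU _ _) _; apply: leq_add.
have [M0 [M0S cM0 M0i]] := independent_subset cfs cfk cfr.
have dM0 : d <= #|M0|.
  rewrite -(@leq_pmul2l 19) //; apply: leq_trans (leq_trans _ dS) cM0.
  by rewrite leq_mul2r orbT.
have [M MM0 cM] := exists_subset_card dM0.
have Mi e e' : e \in M -> e' \in M -> cf e e' -> e = e'.
  by move=> eM e'M; apply: M0i; apply: (subsetP MM0).
have MS := subset_trans MM0 M0S.
exists M; split=> //; first exact: subset_trans SE.
- move=> e e' eM e'M ne; rewrite disjoint_subset; apply/subsetP=> v ve; rewrite inE.
  apply: contra ne => ve'; apply/eqP/Mi => //; apply/or3P/Or32/existsP.
  by exists v; rewrite ve.
- by move=> e e' eM e'M ce; apply: Mi => //; rewrite /cf ce eqxx !orbT.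
move=> v; apply: leq_trans (Sl v).
apply: leq_trans (_ : \sum_(e in M) w v (col e) <= _); last first.
  rewrite [leqRHS](bigID (mem M)) /= [leqRHS]addnC.
  rewrite [X in _ <= _ + X](eq_bigl (mem M)) ?leq_addl // => e.
  by rewrite andb_idl //=; apply: (subsetP MS).
rewrite -card_sum /w; under [leqRHS]eq_bigr => e _ do rewrite -card_sum.
rewrite exchange_big; apply: leq_sum => y _ /=.
case: (G v y) => //=; case: exists_inP => // -[e eM /eqP ce].
by rewrite (bigD1 e) //= ce eqxx.
Qed.

End Matching.

(** * The near-bipartite case *)

Section Weave.
Variables (V : finType) (A : {set V}) (M : {set {set V}}).
Let R := sideR A true.

(** A vertex outside [A] alternates with a block, which is a single vertex of [A] or both ends of a
    matching edge; so only matching edges stay inside [A]. *)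
Fixpoint weave (bs : seq V) (es : seq {set V}) : seq V :=
  if bs is b :: bs' then if es is e :: es' then b :: enum e ++ weave bs' es' else [::] else [::].

Hypothesis MA : forall e, e \in M -> e \subset A.
Hypothesis M2 : forall e, e \in M -> #|e| = 2.
Hypothesis Mdis : forall e e', e \in M -> e' \in M -> e != e' -> [disjoint e & e'].

Let block (e : {set V}) := (exists2 a, a \in A & e = [set a]) \/ e \in M.

Lemma enum_pair (e : {set V}) : #|e| = 2 -> exists x y, enum e = [:: x; y] /\ e = [set x; y].
Proof.
rewrite cardE; case E: (enum e) => [|x [|y []]] // _; exists x, y; split=> //.
by apply/setP=> z; rewrite -mem_enum E !inE.
Qed.

Lemma cross_edge x y : x \in A -> y \notin A -> [set x; y] \in gedges R.
Proof. by move=> xA yA; rewrite gedgesE ?/R /sideR ?xA ?(negPf yA) //; apply: sideR_sym. Qed.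

Lemma cross_edge' x y : x \in A -> y \notin A -> [set y; x] \in gedges R.
Proof. by rewrite setUC; apply: cross_edge. Qed.

Lemma weave_edges bs es f : {in bs, forall b, b \notin A} -> {in es, forall e, block e} ->
  f \in pedges (weave bs es) -> f \in gedges R \/ f \in M.
Proof.
elim: bs es => [|b bs IH] [|e es] //= hb he.
have bA : b \notin A by apply: hb; rewrite inE eqxx.
have IH' : f \in pedges (weave bs es) -> f \in gedges R \/ f \in M.
  by apply: IH => x xs; [apply: hb|apply: he]; rewrite inE xs orbT.
have tail a : a \in A -> f \in pedges (a :: weave bs es) -> f \in gedges R \/ f \in M.
  move=> aA; case: bs es hb {he IH} IH' => [|b' bs] [|e' es] hb IH' //.
  rewrite [pedges _]/= inE => /orP[/eqP->|h]; last exact: IH'.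
  by left; apply: cross_edge => //; apply: hb; rewrite !inE eqxx orbT.
have [[a aA ->]|eM] := he e (mem_head _ _).
  rewrite enum_set1 [_ ++ _]/= [pedges _]/= inE => /orP[/eqP->|]; last exact: tail.
  by left; apply: cross_edge'.
have [x [y [-> eE]]] := enum_pair (M2 eM).
have /subsetP eA := MA eM; rewrite eE in eA.
rewrite [_ ++ _]/= [pedges _]/= !in_cons => /or3P[/eqP->|/eqP->|].
- by left; apply: cross_edge' => //; apply: eA; rewrite !inE eqxx.
- by right; rewrite -eE.
by apply: tail; apply: eA; rewrite !inE eqxx orbT.
Qed.

Lemma weave_covers bs es e : size bs = size es -> e \in es -> e \in M ->
  e \in pedges (weave bs es).
Proof.
elim: bs es => [|b bs IH] [|e' es] //= [sz]; rewrite inE => /orP[/eqP <-|ees] eM.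
  have [x [y [-> eE]]] := enum_pair (M2 eM).
  by rewrite /= eE !inE eqxx orbT.
have h := IH _ sz ees eM.
have sub (s t : seq V) (z : {set V}) : z \in pedges t -> z \in pedges (s ++ t).
  elim: s => // x s IHs zt; rewrite cat_cons.
  by case E: (s ++ t) (IHs zt) => [|y w] //= h'; rewrite inE h' orbT.
by apply: (sub (b :: enum e')).
Qed.

Lemma weave_last bs es x : {in es, forall e, block e} -> x \in A -> last x (weave bs es) \in A.
Proof.
elim: bs es x => [|b bs IH] [|e es] //= x he xA; rewrite last_cat.
apply: IH => [z zs|]; first by apply: he; rewrite inE zs orbT.
have [[a aA ->]|eM] := he e (mem_head _ _); first by rewrite enum_set1.
have [y [z [-> eE]]] := enum_pair (M2 eM).
by apply: (subsetP (MA eM)); rewrite eE !inE eqxx orbT.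
Qed.

Lemma weave_perm bs es : size bs = size es ->
  perm_eq (weave bs es) (bs ++ flatten (map (fun e : {set V} => enum e) es)).
Proof.
elim: bs es => [|b bs IH] [|e es] //= [sz]; rewrite perm_cons.
by rewrite perm_sym perm_catCA perm_cat2l perm_sym IH.
Qed.

(** The matching edges and the uncovered vertices of [A] form |A| - |M| blocks, exactly one for each
    vertex outside [A]. *)
Lemma matching_cycles : #|A| = #|~: A| + #|M| -> 0 < #|~: A| -> side_cycles A true M != set0.
Proof.
move=> cA B0.
pose sing := [set [set a] | a in A :\: cover M]; pose Q := M :|: sing.
have MT : trivIset M by apply/trivIsetP=> e e' eM e'M; apply: Mdis.
have cM : #|cover M| = 2 * #|M|.
  move/eqP: MT => <-; rewrite mulnC -sum_nat_const; exact: eq_bigr.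
have cMA : cover M \subset A by apply/bigcupsP=> e; apply: MA.
have Qb e : e \in Q -> block e.
  rewrite in_setU => /orP[eM|/imsetP[a]]; first by right.
  by rewrite inE => /andP[_ aA] ->; left; exists a.
have disj : [disjoint M & sing].
  rewrite disjoint_subset; apply/subsetP=> e eM; rewrite inE; apply/imsetP=> -[a _ eE].
  by have := M2 eM; rewrite eE cards1.
have cQ : #|Q| = #|~: A|.
  rewrite cardsU (disjoint_setI0 disj) cards0 subn0 card_imset; last exact: set1_inj.
  rewrite cardsD (setIidPr cMA) cM; have := subset_leq_card cMA; rewrite cM; lia.
have covQ a : a \in A -> exists2 e, e \in Q & a \in e.
  move=> aA; have [/bigcupP[e eM ae]|aM] := boolP (a \in cover M).
    by exists e; rewrite // inE eM.
  by exists [set a]; rewrite ?inE // imset_f ?orbT // inE aM.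
have sQ : \sum_(e in Q) #|e| = #|A|.
  rewrite (eq_bigl (fun e => (e \in M) || (e \in sing))); last by move=> e; rewrite inE.
  rewrite bigU //= big_imset /=; last by move=> x y _ _; apply: set1_inj.
  rewrite (eqP MT) (eq_bigr (fun=> 1)); last by move=> a _; rewrite cards1.
  by rewrite sum1_card cardsD (setIidPr cMA) subnKC // subset_leq_card.
pose bs := enum (~: A); pose es := enum Q; pose s := weave bs es.
have sz : size bs = size es by rewrite -!cardE cQ.
have ps := weave_perm sz.
have es_b : {in es, forall e, block e} by move=> e; rewrite mem_enum; apply: Qb.
have bs_A : {in bs, forall b, b \notin A} by move=> b; rewrite mem_enum inE.
have sall x : x \in s.
  rewrite (perm_mem ps) mem_cat mem_enum inE; case: (boolP (x \in A)) => //= xA.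
  have [e eQ xe] := covQ x xA; apply/flattenP; exists (enum e); last by rewrite mem_enum.
  by apply/map_f; rewrite mem_enum.
have ssz : size s = #|V|.
  rewrite (perm_size ps) size_cat -cardE size_flatten /shape -map_comp sumnE big_map.
  rewrite big_enum /= (eq_bigr (fun e : {set V} => #|e|)); last by move=> e _; rewrite /= -cardE.
  by rewrite sQ addnC cardsC.
have us : uniq s.
  by apply/card_uniqP; rewrite ssz; apply: eq_card => x; rewrite sall.
apply/set0Pn; exists (cyc s); rewrite inE; apply/and3P; split.
- exact: hamc_all.
- apply/subsetP=> e eM; rewrite in_cyc.
  have : e \in pedges s by apply: weave_covers => //; rewrite mem_enum inE eM.
  by case: (s) => // x t h; rewrite (cedgesE x) // inE h orbT.
apply/subsetP=> e /setDP[eH eM]; move: eH; rewrite in_cyc.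
have [b [bs' bE]] : exists b bs', bs = b :: bs'.
  by move: B0; rewrite cardE -/bs; case: (bs) => // b bs' _; exists b, bs'.
have [e0 [es' eE]] : exists e0 es', es = e0 :: es'.
  by move: sz; rewrite bE; case: (es) => // e0 es' _; exists e0, es'.
rewrite (cedgesE b) /s ?bE ?eE // inE -bE -eE => /orP[/eqP->|]; last first.
  by case/(weave_edges bs_A es_b) => //; rewrite (negPf eM).
have hb : head b (weave bs es) = b by rewrite bE eE.
rewrite hb; apply: cross_edge; last by apply: bs_A; rewrite bE mem_head.
rewrite bE eE /= last_cat; apply: weave_last => [x xs|].
  by apply: es_b; rewrite eE inE xs orbT.
have [[a aA ->]|e0M] := es_b e0 (eq_ind_r (fun l => e0 \in l) (mem_head _ _) eE).
  by rewrite enum_set1.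
have [y [z [-> yz]]] := enum_pair (M2 e0M).
by apply: (subsetP (MA e0M)); rewrite yz !inE eqxx orbT.
Qed.

End Weave.

Section Bipartite.
Variables (V C : finType) (G : rel V) (col : {set V} -> C) (m b : nat).
Let n := #|V|.
Hypotheses (Gs : symmetric G) (Gi : irreflexive G).
Hypothesis colm : forall c, #|[set e in gedges G | col e == c]| <= m.
Hypothesis dG : forall x, n <= 2 * \sum_y G x y.
Hypotheses (bE : b = 256) (bn : b <= n) (bm : b * m <= n) (m0 : 0 < m).

Lemma inside_deg (A : {set V}) x :
  n <= 2 * #|~: A| + 2 * #|[set y | G x y && (y \in A)]|.
Proof.
have := dG x; have : \sum_y G x y <= #|~: A| + #|[set y | G x y && (y \in A)]|.
  rewrite -card_sum -sum_card_in -big_split /=; apply: leq_sum => y _.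
  by rewrite in_setC; case: (G x y); case: (y \in A).
lia.
Qed.

(** Each of the at least n/2 vertices of [A] has at least d/2 neighbours inside [A]. *)
Lemma inside_edges (A : {set V}) d : #|A| = #|~: A| + d ->
  d * n <= 8 * #|[set e in gedges G | e \subset A]|.
Proof.
move=> cA; set EA := [set e in _ | _].
have h1 : \sum_(x in A) #|[set y | G x y && (y \in A)]| <= 2 * #|EA|.
  apply: leq_trans (card_arcs EA).
  rewrite big_mkcond /= (eq_bigr (fun x => \sum_y [&& x \in A, G x y & y \in A] : nat)).
    rewrite pair_bigA /= card_sum; apply: subset_leq_card; apply/subsetP=> p.
    rewrite in_set => /and3P[xA gxy yA].
    by rewrite in_set in_set gedgesE // gxy subUset !sub1set xA yA.
  by move=> x _; case: (x \in A); [rewrite card_sum|rewrite big1].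
have h2 : \sum_(x in A) d <= 2 * \sum_(x in A) #|[set y | G x y && (y \in A)]|.
  rewrite big_distrr /=; apply: leq_sum => x _.
  by have := inside_deg A x; have := cardsC A; rewrite -/n; lia.
rewrite sum_nat_const in h2.
have h3 : n <= 2 * #|A| by have := cardsC A; rewrite -/n; lia.
by have := leq_mul (leqnn d) h3; lia.
Qed.

(** An imbalance of 1 is corrected by any single edge inside [A]; from 2 on the rounding is used,
    which is where the inner degrees must be small. *)
Lemma matching_exists (A : {set V}) d : #|A| = #|~: A| + d ->
  (2 <= d -> forall v, v \in A -> b * #|[set y | G v y && (y \in A)]| <= n) ->
  exists M : {set {set V}}, [/\ forall e, e \in M -> e \in gedges G /\ e \subset A, #|M| = d,
    forall e e', e \in M -> e' \in M -> e != e' -> [disjoint e & e'],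
    {in M &, injective col} &
    forall v, #|[set y | G v y && [exists e in M, col e == col [set v; y]]]| <= (b + 5) * m].
Proof.
move=> cA hd; have cE := inside_edges cA.
case: d cA hd cE => [|[|d]] cA hd cE.
- exists set0; split=> [e|||e e'|v]; rewrite ?cards0 //; try by [rewrite inE|move=> e e'; rewrite inE].
  rewrite eq_card0 // => y; rewrite !inE; apply/negP=> /andP[_ /exists_inP[e]].
  by rewrite inE.
- have : 0 < #|[set e in gedges G | e \subset A]|.
    by move: bn cE; rewrite bE; lia.
  move=> /card_gt0P[e]; rewrite in_set => /andP[eG eA].
  exists [set e]; split.
  + by move=> e'; rewrite in_set1 => /eqP->.
  + by rewrite cards1.
  + by move=> e1 e2; rewrite !in_set1 => /eqP-> /eqP->; rewrite eqxx.
  + by move=> e1 e2; rewrite !in_set1 => /eqP-> /eqP->.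
  move=> v; apply: leq_trans (hit_load Gs colm _ _) _.
  by rewrite cards1 mulnC leq_mul2r; apply/orP; right; rewrite bE.
have [M [h1 h2 h3 h4 h5]] := rainbow_matching Gs colm (hd isT) cE bE bn bm m0.
exists M; split=> // e eM; have := subsetP h1 _ eM; rewrite in_set => /andP[]; by [].
Qed.

Variables (A : {set V}) (r g dl : nat).
Hypothesis cA1 : n <= 2 * #|A|.
Hypothesis cA2 : 2 * #|A| <= n + 130 * r.
Hypothesis degR : forall x, n <= 4 * (\sum_y (sideR A true x y && G x y)) + 256 * r.
Hypothesis nonR : \sum_x \sum_y (sideR A true x y && ~~ G x y) <= 136 * (r * n).
Hypothesis dlr : b * (dl + (b + 5) * m + 66 * r) <= n.
Hypothesis n3 : 2 < n.
Hypothesis dlbig : 2 * (g * n) + 2 * n + 6 * ((130 * r) * n) +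
  2 * (266 * (r * n) + 2 * (m * (130 * r))) <= dl * dl.
Hypothesis gm : 8 * (m + 1) <= g.
Hypothesis gbig : 2048 * 100 * (n * m) <= g ^ 2.
Hypothesis g120 : 120 <= g.

(* Vertices with many neighbours inside A are moved to the other side first, so that either
   the sides become balanced (up to one) or the degrees inside A are small. *)
Lemma bipartite_rainbow : has_rainbow_cycle G col.
Proof.
pose hubs := [set v in A | n <= b * #|[set y | G v y && (y \in A)]|].
(* Moving one vertex lowers the excess 2 |A| - n by 2, hence at most half of it is moved. *)
have [W Wh cW] := exists_subset_card (geq_minl #|hubs| (2 * #|A| - n)./2).
have hA : hubs \subset A by apply/subsetP=> v; rewrite inE => /andP[].
have WA := subset_trans Wh hA.
pose A' := A :\: W; pose d := (2 * #|A| - n) - 2 * #|W|.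
have cA' : #|A'| + #|W| = #|A| by rewrite cardsD (setIidPr WA) subnK // subset_leq_card.
have cW2 : 2 * #|W| <= 2 * #|A| - n.
  rewrite cW; apply: leq_trans (_ : 2 * (2 * #|A| - n)./2 <= _).
    by rewrite leq_mul2l geq_minr.
  by rewrite mul2n -[leqRHS]odd_double_half leq_addl.
have cAC := cardsC A'; rewrite -/n in cAC.
have cAd : #|A'| = #|~: A'| + d by rewrite /d; lia.
have hd : 2 <= d -> forall v, v \in A' -> b * #|[set y | G v y && (y \in A')]| <= n.
  move=> d2 v; rewrite inE => /andP[vW vA].
  have WE : W = hubs.
    apply/eqP; rewrite eqEcard Wh /= cW leq_min leqnn /=.
    case: (leqP #|hubs| (2 * #|A| - n)./2) => // lt; exfalso.
    have cWe : #|W| = (2 * #|A| - n)./2 by rewrite cW; apply/minn_idPr/ltnW.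
    move: d2; rewrite /d cWe -{1}(odd_double_half (2 * #|A| - n)) -mul2n addnK.
    by case: (odd _).
  move: vW; rewrite WE inE vA /= -ltnNge => /ltnW; apply: leq_trans.
  rewrite leq_mul2l; apply/orP; right; apply/subset_leq_card/subsetP=> y.
  by rewrite !inE => /and3P[-> _ ->].
have [M [MG cM Mdis Mcol Mload]] := matching_exists cAd hd.
have Wr : #|W| <= 65 * r by lia.
have dr : #|M| <= 130 * r by rewrite cM /d; lia.
have M2 e : e \in M -> #|e| = 2.
  move=> /MG[/gedgesP[x [y [gxy ->]]] _]; rewrite cards2.
  by case: eqP gxy => // ->; rewrite Gi.
have RW x y : sideR A true x y <= sideR A' true x y + ((x \in W) + (y \in W)).
  by rewrite /sideR !in_setD; case: (x \in W); case: (y \in W); case: (x \in A); case: (y \in A).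
apply: (@side_rainbow V G C col Gs Gi A' true M m g (130 * r) dl ((b + 5) * m) (266 * (r * n))) => //.
- by apply/subsetP=> e /MG[].
- move=> e eM; have [/gedgesP[x [y [_ eE]]] /subsetP eA] := MG _ eM.
  rewrite eE gedgesE; last exact: sideR_sym.
  by rewrite /sideR !eA ?eE ?inE ?eqxx ?orbT.
- move=> v; rewrite -(@leq_pmul2l b) ?bE //.
  (* A moved vertex has n / b neighbours in the old [A], all but at most |W| of them now opposite to
     it; this keeps dl below n / b. Any other vertex loses at most |W| of the roughly n/4 granted by
     [degR]. *)
  have [vW|vW] := boolP (v \in W).
    have : n <= b * #|[set y | G v y && (y \in A)]|.
      by have := subsetP Wh _ vW; rewrite inE => /andP[].
    have : #|[set y | G v y && (y \in A)]| <= \sum_y (sideR A' true v y && G v y) + #|W|.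
      rewrite -card_sum -sum_card_in -big_split /=; apply: leq_sum => y _.
      by rewrite /sideR !in_setD vW /=; case: (y \in W); case: (G v y); case: (y \in A).
    by move: dlr Wr; rewrite bE; clear; lia.
  have : \sum_y (sideR A true v y && G v y) <= \sum_y (sideR A' true v y && G v y) + #|W|.
    rewrite -sum_card_in -big_split /=; apply: leq_sum => y _; have := RW v y.
    by rewrite (negPf vW); case: (sideR A true v y); case: (sideR A' true v y); case: (y \in W); case: (G v y).
  by move: dlr Wr (degR v); rewrite bE; clear; lia.
- apply: leq_trans (_ : \sum_x (\sum_y (sideR A true x y && ~~ G x y) + (n * (x \in W) + #|W|)) <= _).
    apply: leq_sum => x _; rewrite -sum_card_in -sum_const_fin -!big_split /=.
    apply: leq_sum => y _; have : sideR A' true x y <= sideR A true x y + ((x \in W) + (y \in W)).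
      by rewrite /sideR !in_setD; case: (x \in W); case: (y \in W); case: (x \in A); case: (y \in A).
    by case: (sideR A true x y); case: (sideR A' true x y); case: (x \in W); case: (y \in W); case: (G x y).
  rewrite big_split /= big_split /= -big_distrr /= sum_card_in sum_const_fin -/n.
  by have := leq_mul (leqnn n) Wr; move: nonR; clear; lia.
apply: matching_cycles => //; first by move=> e /MG[].
  by rewrite cM.
by move: dlr cAd cAC cA2 cM dr n3; rewrite bE; clear; lia.
Qed.

End Bipartite.

Lemma sideR_setC (V : finType) (A : {set V}) k : sideR (~: A) k =2 sideR A k.
Proof. by move=> x y; rewrite /sideR !in_setC; case: (x \in A); case: (y \in A). Qed.

(** * Combining the generic and the two extremal cases *)

Section DiracRainbow.
Variables (V C : finType) (G : rel V) (col : {set V} -> C) (m g h r dl : nat).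
Let n := #|V|.
Hypotheses (Gs : symmetric G) (Gi : irreflexive G).
Hypothesis colm : forall c, #|[set e in gedges G | col e == c]| <= m.
Hypothesis dG : forall x, n <= 2 * \sum_y G x y.
Hypotheses (m0 : 0 < m) (gm : 8 * (m + 1) <= g) (gbig : 2048 * 100 * (n * m) <= g ^ 2).
Hypotheses (g120 : 120 <= g) (gh : 2 * g * n <= h * h) (glh : 2 * g <= h).
Hypotheses (hr : h <= r) (hnr : 96 * (h * n) <= r * r) (rn : 256 * r <= n).
Hypothesis dlr : 256 * (dl + (256 + 5) * m + 66 * r) <= n.
Hypothesis dlbig : 2 * (g * n) + 2 * n + 6 * ((130 * r) * n) +
  2 * (266 * (r * n) + 2 * (m * (130 * r))) <= dl * dl.

Lemma dirac_rainbow : has_rainbow_cycle G col.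
Proof.
have r0 : 0 < r by lia.
have n0 : 256 <= n by lia.
have n3 : 2 < n by apply: leq_trans n0.
pose KK : {set {set {set V}}} := [set H | hamc H].
have [/forallP all_moves|] := boolP [forall H : {set {set V}}, forall u, forall v,
   (H \in KK) && ([set u; v] \in H) ==>
   ((2 * g <= #|[set w | move2 KK (gedges G) H u v w]|) ||
    (2 * (g * n) <= #|[set w | move3 KK (gedges G) H u v w]|))].
  have KKham H : H \in KK -> hamc H by rewrite inE.
  have ESF e : e \in gedges G -> e \notin (set0 : {set {set V}}) by rewrite in_set0.
  have ESP e : e \in gedges G -> exists x y, e = [set x; y].
    by move=> /gedgesP[x [y [_ ->]]]; exists x, y.
  have EScol e : e \in gedges G -> #|[set f in gedges G | col f == col e]| <= m by move=> _; apply: colm.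
  have moves H u v : H \in KK -> [set u; v] \in H -> [set u; v] \notin (set0 : {set {set V}}) ->
    2 * g <= #|[set w | move2 KK (gedges G) H u v w]| \/
    2 * (g * n) <= #|[set w | move3 KK (gedges G) H u v w]|.
    move=> HK uvH _; have /forallP/(_ u)/forallP/(_ v) := all_moves H.
    by rewrite HK uvH => /orP.
  have KK0 : KK != set0.
    apply/set0Pn; exists (cyc (enum V)); rewrite inE; apply: hamc_all.
      exact: enum_uniq.
    by move=> x; rewrite mem_enum.
  have [H HK [Hs Hc]] := switching_rainbow KKham ESF ESP EScol moves n3 gm gbig g120 KK0.
  rewrite setU0 in Hs; rewrite setD0 in Hc.
  exact: (rainbow_of_edges Gs n3 (KKham _ HK) Hs Hc).
move=> /forallPn[H /forallPn[u /forallPn[v]]]; rewrite negb_imply negb_or -!ltnNge.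
move=> /andP[/andP[HK uvH] /andP[f2 f3]].
have hH : hamc H by rewrite inE in HK.
have [t [us ss HE lt]] := hamc_edge hH uvH; rewrite HE in f2 f3.
have dG' x : n <= 2 * #|[set y | G x y]| by rewrite -card_sum.
have q0 : 0 < 2 * g by lia.
have hn : 2 * h <= n by lia.
have [c2|c3|[S0 [S1 [s0 s1 cut]]]] := dichotomy_at Gs Gi us ss lt n3 dG' gh q0 glh hn.
- by move: (leq_trans f2 c2); rewrite ltnn.
- by rewrite -mulnA in c3; move: (leq_trans f3 c3); rewrite ltnn.
have rn8 : 8 * r <= n by lia.
have nn0 : 0 < n by lia.
have [A [k [degR nonR A1 A2]]] := extremal_structure Gs dG glh hr hnr rn8 nn0 r0 s0 s1 cut.
have cC := cardsC A; rewrite -/n in cC.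
have degRC x : n <= 4 * (\sum_y (sideR (~: A) k x y && G x y)) + 256 * r.
  by apply: leq_trans (degR x) _; rewrite leq_add2r leq_mul2l /=; apply: leq_sum => y _; rewrite sideR_setC.
have nonRC : \sum_x \sum_y (sideR (~: A) k x y && ~~ G x y) <= 136 * (r * n).
  apply: leq_trans nonR; apply: leq_sum => x _; apply: leq_sum => y _; by rewrite sideR_setC.
have bm : 256 * m <= n by lia.
case: k degR nonR degRC nonRC => degR nonR degRC nonRC.
  (* The argument needs [A] to be the larger side; the side relation is the same for the
     complement. *)
  have [An|An] := leqP n (2 * #|A|).
    apply: (@bipartite_rainbow V C G col m 256 Gs Gi colm dG erefl n0 bm m0 A r g dl) => //; by lia.
  apply: (@bipartite_rainbow V C G col m 256 Gs Gi colm dG erefl n0 bm m0 (~: A) r g dl) => //; by lia.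
have dlbig2 : 2 * (g * n) + 2 * n + 6 * (2 * n) + 2 * (136 * (r * n) + 2 * (m * 2)) <= dl * dl.
  apply: leq_trans dlbig; have := leq_mul r0 (leqnn n); have := leq_mul (leqnn m) r0; lia.
have [An|An] := leqP (2 * #|A|) n.
  apply: (@two_cliques_rainbow V G C col m Gs Gi colm A dG g dl (136 * (r * n))) => //; first by lia.
  by move=> x; have := degR x; lia.
apply: (@two_cliques_rainbow V G C col m Gs Gi colm (~: A) dG g dl (136 * (r * n))) => //; try by lia.
by move=> x; have := degRC x; lia.
Qed.

End DiracRainbow.

(** * The theorem *)

Lemma map_uniq_coarser (T : Type) (C D : eqType) (f : T -> C) (g : T -> D) (s : seq T) :
  (forall x y, f x = f y -> g x = g y) -> uniq (map g s) -> uniq (map f s).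
Proof.
move=> fg; elim: s => //= x s IH /andP[xs /IH ->]; rewrite andbT.
elim: s xs {IH} => //= y s IHs; rewrite !inE !negb_or => /andP[gxy /IHs ->].
by rewrite andbT; apply: contra gxy => /eqP/fg ->.
Qed.

Section Recolour.
Variables (V : finType) (E : {set {set V}}) (C : eqType) (col : {set V} -> C).

(* C may be infinite; a colour is replaced by the choice of an edge having it. *)
Definition recolour (e : {set V}) : {set V} := odflt set0 [pick f in E | col f == col e].

Lemma recolour_coarser e f : col e = col f -> recolour e = recolour f.
Proof. by rewrite /recolour => ->. Qed.

Lemma recolour_class m : (forall c, #|[set e in E | col e == c]| <= m) ->
  forall c, #|[set e in E | recolour e == c]| <= m.
Proof.
move=> colm c; have [->|[e0]] := set_0Vmem [set e in E | recolour e == c].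
  by rewrite cards0.
have rE e : e \in E -> col (recolour e) = col e.
  by move=> eE; rewrite /recolour; case: pickP => [f /andP[_ /eqP]//|/(_ e)]; rewrite /= eE eqxx.
rewrite inE => /andP[e0E /eqP e0c]; apply: leq_trans (colm (col e0)).
apply/subset_leq_card/subsetP=> e; rewrite !inE => /andP[eE /eqP ec].
by rewrite eE -(rE e) // ec -e0c rE // eqxx.
Qed.

End Recolour.

(* With k = n / B^4, the scales are g = k, h = 2 B^2 k, r = 20 B^3 k, dl ~ n / 1024. *)
Lemma scale_choice t n : 4096 * 4096 * 8 <= t ->
  let B := 1024 * t in let B4 := B * B * B * B in
  let K := 1024 * 1024 * (B4 * B4) in let m := n %/ K in
  K <= n -> exists g h r dl,
  [/\ 0 < m, 8 * (m + 1) <= g, 2048 * 100 * (n * m) <= g ^ 2, 120 <= g &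
  [/\ 2 * g * n <= h * h, 2 * g <= h, h <= r, 96 * (h * n) <= r * r &
  [/\ 256 * r <= n, 256 * (dl + (256 + 5) * m + 66 * r) <= n &
   2 * (g * n) + 2 * n + 6 * ((130 * r) * n) +
   2 * (266 * (r * n) + 2 * (m * (130 * r))) <= dl * dl]]].
Proof.
move=> ht B B4 K m Kn; pose k := n %/ B4; pose P := B * B * B * k.
exists k, (2 * (B * B) * k), (20 * P), (t * P).
have BE : B = 1024 * t by [].
have B4E : B4 = B * B * B * B by [].
have KE : K = 1024 * 1024 * (B4 * B4) by [].
have PE : P = B * B * B * k by [].
clearbody P K B4 B.
have t0 : 0 < t by apply: leq_trans ht.
have B0 : 512 * 10 <= B by rewrite BE; move: ht; clear; lia.
have B40 : 0 < B4 by rewrite B4E !muln_gt0 andbb andbb andbb; apply: leq_trans B0.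
have K0 : 0 < K by rewrite KE !muln_gt0 B40.
have m0 : 0 < m by rewrite divn_gt0.
have mK : m * K <= n by apply: leq_trunc_div.
have kB : k * B4 <= n by apply: leq_trunc_div.
have kB' : n < (k + 1) * B4 by rewrite addn1; apply: ltn_ceil.
have mk : 1024 * 1024 * B4 * m <= k.
  by rewrite leq_divRL //; apply: leq_trans mK; rewrite KE; clear; lia.
clearbody m k.
have m1k : 1024 * 1024 * m <= k.
  by apply: leq_trans mk; rewrite leq_mul2r; apply/orP; right; rewrite leq_pmulr.
have k120 : 1024 * 1024 <= k by apply: leq_trans m1k; rewrite leq_pmulr.
have k0 : 0 < k by apply: leq_trans k120.
have n2' : n <= 2 * (k * B4) by have := leq_mul k0 (leqnn B4); move: kB'; clear; lia.
have n2 : n <= 2 * (B * P) by apply: leq_trans n2' _; rewrite PE B4E; clear; lia.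
have n1 : B * P <= n by apply: leq_trans kB; rewrite PE B4E; clear; lia.
have kP : k <= P by rewrite PE leq_pmull // !muln_gt0 andbb andbb; apply: leq_trans B0.
have P0 : 0 < P by apply: leq_trans kP.
have mn : m <= n.
  apply: leq_trans mK; rewrite leq_pmulr //.
split=> //.
- by move: m1k k120; clear; lia.
- rewrite !expnS expn0 muln1.
  by have := leq_mul n2' (leqnn m); have := leq_mul (leqnn k) mk; clear; lia.
- by apply: leq_trans k120.
split.
- have := leq_mul (leqnn (2 * k)) n2'; rewrite B4E; clear; lia.
- rewrite leq_mul2r; apply/orP; right; rewrite leq_pmulr // muln_gt0 andbb.
  by apply: leq_trans B0.
- have : 1 <= B by apply: leq_trans B0.
  by move=> /leq_mul/(_ (leqnn (B * B * k))); rewrite PE; clear; lia.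
- have E : B * B * k * (B * P) = P * P by rewrite {2}PE; clear; lia.
  by have := leq_mul (leqnn (B * B * k)) n2; move: E; clear; lia.
have tP := leq_mul ht (leqnn P).
have mP : m <= P by apply: leq_trans kP; move: m1k; clear; lia.
split.
- by have := leq_mul B0 (leqnn P); move: n1; clear; lia.
- by move: n1 tP mP; rewrite BE -mulnA; clear; lia.
(* Every term on the left is at most a constant times P n <= 2 B P^2 = 2048 t P^2. The constants add
   up to less than 40000, and t >= 4096 * 4096 * 8 makes t^2 P^2 larger. *)
have h1 := leq_mul kP (leqnn n); have h2 := leq_mul P0 (leqnn n).
have h3 := leq_mul mn (leqnn P); have h4 := leq_mul (leqnn P) n2.
have h5 := leq_mul (leqnn (t * P)) tP.
have h6 : P * (2 * (B * P)) = 2048 * (t * P * P) by rewrite BE; clear; lia.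
by move: h1 h2 h3 h4 h5 h6; clear; lia.
Qed.

Theorem mainTheorem1 :
  exists (mu : rat) (n0 : nat), (0 < mu)%R /\
    forall (n : nat), n0 <= n ->
    forall (G : rel 'I_n), simple_graph G -> dirac G ->
    forall (C : eqType) (col : {set 'I_n} -> C),
      bounded_colouring G col (mu * n%:R)%R ->
      exists s : seq 'I_n, rainbow_hamilton_cycle G col s.
Proof.
have [t ht] : exists t, 4096 * 4096 * 8 <= t by exists (4096 * 4096 * 8); apply: leqnn.
pose B := 1024 * t; pose B4 := B * B * B * B; pose K := 1024 * 1024 * (B4 * B4).
have K0 : 0 < K.
  have t0 : 0 < t by apply: leq_trans ht.
  by rewrite !muln_gt0 t0.
(* For mu = 1 / K a colour class has at most m = n %/ K edges, and n >= K ensures m > 0. *)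
exists (K%:R^-1)%R, K; split; first by rewrite Num.Theory.invr_gt0 Num.Theory.ltr0n.
move=> n Kn G [Gs Gi] dG C col colb.
pose m := n %/ K.
have [g [h [r [dl [m0 gm gbig g120 [gh glh hr hnr [rn dlr dlbig]]]]]]] := @scale_choice t n ht Kn.
rewrite -/B -/B4 -/K -/m in m0 gm gbig dlr dlbig.
have colm c : #|[set e in gedges G | col e == c]| <= m.
  rewrite /m leq_divRL // -(Num.Theory.ler_nat rat) GRing.natrM.
  by rewrite -Num.Theory.ler_pdivlMr ?Num.Theory.ltr0n // GRing.mulrC; apply: colb.
have dG' x : n <= 2 * \sum_y G x y by rewrite card_sum; apply: dG.
have cn : #|'I_n| = n := card_ord n.
move: (@dirac_rainbow 'I_n {set 'I_n} G (recolour (gedges G) col) m).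
rewrite cn => main.
have [s [us ss cs rs]] := main g h r dl Gs Gi (recolour_class colm) dG' m0 gm gbig g120 gh glh hr hnr rn dlr dlbig.
rewrite cn in ss; exists s; split.
  by split=> //; lia.
rewrite /cycle_edges -map_comp; apply: map_uniq_coarser rs => p q; exact: recolour_coarser.
Qed.
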